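(* For the numerical solution of Scheme L-SAV (defined in the context), the following error estimate holds: $$\|e^{n}_\phi\|^2_{H^1}+\|e^{n}_r\|^2_{L^2}\le C\,\Delta t^4,\qquad 0\le n\le N,$$ where $C$ is a generic constant independent of $\Delta t$.
   Context: Setting. $\Omega\subset\mathbb R^2$ is open, connected and bounded with sufficiently smooth boundary, such that the Sobolev inequalities $\|u\|_{L^4}^2\le C\|u\|_{L^2}\|u\|_{H^1}$ and $\|u\|_{L^\infty}^2\le C\|u\|_{H^1}\|u\|_{H^2}$ hold. The time interval is $[0,T]$, $\Delta t=T/N$, $t_n=n\Delta t$. $\gamma_1,\gamma_2$ are model parameters, $f(\phi)=\gamma_2\phi^2(1-\phi)^2$, and the mobility is set to $M\equiv1$. Auxiliary quantities. $E_1(\phi)=\int_\Omega[f(\phi)-\gamma_2\phi^2]\,d\mathbf x$; the constant $C_0$ is chosen such that $E_1(\phi)\ge -C_0$; $U=\delta E_1/\delta\phi$; $r=\sqrt{E_1(\phi)+C_0}$ (a scalar); $s(\phi)=\dfrac{U(\phi)}{2\sqrt{E_1(\phi)+C_0}}$. Exact problem (Allen-Cahn equation with a Lagrange multiplier). $\phi(\mathbf x,t)$ solves $\phi_t=-(\mu-L)$ in $\Omega$ for $t>0$, $\partial\phi/\partial n=0$ on $\partial\Omega$, with given initial value $\phi(\mathbf x,0)$, where $\mu=-\gamma_1\Delta\phi+f'(\phi)$, $f'(\phi)=2\gamma_2\phi+2rs$, and $L=\frac1{|\Omega|}\int_\Omega\mu\,d\mathbf x$. Regularity assumption on the exact solution: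 $\phi\in L^\infty(0,T;H^2(\Omega))\cap L^\infty(0,T;W^{1,\infty}(\Omega))$ and $\phi_t\in L^\infty(0,T;L^\infty(\Omega))\cap L^2(0,T;H^1(\Omega))$. Notation: $a^{n+1/2}=\frac12(a^{n+1}+a^n)$ and $\overline a^{n+1/2}=\frac32a^n-\frac12a^{n-1}$; $s^n=s(\phi^n)$. Scheme L-SAV (scalar auxiliary variable, linear Crank-Nicolson, semi-discrete in time). Given the initial condition $\phi^0$, $r^0$ is calculated from $\phi^0$, and $\phi^1,r^1$ are computed by a first order scheme. Having computed the values at steps $n-1$ and $n$, compute those at step $n+1$ (with the homogeneous Neumann boundary condition of the model) from $$\frac{\phi^{n+1}-\phi^{n}}{\Delta t}=\gamma_1\Delta\phi^{n+1/2}-2\gamma_2\phi^{n+1/2}-2r^{n+1/2}\overline s^{n+1/2}+\frac1{|\Omega|}\int_\Omega\big(2\gamma_2\phi^{n+1/2}+2r^{n+1/2}\overline s^{n+1/2}\big)d\mathbf x,$$ $$r^{n+1}-r^n=\int_\Omega\overline s^{n+1/2}(\phi^{n+1}-\phi^n)\,d\mathbf x.$$ Truncation: substituting the exact solution into these difference equations (Taylor expansion) leaves truncation errors of order $O(\Delta t^2)$ in each of them. Errors: $e^n_\phi=\phi(t_n)-\phi^n$, $e_r^n=r(t_n)-r^n$, with exact values $\phi(t_n),r(t_n)$; scalars are regarded as constant functions on $\Omega$ in the $L^2(\Omega)$ norm. *)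

(* Defs.v *)
From HB Require Import structures.
From mathcomp Require Import all_boot all_order all_algebra.
From mathcomp Require Import all_classical all_reals all_analysis.

Set Implicit Arguments.
Unset Strict Implicit.
Unset Printing Implicit Defensive.

Import Order.TTheory GRing.Theory Num.Theory.
Import numFieldNormedType.Exports.

Local Open Scope classical_set_scope.
Local Open Scope ring_scope.

(* ** The plane and its domains *)

Notation plane R := (measurableTypeR R * measurableTypeR R)%type.

Notation leb R := (@lebesgue_measure R).
Notation leb2 R := (@lebesgue_measure R \x @lebesgue_measure R)%E.

Definition dir {R : realType} (i : 'I_2) : R * R :=
  if i == ord0 then (1, 0) else (0, 1).

Fixpoint Ck {R : realType} (k : nat) (u : R * R -> R) : Prop :=
  match k with
  | 0%N => continuous u
  | j.+1 => continuous u /\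
      forall i : 'I_2, (forall x, derivable u x (dir i)) /\
                       Ck j (fun x => 'D_(dir i) u x)
  end.

(* Near every boundary point O is the negativity set of a C^k function with
   nonvanishing gradient; equivalently, O lies locally on one side of the graph
   of a C^k function. *)
Definition Ck_boundary {R : realType} (k : nat) (O : set (R * R)) : Prop :=
  forall p, (closure O `\` O) p ->
  exists rho : R * R -> R,
    [/\ Ck k rho, exists i : 'I_2, 'D_(dir i) rho p != 0
      & \forall x \near p, O x <-> rho x < 0].

(* ** Lebesgue and Sobolev spaces on O *)

Definition inLp {R : realType} (O : set (plane R)) (p : \bar R)
    (u : plane R -> R) : Prop :=
  u \_ O \in Lfun (leb2 R) p.

Definition Lpnorm {R : realType} (O : set (plane R)) (p : \bar R)
    (u : plane R -> R) : \bar R :=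
  'N[leb2 R]_p[EFin \o u \_ O]%E.

Definition test_function {R : realType} (O : set (R * R))
    (psi : R * R -> R) : Prop :=
  (forall k, Ck k psi) /\
  exists K : set (R * R), [/\ compact K, K `<=` O & forall x, ~ K x -> psi x = 0].

Definition loc_integrable {R : realType} (O : set (R * R)) (u : R * R -> R) :
    Prop :=
  measurable_fun (O : set (plane R)) (u : plane R -> R) /\
  forall K : set (R * R), compact K -> K `<=` O ->
    (leb2 R).-integrable (K : set (plane R)) (EFin \o (u : plane R -> R)).

Definition weak_partial {R : realType} (O : set (plane R)) (i : 'I_2)
    (u g : plane R -> R) : Prop :=
  [/\ loc_integrable O u, loc_integrable O g
    & forall psi : R * R -> R, test_function O psi ->
        \int[leb2 R]_(x in O) (u x * 'D_(dir i) psi x)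
        = - \int[leb2 R]_(x in O) (g x * psi x)].

(* A weak partial derivative is unique up to a null set; [pd] picks one. *)
Definition pd {R : realType} (O : set (plane R)) (i : 'I_2)
    (u : plane R -> R) : plane R -> R :=
  xget (cst 0) [set g | weak_partial O i u g].

Definition inW1p {R : realType} (O : set (plane R)) (p : \bar R)
    (u : plane R -> R) : Prop :=
  inLp O p u /\
  forall i, weak_partial O i u (pd O i u) /\ inLp O p (pd O i u).

Definition inH1 {R : realType} (O : set (plane R)) (u : plane R -> R) : Prop :=
  inW1p O 2%:E u.

Definition inH2 {R : realType} (O : set (plane R)) (u : plane R -> R) : Prop :=
  inH1 O u /\ forall i, inH1 O (pd O i u).

Definition H1norm {R : realType} (O : set (plane R)) (u : plane R -> R) :
    \bar R :=
  ((Lpnorm O 2%:E u ^+ 2 + \sum_(i < 2) Lpnorm O 2%:E (pd O i u) ^+ 2)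
     `^ (2^-1))%E.

Definition H2norm {R : realType} (O : set (plane R)) (u : plane R -> R) :
    \bar R :=
  ((H1norm O u ^+ 2 +
    \sum_(i < 2) \sum_(j < 2) Lpnorm O 2%:E (pd O j (pd O i u)) ^+ 2)
     `^ (2^-1))%E.

Definition W1oonorm {R : realType} (O : set (plane R)) (u : plane R -> R) :
    \bar R :=
  (Lpnorm O +oo u + \sum_(i < 2) Lpnorm O +oo (pd O i u))%E.

Definition laplacian {R : realType} (O : set (plane R)) (u : plane R -> R) :
    plane R -> R :=
  fun x => \sum_(i < 2) pd O i (pd O i u) x.

(* The condition du/dn = 0 on the boundary for u in H2, through Green's
   formula: the boundary integral of (du/dn) v vanishes for all v in H1. *)
Definition neumann {R : realType} (O : set (plane R)) (u : plane R -> R) :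
    Prop :=
  forall v, inH1 O v ->
    \int[leb2 R]_(x in O) (laplacian O u x * v x)
    = - \int[leb2 R]_(x in O) (\sum_(i < 2) pd O i u x * pd O i v x).

Definition sobolev_L4 {R : realType} (O : set (plane R)) : Prop :=
  exists C : R, forall u, inH1 O u ->
    (Lpnorm O 4%:E u ^+ 2 <= C%:E * Lpnorm O 2%:E u * H1norm O u)%E.

Definition sobolev_Loo {R : realType} (O : set (plane R)) : Prop :=
  exists C : R, forall u, inH2 O u ->
    (Lpnorm O +oo u ^+ 2 <= C%:E * H1norm O u * H2norm O u)%E.

(* Every degree of boundary smoothness k >= 1, the least one for which the
   normal exists, is covered by k = 1. *)
Definition smooth_domain {R : realType} (O : set (plane R)) : Prop :=
  [/\ [/\ open (O : set (R * R)), connected (O : set (R * R)),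
          bounded_set (O : set (R * R)) & O !=set0],
      Ck_boundary 1 O, sobolev_L4 O & sobolev_Loo O].

Definition vol {R : realType} (O : set (plane R)) : R := fine (leb2 R O).

Definition mean {R : realType} (O : set (plane R)) (u : plane R -> R) : R :=
  (vol O)^-1 * \int[leb2 R]_(x in O) u x.

(* The space L^p(0,T; X), where X is given by its membership predicate and its
   norm. Strong measurability in time is to be given separately, as joint
   measurability in (t, x). *)
Definition Lp_time {R : realType} (T : R) (p : \bar R)
    (X : (plane R -> R) -> Prop) (normX : (plane R -> R) -> \bar R)
    (u : R -> plane R -> R) : Prop :=
  {ae leb R, forall t, 0 < t < T -> X (u t)} /\
  ('N[leb R]_p[(fun t => if (0 < t < T)%R then normX (u t) else 0)] < +oo)%E.

(* ** The Allen-Cahn model and its scalar auxiliary variable *)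

Definition fpot {R : realType} (g2 z : R) : R := g2 * z ^+ 2 * (1 - z) ^+ 2.

Definition e1_density {R : realType} (g2 z : R) : R := fpot g2 z - g2 * z ^+ 2.

Definition E1 {R : realType} (O : set (plane R)) (g2 : R) (u : plane R -> R) :
    R :=
  \int[leb2 R]_(x in O) e1_density g2 (u x).

(* The density of E1 involves no gradient, so its variational derivative
   is the derivative of the density. *)
Definition U {R : realType} (g2 : R) (u : plane R -> R) : plane R -> R :=
  fun x => derive1 (e1_density g2) (u x).

Definition rfun {R : realType} (O : set (plane R)) (g2 C0 : R)
    (u : plane R -> R) : R :=
  Num.sqrt (E1 O g2 u + C0).

Definition sfun {R : realType} (O : set (plane R)) (g2 C0 : R)
    (u : plane R -> R) : plane R -> R :=
  fun x => U g2 u x / (2 * Num.sqrt (E1 O g2 u + C0)).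

(* When E1 u + C0 > 0, f'(u) = 2 g2 u + U u = 2 g2 u + 2 r s. *)
Definition mu {R : realType} (O : set (plane R)) (g1 g2 : R)
    (u : plane R -> R) : plane R -> R :=
  fun x => - g1 * laplacian O u x + derive1 (fpot g2) (u x).

(* phit is the time derivative of phi; the integral form selects the
   representative of phi that is continuous in time, so that the values phi(t)
   make sense for every t. *)
Definition time_derivative {R : realType} (O : set (plane R)) (T : R)
    (phi phit : R -> plane R -> R) : Prop :=
  forall s t, 0 <= s -> s <= t -> t <= T ->
    {ae leb2 R, forall x, O x ->
       phi t x - phi s x = \int[leb R]_(tau in `[s, t]) phit tau x}.

Definition jointly_measurable {R : realType} (O : set (plane R)) (T : R)
    (u : R -> plane R -> R) : Prop :=
  measurable_fun (`]0, T[ `*` O : set (measurableTypeR R * plane R))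
    (fun z => u z.1 z.2).

(* Positivity of E1 + C0 along the solution is what makes s well defined. *)
Definition AC_solution {R : realType} (O : set (plane R)) (g1 g2 T C0 : R)
    (phi phit : R -> plane R -> R) : Prop :=
  [/\ time_derivative O T phi phit,
      forall t, 0 <= t <= T -> inH2 O (phi t) /\ 0 < E1 O g2 (phi t) + C0,
      forall t, 0 < t <= T -> neumann O (phi t)
    & {ae leb R, forall t, 0 < t < T ->
        {ae leb2 R, forall x, O x ->
          phit t x =
          - (mu O g1 g2 (phi t) x - mean O (mu O g1 g2 (phi t)))}}].

Definition regular {R : realType} (O : set (plane R)) (T : R)
    (phi phit : R -> plane R -> R) : Prop :=
  [/\ jointly_measurable O T phi /\ jointly_measurable O T phit,
      Lp_time T +oo (inH2 O) (H2norm O) phi,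
      Lp_time T +oo (inW1p O +oo) (W1oonorm O) phi,
      Lp_time T +oo (inLp O +oo) (Lpnorm O +oo) phit
    & Lp_time T 2%:E (inH1 O) (H1norm O) phit].

(* ** The scheme *)

Definition mid {R : realType} (a : nat -> R) (n : nat) : R :=
  (a n.+1 + a n) / 2.

Definition extrap {R : realType} (a : nat -> R) (n : nat) : R :=
  3 / 2 * a n - 1 / 2 * a n.-1.

Definition phi_mid {R : realType} (phi : nat -> plane R -> R) (n : nat) :
    plane R -> R :=
  fun x => mid (phi^~ x) n.

Definition s_bar {R : realType} (O : set (plane R)) (g2 C0 : R)
    (phi : nat -> plane R -> R) (n : nat) : plane R -> R :=
  fun x => extrap (fun k => sfun O g2 C0 (phi k) x) n.

(* Left-hand side minus right-hand side of the two difference equations. *)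
Definition phi_residual {R : realType} (O : set (plane R)) (g1 g2 C0 dt : R)
    (phi : nat -> plane R -> R) (r : nat -> R) (n : nat) : plane R -> R :=
  fun x =>
    (phi n.+1 x - phi n x) / dt
    - (g1 * laplacian O (phi_mid phi n) x
       - 2 * g2 * phi_mid phi n x
       - 2 * mid r n * s_bar O g2 C0 phi n x
       + mean O (fun y => 2 * g2 * phi_mid phi n y
                          + 2 * mid r n * s_bar O g2 C0 phi n y)).

Definition r_residual {R : realType} (O : set (plane R)) (g2 C0 : R)
    (phi : nat -> plane R -> R) (r : nat -> R) (n : nat) : R :=
  (r n.+1 - r n)
  - \int[leb2 R]_(x in O) (s_bar O g2 C0 phi n x * (phi n.+1 x - phi n x)).

Definition LSAV_steps {R : realType} (O : set (plane R)) (g1 g2 C0 dt : R)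
    (N : nat) (phi : nat -> plane R -> R) (r : nat -> R) : Prop :=
  (forall n, (1 <= n <= N)%N -> inH2 O (phi n) /\ neumann O (phi n)) /\
  (forall n, (1 <= n < N)%N ->
     {ae leb2 R, forall x, O x -> phi_residual O g1 g2 C0 dt phi r n x = 0} /\
     r_residual O g2 C0 phi r n = 0).

(* Psi dt maps the values at a given time to the values one step later. *)
Definition LSAV_start {R : realType} (O : set (plane R)) (g2 C0 dt : R)
    (Psi : R -> (plane R -> R) * R -> (plane R -> R) * R)
    (phi0 : plane R -> R) (phi : nat -> plane R -> R) (r : nat -> R) : Prop :=
  [/\ phi 0%N = phi0, r 0%N = rfun O g2 C0 (phi 0%N)
    & (phi 1%N, r 1%N) = Psi dt (phi 0%N, r 0%N)].

(* First order of a one-step scheme: one step from the exact initial values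
   commits an error O(dt^2). *)
Definition first_order {R : realType} (O : set (plane R)) (g2 T C0 : R)
    (phi : R -> plane R -> R)
    (Psi : R -> (plane R -> R) * R -> (plane R -> R) * R) : Prop :=
  exists K : R, forall dt, 0 < dt <= T ->
    let start := Psi dt (phi 0, rfun O g2 C0 (phi 0)) in
    (H1norm O (phi dt \- start.1)%R
     + Lpnorm O 2%:E (cst (rfun O g2 C0 (phi dt) - start.2)%R)
     <= (K * dt ^+ 2)%:E)%E.

(* The equation for r is compared with r_t = int s phi_t, hence its residual
   is divided by dt before it is required to be O(dt^2). *)
Definition truncation_O2 {R : realType} (O : set (plane R))
    (g1 g2 T C0 : R) (phi : R -> plane R -> R) : Prop :=
  exists K : R, forall N n : nat, (1 <= n < N)%N ->
    let dt := T / N%:R in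
    let phiE := fun k : nat => phi (k%:R * dt) in
    let rE := fun k : nat => rfun O g2 C0 (phiE k) in
    (Lpnorm O 2%:E (phi_residual O g1 g2 C0 dt phiE rE n)
     <= (K * dt ^+ 2)%:E)%E /\
    `|r_residual O g2 C0 phiE rE n / dt| <= K * dt ^+ 2.

(* Main.v *)
(** The increment [del = e^(n+1) - e^n] of the error is a test function for the
error equation.  Write [z] for the error of the extrapolated [s], [rho] for the
error of [r] and [Y = g1/2 |grad e|^2 + g2 |e|^2 + rho^2].  The equation for [r]
turns the pairing of [del] with the numerical [s], for which no bound is known,
into a difference of [rho^2], which gives
  [|del|^2/dt + Y_(n+1) - Y_n = - 2 r (z, del) + 2 rho^(n+1/2) ((z, dphi) + res)
     + m (1, del) + (tau, del)].
Only the exact solution is bounded a priori: it is bounded by [M] pointwise, and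
[E1 + C0] stays above some [c > 0] because it is continuous in time.  While the
H^1 error is small, [|s(phi) - s(phi^n)| <= C (eta + |e| + |e|^3)] with
[eta = int (|e| + e^4)], and the cubic term is paired with [del] through the L^4
Sobolev inequality.  Everything is absorbed as long as [|e|_(H^1)^2 <= dt], and
the discrete Gronwall inequality then yields [Y = O(dt^4)], which for small [dt]
is below that threshold.  For the finitely many remaining values of [N], the
scheme itself dissipates its energy, and its first step is fixed by [Psi]. *)

Require Import Defs.
From HB Require Import structures.
From mathcomp Require Import all_boot all_order all_algebra.
From mathcomp Require Import all_classical all_reals all_analysis.
From mathcomp Require Import measurable_realfun ess_sup_inf.
From mathcomp Require Import ring lra.

Import Order.TTheory GRing.Theory Num.Theory.
Import numFieldNormedType.Exports.

Set Implicit Arguments.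
Unset Strict Implicit.
Unset Printing Implicit Defensive.

Local Open Scope classical_set_scope.
Local Open Scope ring_scope.

(** * Integrals over a set of finite measure *)

Section finite_measure_integrals.
Context d (T : measurableType d) (R : realType).
Variables (mu : {measure set T -> \bar R}) (D : set T).
Hypotheses (mD : measurable D) (finD : (mu D < +oo)%E).
Implicit Types (u v f g : T -> R).

(** No quantitative pointwise bound of the numerical solution is available: its membership in H^2
    only makes it essentially bounded step by step, which is enough to make every nonlinear term
    integrable. The threshold on |e|_(H^1)^2 has two parts. A constant part keeps E1 + C0 of the
    numerical solution away from 0, so that the denominator of s is controlled. The part dt serves
    the cubic term: the L^4 inequality produces the H^1 norm of del, which the dissipation
    |del|^2/dt does not see; it is bounded by the errors at two levels, and the missing factor dt
    has to come from the size of e. The term m (1, del) is harmless because integrating the error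
    equation leaves (1, del) = dt int tau: the Laplacians integrate to 0 by the Neumann condition
    and the multiplier cancels the rest. Weak derivatives are chosen representatives, so their
    linearity and the zero gradient of constants rest on uniqueness almost everywhere, hence on the
    fundamental lemma with explicit bump functions. *)

Definition ess_bounded u :=
  measurable_fun D u /\ exists M, {ae mu, forall x, D x -> `|u x| <= M}.

Definition sq_integrable u :=
  measurable_fun D u /\ mu.-integrable D (EFin \o (fun x => u x ^+ 2)).

Lemma integrable_EFin_measurable u :
  mu.-integrable D (EFin \o u) -> measurable_fun D u.
Proof. by move=> /(measurable_int mu)/measurable_EFinP. Qed.

(** The integrand is replaced by max(f, 0), which is nonnegative everywhere and differs from f on a
    null set only. *)
Lemma ae_ge0_Rintegral f : mu.-integrable D (EFin \o f) ->
  {ae mu, forall x, D x -> 0 <= f x} -> 0 <= \int[mu]_(x in D) f x.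
Proof.
move=> fi f0; apply: fine_ge0.
have mf := measurable_int mu fi.
rewrite (ae_eq_integral (fun x => maxe (f x)%:E 0%E)) //.
- by apply: integral_ge0 => x _; rewrite le_max lexx orbT.
- by apply: measurable_maxe => //.
- by apply: filterS f0 => x + Dx; move=> /(_ Dx) fx; rewrite max_l// lee_fin.
Qed.

Lemma ae_le_Rintegral f g : mu.-integrable D (EFin \o f) ->
  mu.-integrable D (EFin \o g) -> {ae mu, forall x, D x -> f x <= g x} ->
  \int[mu]_(x in D) f x <= \int[mu]_(x in D) g x.
Proof.
move=> fi gi fg; rewrite -subr_ge0 -RintegralB//; apply: ae_ge0_Rintegral.
  rewrite (_ : _ \o _ = (EFin \o g) \- (EFin \o f))%E; last exact/funext.
  exact: integrableB.
by apply: filterS fg => x + Dx; rewrite subr_ge0; exact.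
Qed.

Lemma ae_eq_Rintegral f g : measurable_fun D f -> measurable_fun D g ->
  {ae mu, forall x, D x -> f x = g x} ->
  \int[mu]_(x in D) f x = \int[mu]_(x in D) g x.
Proof.
move=> mf mg fg; congr fine; apply: ae_eq_integral => //.
- exact/measurable_EFinP.
- exact/measurable_EFinP.
- by apply: filterS fg => x + Dx; move=> /(_ Dx) ->.
Qed.

Lemma ae_eq_integrable f g : measurable_fun D g ->
  {ae mu, forall x, D x -> f x = g x} ->
  mu.-integrable D (EFin \o f) -> mu.-integrable D (EFin \o g).
Proof.
move=> mg fg fi; apply/integrableP; split; first exact/measurable_EFinP.
have [mf foo] := integrableP _ _ _ fi.
rewrite (ae_eq_integral (fun x => `|(EFin \o f) x|)%E)//.
- by apply: measurableT_comp => //; exact/measurable_EFinP.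
- exact: measurableT_comp.
- by apply: filterS fg => x + Dx; move=> /(_ Dx) /= ->.
Qed.

Lemma le_ae_integrable f g : measurable_fun D f ->
  {ae mu, forall x, D x -> `|f x| <= g x} ->
  mu.-integrable D (EFin \o g) -> mu.-integrable D (EFin \o f).
Proof.
move=> mf fg gi; apply/integrableP; split; first exact/measurable_EFinP.
have [mg goo] := integrableP _ _ _ gi; apply: le_lt_trans goo.
apply: ae_ge0_le_integral => //.
- by apply: measurableT_comp => //; exact/measurable_EFinP.
- exact: measurableT_comp.
- apply: filterS fg => x + Dx; move=> /(_ Dx) /= fg; rewrite lee_fin.
  exact: le_trans (ler_norm _).
Qed.

Lemma integrableZ k f : mu.-integrable D (EFin \o f) ->
  mu.-integrable D (EFin \o (fun x => k * f x)).
Proof.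
move=> fi; rewrite (_ : _ \o _ = (fun x => k%:E * (EFin \o f) x)%E).
  exact: integrableZl.
exact/funext.
Qed.

Lemma integrableDr f g : mu.-integrable D (EFin \o f) ->
  mu.-integrable D (EFin \o g) -> mu.-integrable D (EFin \o (fun x => f x + g x)).
Proof. by move=> fi gi; exact: (integrableD mD fi gi). Qed.

Lemma integrableBr f g : mu.-integrable D (EFin \o f) ->
  mu.-integrable D (EFin \o g) -> mu.-integrable D (EFin \o (fun x => f x - g x)).
Proof.
move=> fi gi; apply: integrableDr => //.
rewrite (_ : _ \o _ = EFin \o (fun x => -1 * g x)); first exact: integrableZ.
by apply/funext => x /=; rewrite mulN1r.
Qed.

Lemma EFin_Rintegral f : mu.-integrable D (EFin \o f) ->
  (\int[mu]_(x in D) (f x)%:E = (\int[mu]_(x in D) f x)%:E)%E.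
Proof. by move=> fi; rewrite /Rintegral fineK//; exact: integrable_fin_num fi. Qed.

Lemma integrable_cstr k : mu.-integrable D (EFin \o (fun=> k)).
Proof.
apply: measurable_bounded_integrable => //.
exact: bounded_cst.
Qed.

Lemma ess_bounded_integrable u : ess_bounded u -> mu.-integrable D (EFin \o u).
Proof.
move=> [mu_ [M uM]]; apply: le_ae_integrable uM _ => //.
exact: integrable_cstr.
Qed.

Lemma ess_bounded_cst k : ess_bounded (fun=> k).
Proof. by split => //; exists `|k|; apply: aeW. Qed.

Lemma ess_boundedD u v : ess_bounded u -> ess_bounded v ->
  ess_bounded (fun x => u x + v x).
Proof.
move=> [mu_ [M uM]] [mv [N vN]]; split; first exact: measurable_funD.
exists (M + N); apply: filterS2 uM vN => x + + Dx => /(_ Dx) uM /(_ Dx) vN.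
by rewrite (le_trans (ler_normD _ _))// lerD.
Qed.

Lemma ess_boundedM u v : ess_bounded u -> ess_bounded v ->
  ess_bounded (fun x => u x * v x).
Proof.
move=> [mu_ [M uM]] [mv [N vN]]; split; first exact: measurable_funM.
exists (M * N); apply: filterS2 uM vN => x + + Dx => /(_ Dx) uM /(_ Dx) vN.
by rewrite normrM ler_pM.
Qed.

Lemma ess_boundedZ k u : ess_bounded u -> ess_bounded (fun x => k * u x).
Proof. exact/ess_boundedM/ess_bounded_cst. Qed.

Lemma ess_boundedB u v : ess_bounded u -> ess_bounded v ->
  ess_bounded (fun x => u x - v x).
Proof.
move=> bu bv; rewrite (_ : (fun x => _) = (fun x => u x + (-1) * v x)).
  exact/ess_boundedD/ess_boundedZ.
by apply/funext => x; rewrite mulN1r.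
Qed.

Lemma ess_boundedX n u : ess_bounded u -> ess_bounded (fun x => u x ^+ n).
Proof.
move=> bu; elim: n => [|n ih]; first exact: ess_bounded_cst.
rewrite (_ : (fun x => _) = (fun x => u x * u x ^+ n)).
  exact: ess_boundedM.
by apply/funext => x; rewrite exprS.
Qed.

Lemma ess_bounded_norm u : ess_bounded u -> ess_bounded (fun x => `|u x|).
Proof.
move=> [mu_ [M uM]]; split; first exact: measurableT_comp.
by exists M; apply: filterS uM => x + Dx => /(_ Dx); rewrite normr_id.
Qed.

Lemma ess_bounded_sq_integrable u : ess_bounded u -> sq_integrable u.
Proof.
by move=> bu; split; [case: bu|exact/ess_bounded_integrable/ess_boundedX].
Qed.

Lemma sq_integrableM u v : sq_integrable u -> sq_integrable v ->
  mu.-integrable D (EFin \o (fun x => u x * v x)).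
Proof.
move=> [mu_ iu] [mv iv].
apply: (@le_ae_integrable _ (fun x => u x ^+ 2 + v x ^+ 2)).
- exact: measurable_funM.
- apply: aeW => x Dx; rewrite ler_norml; apply/andP; split.
    by have := sqr_ge0 (u x + v x); have := sqr_ge0 (u x);
       have := sqr_ge0 (v x); nra.
  by have := sqr_ge0 (u x - v x); have := sqr_ge0 (u x);
     have := sqr_ge0 (v x); nra.
- exact: integrableDr.
Qed.

Lemma sq_integrable_integrable u :
  sq_integrable u -> mu.-integrable D (EFin \o u).
Proof.
move=> iu.
have := sq_integrableM iu (ess_bounded_sq_integrable (ess_bounded_cst 1)).
by under eq_fun do rewrite mulr1.
Qed.

Lemma sq_integrableZ k u : sq_integrable u -> sq_integrable (fun x => k * u x).
Proof.
move=> [mu_ iu]; split; first exact: measurable_funM.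
rewrite (_ : (fun x => _) = (fun x => k ^+ 2 * u x ^+ 2)).
  exact: integrableZ.
by apply/funext => x; rewrite exprMn.
Qed.

Lemma sq_integrableD u v : sq_integrable u -> sq_integrable v ->
  sq_integrable (fun x => u x + v x).
Proof.
move=> hu hv; have iuv := sq_integrableM hu hv.
have [mu_ iu] := hu; have [mv iv] := hv; split; first exact: measurable_funD.
rewrite (_ : (fun x => _) = (fun x => u x ^+ 2 + (2 * (u x * v x) + v x ^+ 2))).
  by do ?apply: integrableDr => //; exact: integrableZ.
by apply/funext => x; rewrite sqrrD; ring.
Qed.

Lemma sq_integrableB u v : sq_integrable u -> sq_integrable v ->
  sq_integrable (fun x => u x - v x).
Proof.
move=> hu hv; rewrite (_ : (fun x => _) = (fun x => u x + (-1) * v x)).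
  exact/sq_integrableD/sq_integrableZ.
by apply/funext => x; rewrite mulN1r.
Qed.

Lemma ae_eq_sq_integrable u v : measurable_fun D v ->
  {ae mu, forall x, D x -> u x = v x} -> sq_integrable u -> sq_integrable v.
Proof.
move=> mv uv [mu_ iu]; split => //; apply: ae_eq_integrable iu.
  exact: measurable_funX.
by apply: filterS uv => x + Dx => /(_ Dx) ->.
Qed.

Lemma Rintegral_sqr_ge0 u : 0 <= \int[mu]_(x in D) (u x ^+ 2).
Proof. by apply: Rintegral_ge0 => x _; exact: sqr_ge0. Qed.

(* Integrate (a u - b v)^2 >= 0 with a = int v^2 and b = int u v. *)
Lemma cauchy_schwarz_Rintegral u v : sq_integrable u -> sq_integrable v ->
  (\int[mu]_(x in D) (u x * v x)) ^+ 2 <=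
  \int[mu]_(x in D) (u x ^+ 2) * \int[mu]_(x in D) (v x ^+ 2).
Proof.
move=> hu hv; have iuv := sq_integrableM hu hv.
have [mu_ iu] := hu; have [mv iv] := hv.
set A := \int[mu]_(x in D) (u x ^+ 2); set B := \int[mu]_(x in D) (v x ^+ 2).
set C := \int[mu]_(x in D) (u x * v x).
have key a b : 0 <= a ^+ 2 * A + (- (2 * a * b) * C + b ^+ 2 * B).
  have := Rintegral_sqr_ge0 (fun x => a * u x - b * v x).
  rewrite (@eq_Rintegral _ _ _ _ _ (fun x => a ^+ 2 * u x ^+ 2 +
    (- (2 * a * b) * (u x * v x) + b ^+ 2 * v x ^+ 2))); last first.
    by move=> x _; ring.
  rewrite RintegralD//; last 2 first.
  - exact: integrableZ.
  - by apply: integrableDr; exact: integrableZ.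
  by rewrite RintegralD ?RintegralZl//; exact: integrableZ.
have B0 : 0 <= B := Rintegral_sqr_ge0 v.
have A0 : 0 <= A := Rintegral_sqr_ge0 u.
(* For B = 0 the choice a = C, b = A + 1 gives - C^2 (A + 2) >= 0, hence C = 0. *)
have [B00|B0'] := eqVneq B 0.
  have := key C (A + 1); have := sqr_ge0 C.
  by rewrite B00 !mulr0 addr0; nra.
have {}B0' : 0 < B by rewrite lt_neqAle eq_sym B0' B0.
have := key B C; rewrite (_ : _ + _ = B * (A * B - C ^+ 2)); last by ring.
by rewrite pmulr_rge0// subr_ge0.
Qed.

End finite_measure_integrals.

(** * Test functions and the fundamental lemma *)

Section plane_topology.
Context {R : realType}.
Implicit Types (O : set (R * R)).

Definition open_box (a b c d : R) : set (R * R) := `]a, b[ `*` `]c, d[.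

Definition closed_box (a b c d : R) : set (R * R) := `[a, b] `*` `[c, d].

Lemma compact_closed_box a b c d : compact (closed_box a b c d).
Proof. by apply: compact_setX; exact: segment_compact. Qed.

Lemma open_sub_closed_box a b c d : open_box a b c d `<=` closed_box a b c d.
Proof.
by move=> [x y] [/= hx hy]; split => /=; exact: subset_itv_oo_cc.
Qed.

(** Countability makes open sets measurable for the product sigma-algebra and lets almost everywhere
    statements be checked box by box. The closed box is asked to lie in O so that functions
    supported in it are test functions on O. *)
Lemma open_bigcup_rat_boxes O : open O ->
  O = \bigcup_(q in [set q : (rat * rat) * (rat * rat) |
      closed_box (ratr q.1.1) (ratr q.1.2) (ratr q.2.1) (ratr q.2.2) `<=` O])
    open_box (ratr q.1.1) (ratr q.1.2) (ratr q.2.1) (ratr q.2.2).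
Proof.
move=> oO; apply/seteqP; split => [[x y] Oxy|p [q qO] qp]; last first.
  exact/qO/open_sub_closed_box.
have /nbhs_ballP[e /= e0 be] : nbhs (x, y) O by exact: open_nbhs_nbhs.
have e20 : 0 < e / 2 by lra.
have [a /[!in_itv]/= ha] : exists q, ratr q \in `]x - e / 2, x[.
  by apply: rat_in_itvoo; lra.
have [b /[!in_itv]/= hb] : exists q, ratr q \in `]x, x + e / 2[.
  by apply: rat_in_itvoo; lra.
have [c /[!in_itv]/= hc] : exists q, ratr q \in `]y - e / 2, y[.
  by apply: rat_in_itvoo; lra.
have [d /[!in_itv]/= hd] : exists q, ratr q \in `]y, y + e / 2[.
  by apply: rat_in_itvoo; lra.
exists ((a, b), (c, d)) => /=; last first.
  split => /=; rewrite in_itv/=; apply/andP; split; lra.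
move=> [x' y'] [/=]; rewrite !in_itv/= => hx' hy'; apply: be.
by split => /=; rewrite /ball/= ltr_norml; apply/andP; split; lra.
Qed.

Lemma open_box_measurable a b c d :
  measurable (open_box a b c d : set (plane R)).
Proof. by apply: measurableX; exact: measurable_itv. Qed.

Lemma open_plane_measurable O : open O -> measurable (O : set (plane R)).
Proof.
move=> /open_bigcup_rat_boxes ->; rewrite bigcup_mkcond.
apply: countable_bigcupT_measurable => //.
by move=> q; case: ifPn => // _; exact: open_box_measurable.
Qed.

Lemma closed_plane_measurable O : closed O -> measurable (O : set (plane R)).
Proof.
move=> cO; rewrite -(setCK O); apply: measurableC.
by apply: open_plane_measurable; exact: closed_openC.
Qed.

Lemma compact_plane_measurable O : compact O -> measurable (O : set (plane R)).
Proof.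
move=> cO; apply: closed_plane_measurable; apply: compact_closed cO.
exact: norm_hausdorff.
Qed.

Lemma continuous_plane_measurable (f : R * R -> R) : continuous f ->
  measurable_fun setT (f : plane R -> R).
Proof.
move=> cf; apply: (measurability _ (RGenOpens.measurableE R)).
move=> _ [_ [a [b ->] <-]]; rewrite setTI; apply: open_plane_measurable.
by apply: open_comp => [x _|]; [exact: cf|exact: interval_open].
Qed.

(** Open boxes are stable under intersection, so this set of generators is one to which Dynkin
    induction applies. *)
Lemma measurable_plane_open_boxes :
  @measurable _ (plane R) = <<s [set B | exists a b c d, B = open_box a b c d] >>.
Proof.
apply/seteqP; split; last first.
  apply: smallest_sub; first exact: sigma_algebra_measurable.
  by move=> _ [a [b [c [d ->]]]]; exact: open_box_measurable.
set G := [set B | _].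
have opG (A : set (R * R)) : open A -> <<s G >> A.
  move=> /open_bigcup_rat_boxes ->; rewrite bigcup_mkcond.
  apply: (@countable_bigcupT_measurable _ (g_sigma_algebraType G)) => //.
  move=> q; case: ifPn => _; last exact: (@measurable0 _ (g_sigma_algebraType G)).
  by apply: sub_sigma_algebra; do 4 eexists.
have m1 : @measurable_fun _ _ (g_sigma_algebraType G) R setT
    (fst : R * R -> R).
  apply: (measurability _ (RGenOpens.measurableE R)).
  move=> _ [_ [a [b ->] <-]]; rewrite setTI; apply: opG.
  by apply: open_comp => [x _|]; [exact: cvg_fst|exact: interval_open].
have m2 : @measurable_fun _ _ (g_sigma_algebraType G) R setT
    (snd : R * R -> R).
  apply: (measurability _ (RGenOpens.measurableE R)).
  move=> _ [_ [a [b ->] <-]]; rewrite setTI; apply: opG.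
  by apply: open_comp => [x _|]; [exact: cvg_snd|exact: interval_open].
rewrite measurable_prod_measurableType.
apply: smallest_sub; first exact: smallest_sigma_algebra.
move=> _ [A mA] [B mB] <-.
rewrite (_ : A `*` B = (fst @^-1` A) `&` (snd @^-1` B)); last first.
  by apply/seteqP; split => -[x y].
apply: (@measurableI _ (g_sigma_algebraType G)).
  by rewrite -[X in measurable X]setTI; exact: m1.
by rewrite -[X in measurable X]setTI; exact: m2.
Qed.

End plane_topology.

(** * Smooth bump functions *)

Section smooth_bumps.
Context {R : realType}.
Implicit Types (f g p q : R -> R).

(** The derivative is carried as a witness, so that each closure property is an induction that
    exhibits the derivative. *)
Fixpoint C1k (k : nat) f : Prop :=
  match k with
  | 0%N => continuous f
  | j.+1 => exists df : R -> R, (forall x : R, is_derive x (1 : R) f (df x)) /\ C1k j df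
  end.

Lemma is_derive_continuous f df : (forall x : R, is_derive x 1 f (df x)) ->
  continuous f.
Proof.
move=> h x; apply: differentiable_continuous; apply/derivable1_diffP.
exact: (@ex_derive _ _ _ _ _ _ _ (h x)).
Qed.

Lemma C1k_continuous k f : C1k k f -> continuous f.
Proof. by case: k => [//|k [df [h _]]]; exact: is_derive_continuous h. Qed.

Lemma C1kS k f : C1k k.+1 f -> C1k k f.
Proof.
elim: k f => [f [df [h _]]|k ih f [df [h1 h2]]]; first exact: is_derive_continuous h.
by exists df; split => //; exact: ih.
Qed.

Lemma C1kD k f g : C1k k f -> C1k k g -> C1k k (fun x => f x + g x).
Proof.
elim: k f g => [f g cf cg x|k ih f g [df [hf Cf]] [dg [hg Cg]]].
  by apply: cvgD; [exact: cf|exact: cg].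
exists (fun x => df x + dg x); split; last exact: ih.
by move=> x; exact: is_deriveD.
Qed.

Lemma C1kZ k c f : C1k k f -> C1k k (fun x => c * f x).
Proof.
elim: k f => [f cf x|k ih f [df [hf Cf]]].
  by apply: cvgM; [exact: cvg_cst|exact: cf].
exists (fun x => c * df x); split; last exact: ih.
by move=> x; exact: is_deriveZ.
Qed.

Lemma C1kM k f g : C1k k f -> C1k k g -> C1k k (fun x => f x * g x).
Proof.
elim: k f g => [f g cf cg x|k ih f g Cf Cg].
  by apply: cvgM; [exact: cf|exact: cg].
have Cf' := C1kS Cf; have Cg' := C1kS Cg.
have [df [hf Cdf]] := Cf; have [dg [hg Cdg]] := Cg.
exists (fun x => f x * dg x + g x * df x); split; last by apply: C1kD; exact: ih.
by move=> x; exact: is_deriveM.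
Qed.

Lemma is_derive_affine (c d x : R) : is_derive x 1 (fun y => c * y + d) c.
Proof.
have h : is_derive x (1 : R) (fun y => c *: y + cst d y) (c *: 1 + 0).
  by apply: is_deriveD.
by move: h; rewrite addr0 [_ *: _]mulr1.
Qed.

Lemma C1k_affine k c d f : C1k k f -> C1k k (fun x => f (c * x + d)).
Proof.
elim: k f => [f cf x|k ih f [df [hf Cf]]].
  apply: (@continuous_comp _ _ _ (fun x => c * x + d) f); last exact: cf.
  by apply: (@is_derive_continuous _ (fun=> c)) => y; exact: is_derive_affine.
exists (fun x => c * df (c * x + d)); split; last exact/C1kZ/ih.
move=> x; rewrite mulrC.
exact: (is_derive1_comp (hf _) (is_derive_affine _ _ _)).
Qed.

(* The vanishing at 0 of all derivatives of exp(-1/x) reduces to the fact that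
   this family spans a space closed under differentiation. *)
Definition flat (n : nat) (x : R) : R :=
  if 0 < x then x ^- n * expR (- x^-1) else 0.

(** With y = 1/x this is y^n <= n! e^y, a single term of the exponential series. *)
Lemma expR_inv_small n (x : R) : 0 < x -> x ^- n * expR (- x^-1) <= n`!%:R.
Proof.
move=> x0; rewrite expRN ler_pdivrMr ?expR_gt0// -exprVn.
have y0 : 0 < x^-1 by rewrite invr_gt0.
case: n => [|n].
  by rewrite expr0 fact0 mul1r; have := expR_ge1Dx x^-1; lra.
have := expR_ge1Dxn n (ltW y0); set y := x^-1; set E := expR y => h.
have F0 : (0 : R) < (n.+1)`!%:R by rewrite ltr0n fact_gt0.
rewrite mulrC -ler_pdivrMr//; apply: le_trans h; lra.
Qed.

Lemma flat_ge0 n x : 0 <= flat n x.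
Proof.
by rewrite /flat; case: ifPn => // x0; rewrite mulr_ge0 ?expR_ge0// invr_ge0 exprn_ge0// ltW.
Qed.

Lemma flat0_le1 x : flat 0 x <= 1.
Proof.
rewrite /flat; case: ifPn => // x0.
by have := expR_inv_small 0 x0; rewrite fact0.
Qed.

(** A quadratic bound is what makes the difference quotient at 0 tend to 0. *)
Lemma flat_le_sqr n x : flat n x <= (n.+2)`!%:R * x ^+ 2.
Proof.
rewrite /flat; case: ifPn => [x0|_]; last by rewrite mulr_ge0// sqr_ge0.
have x20 : 0 < x ^+ 2 by rewrite exprn_gt0.
rewrite -ler_pdivrMr//; have := expR_inv_small n.+2 x0.
by rewrite -addn2 exprD invfM mulrAC.
Qed.

Lemma is_derive_flat (n : nat) (x : R) :
  is_derive x (1 : R) (flat n) (- n%:R * flat n.+1 x + flat n.+2 x).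
Proof.
have [x0|x0|x0] := ltrgt0P x.
- have nx : \forall y \near x, 0 < y by exact: lt_nbhsr.
  apply: (@near_eq_is_derive R R R (fun y : R => y ^- n * expR (- y^-1)) (flat n) x 1).
    by near=> y; rewrite /flat ifT//; near: y.
  have xn0 : x != 0 by rewrite gt_eqF.
  have d1 : is_derive x 1 (fun y : R => y ^- n) (- n%:R * x ^- n.+1).
    have hX : is_derive x (1 : R) (fun y : R => y ^+ n) (n%:R * x ^+ n.-1).
      have := is_deriveX n (is_derive_id x (1 : R)); rewrite exprfctE.
      by move/is_derive_eq; apply; rewrite /GRing.scale/= mulr1.
    have h := @is_deriveV _ _ x _ 1 (expf_neq0 n xn0) hX.
    apply: (is_derive_eq h); rewrite /GRing.scale/= !mulNr; congr (- _).
    case: (n) => [|m /=]; first by rewrite !mul0r mulr0.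
    have a0 : x ^+ m != 0 by rewrite expf_neq0.
    rewrite !(exprS x); move: (m.+1%:R : R) (x ^+ m) a0 => k a a0.
    by field; rewrite a0 xn0.
  have d2 : is_derive x 1 (fun y : R => expR (- y^-1)) (expR (- x^-1) * x ^- 2).
    apply: (@is_derive1_comp _ expR (fun y => - y^-1)).
    have h := is_deriveN (@is_deriveV _ id x 1 1 xn0 (is_derive_id _ _)).
    by apply: (is_derive_eq h); rewrite /GRing.scale/= mulr1 opprK.
  apply: (is_derive_eq (is_deriveM d1 d2)).
  rewrite /flat x0 /GRing.scale/=; set E := expR _.
  have a0 : x ^+ n != 0 by rewrite expf_neq0.
  rewrite !(exprS x n.+1) !(exprS x n); move: (n%:R : R) (x ^+ n) a0 => k a a0.
  by field; rewrite a0 xn0.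
- have -> : - n%:R * flat n.+1 x + flat n.+2 x = 0.
    by rewrite /flat ltNge (ltW x0)/= mulr0 addr0.
  have nx : \forall y \near x, y < 0 by exact: lt_nbhsl.
  apply: (@near_eq_is_derive R R R (cst 0) (flat n) x 1).
    by apply: filterS nx => y y0; rewrite /flat ltNge (ltW y0).
rewrite x0 /flat ltxx mulr0 addr0 -/(flat n).
have key : (fun h => h^-1 *: ((flat n \o shift 0) (h *: (1 : R)) - flat n 0))
    @ (0 : R)^' --> (0 : R).
  apply/cvgrPdist_le => e e0.
  set K : R := (n.+2)`!%:R; have K0 : 0 < K by rewrite ltr0n fact_gt0.
  have eK : 0 < e / K by rewrite divr_gt0.
  near=> h.
  have h0 : h != 0 by near: h; exact: nbhs_dnbhs_neq.
  have hK : `|h| < e / K.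
    near: h; apply: nbhs_dnbhs; exists (e / K) => //= y.
    by rewrite /ball/= sub0r normrN.
  rewrite /= sub0r normrN addr0 /GRing.scale/= mulr1.
  rewrite (_ : flat n 0 = 0) ?subr0; last by rewrite /flat ltxx.
  rewrite normrM normfV ger0_norm ?flat_ge0//.
  rewrite mulrC ler_pdivrMr ?normr_gt0//.
  apply: le_trans (flat_le_sqr _ _) _; rewrite -/K -real_normK ?num_real//.
  move: hK; rewrite ltr_pdivlMr// => hK.
  by have := normr_ge0 h; nra.
by apply: DeriveDef; [apply/cvg_ex; exists 0|apply/cvg_lim].
Unshelve. all: by end_near. Qed.

Lemma C1k_flat k n : C1k k (flat n).
Proof.
elim: k n => [|k ih] n.
  exact: is_derive_continuous (is_derive_flat n).
exists (fun x => - n%:R * flat n.+1 x + flat n.+2 x); split.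
  exact: is_derive_flat.
by apply: C1kD; [exact: C1kZ|].
Qed.

(** A smooth function vanishing outside ]a, b[; the scaling by n + 1 pushes exp(-1/y) to 1, so that
    it tends pointwise to the indicator of ]a, b[. *)
Definition bump (a b : R) (n : nat) (x : R) : R :=
  flat 0 (n.+1%:R * x + - (n.+1%:R * a)) * flat 0 (- n.+1%:R * x + n.+1%:R * b).

Lemma C1k_bump k a b n : C1k k (bump a b n).
Proof. by apply: C1kM; apply: C1k_affine; exact: C1k_flat. Qed.

Lemma bump_ge0 a b n x : 0 <= bump a b n x.
Proof. by rewrite mulr_ge0 ?flat_ge0. Qed.

Lemma bump_le1 a b n x : bump a b n x <= 1.
Proof. by rewrite mulr_ile1 ?flat_ge0 ?flat0_le1. Qed.

Lemma bump_out a b n x : ~~ (a < x < b) -> bump a b n x = 0.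
Proof.
rewrite /bump /flat negb_and -!leNgt.
have n0 : (0 : R) < n.+1%:R by rewrite ltr0n.
by move=> /orP[xa|bx]; [rewrite ifF ?mul0r//|rewrite [X in _ * X]ifF ?mulr0//];
  apply/negbTE; rewrite -leNgt; nra.
Qed.

Lemma flat0_cvg1 (y : R) : 0 < y -> flat 0 (n.+1%:R * y) @[n --> \oo] --> (1 : R).
Proof.
move=> y0.
have -> : (fun n => flat 0 (n.+1%:R * y)) =
    expR \o (fun n => - (n.+1%:R^-1 * y^-1)).
  apply/funext => n /=; rewrite /flat mulr_gt0 ?ltr0n// expr0 invr1 mul1r.
  by rewrite invfM.
rewrite -[X in _ --> X]expR0.
apply: continuous_cvg; first exact: continuous_expR.
rewrite -[X in _ --> X]oppr0; apply: cvgN; rewrite -[X in _ --> X](mul0r y^-1).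
by apply: cvgMr_tmp; exact: cvg_harmonic.
Qed.

Lemma bump_cvg a b x : a < x < b -> bump a b n x @[n --> \oo] --> (1 : R).
Proof.
move=> /andP[ax xb]; rewrite -[X in _ --> X](mulr1 1).
have -> : (fun n => bump a b n x) = (fun n => flat 0 (n.+1%:R * (x - a)) *
    flat 0 (n.+1%:R * (b - x))).
  by apply/funext => n; rewrite /bump; congr (flat _ _ * flat _ _); ring.
by apply: cvgM; apply: flat0_cvg1; rewrite subr_gt0.
Qed.

(** Products of a function of the first coordinate and one of the second are closed under both
    partial derivatives, so the induction on k stays among them. *)
Lemma Ck_tensor k p q : C1k k p -> C1k k q ->
  Ck k (fun z : R * R => p z.1 * q z.2).
Proof.
have ctsor p' q' : continuous p' -> continuous q' ->
    continuous (fun z : R * R => p' z.1 * q' z.2).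
  move=> cp cq z; apply: cvgM.
    by apply: (@continuous_comp _ _ _ fst p'); [exact: cvg_fst|exact: cp].
  by apply: (@continuous_comp _ _ _ snd q'); [exact: cvg_snd|exact: cq].
elim: k p q => [p q cp cq|k ih p q Cp Cq]; first exact: ctsor.
split; first by apply: ctsor; [exact: C1k_continuous Cp|exact: C1k_continuous Cq].
have Cp' := C1kS Cp; have Cq' := C1kS Cq.
have [dp [hp Cdp]] := Cp; have [dq [hq Cdq]] := Cq.
have d0 (z : R * R) : is_derive z ((1, 0) : R * R) (fun z : R * R => p z.1 * q z.2) (dp z.1 * q z.2).
  have h := is_deriveM (hp z.1) (is_derive_cst (q z.2) z.1 1).
  (* Along (1, 0) the difference quotient is that of [p * cst (q z.2)] in one variable. *)
  have hF : (fun h : R => h^-1 *: (((fun z : R * R => p z.1 * q z.2) \o shift z)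
      (h *: ((1, 0) : R * R)) - p z.1 * q z.2)) =
      (fun h : R => h^-1 *: (((p * cst (q z.2)) \o shift z.1) (h *: (1 : R)) - (p * cst (q z.2)) z.1)).
    by apply/funext => h'; rewrite /= /GRing.scale/= /GRing.scale/= ?mulr0 ?add0r.
  case: h => h1 h2; split; rewrite /derivable /derive /= hF //.
  by apply: (etrans h2); rewrite /GRing.scale/= mulr0 ?add0r ?addr0 // mulrC.
have d1 (z : R * R) : is_derive z ((0, 1) : R * R) (fun z : R * R => p z.1 * q z.2) (p z.1 * dq z.2).
  have h := is_deriveM (is_derive_cst (p z.1) z.2 1) (hq z.2).
  have hF : (fun h : R => h^-1 *: (((fun z : R * R => p z.1 * q z.2) \o shift z)
      (h *: ((0, 1) : R * R)) - p z.1 * q z.2)) =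
      (fun h : R => h^-1 *: (((cst (p z.1) * q) \o shift z.2) (h *: (1 : R)) - (cst (p z.1) * q) z.2)).
    by apply/funext => h'; rewrite /= /GRing.scale/= /GRing.scale/= ?mulr0 ?add0r.
  case: h => h1 h2; split; rewrite /derivable /derive /= hF //.
  by apply: (etrans h2); rewrite /GRing.scale/= mulr0 ?add0r ?addr0 // mulrC.
move=> i; rewrite /dir; case: ifPn => _; split.
- by move=> z; case: (d0 z).
- rewrite (_ : (fun x => _) = (fun z => dp z.1 * q z.2)); first exact: ih.
  by apply/funext => z; case: (d0 z).
- by move=> z; case: (d1 z).
- rewrite (_ : (fun x => _) = (fun z => p z.1 * dq z.2)); first exact: ih.
  by apply/funext => z; case: (d1 z).
Qed.

End smooth_bumps.

(** * The fundamental lemma of the calculus of variations *)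

Section fundamental_lemma.
Context {R : realType}.
Implicit Types (O K : set (plane R)) (g : plane R -> R).
Local Notation lam := (leb2 R).

(** The function psi is bounded and vanishes off a compact K, so the product is dominated by a
    multiple of |g| on K, where g is integrable. *)
Lemma compact_plane_integrable_test O g psi : open (O : set (R * R)) ->
  measurable_fun O g ->
  (forall K : set (R * R), compact K -> K `<=` O ->
    lam.-integrable (K : set (plane R)) (EFin \o g)) ->
  test_function O psi ->
  lam.-integrable O (EFin \o (fun x => g x * psi x)).
Proof.
move=> oO mg ig [Cpsi [K [cK KO K0]]].
have mO := open_plane_measurable oO; have mK := compact_plane_measurable cK.
have cpsi : continuous psi := Cpsi 0%N.
have mpsi := continuous_plane_measurable cpsi.
have mpsiO : measurable_fun O (psi : plane R -> R).
  exact: measurable_funTS.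
have [M [_ hM]] : bounded_set (psi @` K).
  apply: compact_bounded; apply: continuous_compact => //.
  exact: continuous_subspaceT.
pose c := `|M| + 1.
have hc x : `|psi x| <= c.
  have [Kx|/K0 ->] := pselect (K x); last by rewrite normr0 addr_ge0.
  by apply: (hM c); [rewrite ltr_pwDr// ler_norm|exists x].
apply: (@le_ae_integrable _ _ _ _ _ mO _ (fun x => c * (`|g x| * \1_K x))).
- exact: measurable_funM.
- apply: aeW => x Ox; rewrite indicE; have [Kx|nKx] := boolP (x \in K).
    by rewrite mulr1 normrM mulrC ler_wpM2r.
  by move: nKx; rewrite notin_setE => /K0 ->; rewrite !mulr0 normr0.
- apply: integrableZ => //.
  have : lam.-integrable K (EFin \o (fun x => `|g x|)) by exact/integrable_norm/ig.
  move=> /(integrable_mkcond _ mK) h.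
  apply: (@integrableS _ _ _ _ setT) => //.
  apply: eq_integrable h => // x _ /=; rewrite patchE indicE.
  by case: ifPn => _; rewrite ?mulr1 ?mulr0.
Qed.

Definition tensor_bump (a b c d : R) n (z : R * R) : R :=
  bump a b n z.1 * bump c d n z.2.

Lemma tensor_bump_out a b c d n z :
  ~ open_box a b c d z -> tensor_bump a b c d n z = 0.
Proof.
move=> h; rewrite /tensor_bump; have [h1|h1] := boolP (a < z.1 < b); last first.
  by rewrite bump_out ?mul0r.
have [h2|h2] := boolP (c < z.2 < d); last by rewrite [X in _ * X]bump_out ?mulr0.
by exfalso; apply: h; split => /=; rewrite in_itv.
Qed.

Lemma test_function_tensor_bump O a b c d n :
  closed_box a b c d `<=` (O : set (R * R)) ->
  test_function O (tensor_bump a b c d n).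
Proof.
move=> hO; split; first by move=> k; apply: Ck_tensor; exact: C1k_bump.
exists (closed_box a b c d); split => //; first exact: compact_closed_box.
move=> x hx; apply: tensor_bump_out => /open_sub_closed_box; exact: hx.
Qed.

(** The tensor bumps of the box are test functions, at most 1, that tend to 1 on the box; dominated
    convergence passes their vanishing pairings with g to the limit. *)
Lemma Rintegral_open_box_eq0 O g a b c d : open (O : set (R * R)) ->
  measurable_fun O g ->
  (forall K : set (R * R), compact K -> K `<=` O ->
    lam.-integrable (K : set (plane R)) (EFin \o g)) ->
  (forall psi, test_function O psi -> \int[lam]_(x in O) (g x * psi x) = 0) ->
  closed_box a b c d `<=` (O : set (R * R)) ->
  (\int[lam]_(x in open_box a b c d) (g x)%:E = 0)%E.
Proof.
move=> oO mg ig g0 hO; set B := open_box a b c d.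
have mO := open_plane_measurable oO.
have mB : measurable (B : set (plane R)) := open_box_measurable a b c d.
have mC := compact_plane_measurable (@compact_closed_box R a b c d).
have BO : B `<=` O := subset_trans (@open_sub_closed_box R a b c d) hO.
have igB : lam.-integrable B (EFin \o g).
  apply: integrableS mC mB (@open_sub_closed_box R a b c d) _.
  by apply: ig => //; exact: compact_closed_box.
have mgB := integrable_EFin_measurable igB.
pose f n x := (g x * tensor_bump a b c d n x)%:E.
have mt n : measurable_fun setT (tensor_bump a b c d n : plane R -> R).
  apply: continuous_plane_measurable.
  exact: (test_function_tensor_bump n hO).1 0%N.
have f0 n : (\int[lam]_(x in B) f n x = 0)%E.
  have tn := test_function_tensor_bump n hO.
  have := g0 _ tn; have := compact_plane_integrable_test oO mg ig tn.
  move=> int0 h; have <- : (\int[lam]_(x in O) (g x * tensor_bump a b c d n x)%:E = 0)%E.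
    by rewrite (EFin_Rintegral mO int0) h.
  rewrite integral_mkcond [RHS]integral_mkcond; apply: eq_integral => x _.
  rewrite !patchE; case: ifPn => [/set_mem/BO/mem_set -> //|xB].
  case: ifPn => // _; rewrite tensor_bump_out ?mulr0//.
  by move: xB; rewrite notin_setE.
have [] := @dominated_convergence _ _ _ lam B mB f (EFin \o g)
  (fun x => `|(g x)%:E|%E).
- move=> n; apply/measurable_EFinP; apply: measurable_funM => //.
  exact: measurable_funTS.
- exact: (measurable_int _ igB).
- apply: aeW => -[x y] [/= hx hy]; apply/fine_cvgP; split; first exact: nearW.
  rewrite -[X in _ --> X](mulr1 (g (x, y))) -[X in _ * X](mulr1 1).
  apply: cvgM; first exact: cvg_cst.
  by apply: cvgM; apply: bump_cvg; move: hx hy; rewrite !in_itv.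
- exact: (integrable_abse igB).
- apply: aeW => x n Bx; rewrite lee_fin normrM ler_piMr//.
  have [z1 z2] : 0 <= bump a b n x.1 /\ 0 <= bump c d n x.2 by rewrite !bump_ge0.
  by rewrite ger0_norm; [apply: mulr_ile1 => //; exact: bump_le1|exact: mulr_ge0].
- move=> _ _; rewrite (_ : [sequence _]_n = cst 0%E); last first.
    by apply/funext => n /=; rewrite f0.
  by move=> h; exact: (cvg_unique (@ereal_hausdorff R) h (cvg_cst _)).
Qed.

Lemma open_boxI (a b c d a' b' c' d' : R) :
  open_box a b c d `&` open_box a' b' c' d' =
  open_box (Num.max a a') (Num.min b b') (Num.max c c') (Num.min d d').
Proof.
apply/seteqP; split => -[x y]; rewrite /open_box /= !in_itv/= !gt_max !lt_min.
  by move=> [[/andP[-> ->] /andP[-> ->]] [/andP[-> ->] /andP[-> ->]]].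
by move=> [/andP[/andP[-> ->] /andP[-> ->]] /andP[/andP[-> ->] /andP[-> ->]]].
Qed.

(** Dynkin induction on E: boxes satisfy the claim because two boxes meet in a box, and the
    integrability of g on the fixed box gives complements and disjoint unions. *)
Lemma Rintegral_sub_box_eq0 O g a b c d : open (O : set (R * R)) ->
  measurable_fun O g ->
  (forall K : set (R * R), compact K -> K `<=` O ->
    lam.-integrable (K : set (plane R)) (EFin \o g)) ->
  (forall psi, test_function O psi -> \int[lam]_(x in O) (g x * psi x) = 0) ->
  closed_box a b c d `<=` (O : set (R * R)) ->
  forall E : set (plane R), measurable E ->
  (\int[lam]_(x in open_box a b c d `&` E) (g x)%:E = 0)%E.
Proof.
move=> oO mg ig g0 hO; set B := open_box a b c d.
have mB : measurable (B : set (plane R)) := open_box_measurable a b c d.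
have igB : lam.-integrable B (EFin \o g).
  have mC := compact_plane_measurable (@compact_closed_box R a b c d).
  apply: integrableS mC mB (@open_sub_closed_box R a b c d) _.
  by apply: ig => //; exact: compact_closed_box.
have igBE E : measurable E -> lam.-integrable (B `&` E) (EFin \o g).
  move=> mE; apply: integrableS igB => //; exact: measurableI.
have B0 : (\int[lam]_(x in B) (g x)%:E = 0)%E.
  exact: Rintegral_open_box_eq0 oO mg ig g0 hO.
move=> E; rewrite measurable_plane_open_boxes; move: E.
apply: dynkin_induction => //.
- exact: measurable_plane_open_boxes.
- move=> _ _ [a1 [b1 [c1 [d1 ->]]]] [a2 [b2 [c2 [d2 ->]]]].
  by rewrite open_boxI; do 4 eexists.
- by rewrite setIT.
- move=> _ [a1 [b1 [c1 [d1 ->]]]]; rewrite open_boxI.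
  apply: Rintegral_open_box_eq0 oO mg ig g0 _.
  apply: subset_trans hO => -[x y] [/=]; rewrite !in_itv/= !ge_max !le_min.
  by move=> /andP[/andP[? _] /andP[? _]] /andP[/andP[? _] /andP[? _]];
    split; rewrite /= in_itv/=; apply/andP.
- move=> S mS S0.
  have BE : B = (B `&` S) `|` (B `&` ~` S) by rewrite -setIUr setUv setIT.
  have mBS : measurable (B `&` S : set (plane R)) by exact: measurableI.
  have mBCS : measurable (B `&` ~` S : set (plane R)).
    by apply: measurableI => //; exact: measurableC.
  have := B0; rewrite [X in (\int[_]_(x in X) _)%E]BE integral_setU_EFin//.
  + by move=> <-; rewrite [X in (X + _)%E]S0 add0e.
  + by rewrite -BE; exact: integrable_EFin_measurable igB.
  + by apply/disj_setPS => x [[_ Sx] [_ nSx]].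
- move=> F mF tF F0; rewrite setI_bigcupr integral_bigcup//.
  + by apply: eseries0 => n _ _; exact: F0.
  + exact: trivIset_setIl.
  + by move=> k; exact: measurableI.
  + by rewrite -setI_bigcupr; apply: igBE; exact: bigcupT_measurable.
Qed.

Lemma test_function_ae_eq0 O g : open (O : set (R * R)) ->
  measurable_fun O g ->
  (forall K : set (R * R), compact K -> K `<=` O ->
    lam.-integrable (K : set (plane R)) (EFin \o g)) ->
  (forall psi, test_function O psi -> \int[lam]_(x in O) (g x * psi x) = 0) ->
  {ae lam, forall x, O x -> g x = 0}.
Proof.
move=> oO mg ig g0.
pose bx (q : (rat * rat) * (rat * rat)) : set (R * R) :=
  open_box (ratr q.1.1) (ratr q.1.2) (ratr q.2.1) (ratr q.2.2).
pose cbx (q : (rat * rat) * (rat * rat)) : set (R * R) :=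
  closed_box (ratr q.1.1) (ratr q.1.2) (ratr q.2.1) (ratr q.2.2).
have hq q : cbx q `<=` O -> {ae lam, forall x : plane R, bx q x -> g x = 0}.
  move=> qO.
  have mB : measurable (bx q : set (plane R)) by exact: open_box_measurable.
  have igB : lam.-integrable (bx q) (EFin \o g).
    have cC := @compact_closed_box R (ratr q.1.1) (ratr q.1.2) (ratr q.2.1) (ratr q.2.2).
    apply: integrableS (compact_plane_measurable cC) mB _ _.
      exact: open_sub_closed_box.
    exact: ig.
  have : ae_eq lam (bx q) (EFin \o g) (cst 0%E).
    apply: integral_ae_eq => // E EB mE; rewrite integral0.
    rewrite -(setIidr EB).
    exact: Rintegral_sub_box_eq0 oO mg ig g0 qO E mE.
  by apply: filterS => x + Bx => /(_ Bx) [].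
(* Enumerating the rational boxes by [pickle] gathers their null sets into one. *)
have : {ae lam, forall x : plane R, forall n : nat, forall q,
    unpickle n = Some q -> cbx q `<=` O -> bx q x -> g x = 0}.
  apply: ae_foralln => n; case: (unpickle n) => [q|]; last exact: aeW.
  have [qO|nqO] := pselect (cbx q `<=` O).
    by apply: filterS (hq q qO) => x gx _ [<-] _; exact: gx.
  by apply: aeW => x _ [<-].
apply: filterS => x hx Ox; move: (Ox); rewrite (open_bigcup_rat_boxes oO).
by move=> [q qO qx]; exact: (hx (pickle q) q (pickleK q) qO qx).
Qed.

End fundamental_lemma.

(** * Weak derivatives and Sobolev norms *)

Section weak_derivatives.
Context {R : realType}.
Implicit Types (O K : set (plane R)) (g u v : plane R -> R) (i : 'I_2).
Local Notation lam := (leb2 R).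

Lemma bounded_plane_fin (K : set (R * R)) :
  measurable (K : set (plane R)) -> bounded_set K -> (lam K < +oo)%E.
Proof.
move=> mK [L [_ hL]]; pose M := `|L| + 1.
have KB : K `<=` closed_box (- M) M (- M) M.
  have LM : L < M by rewrite ltr_pwDr// ler_norm.
  move=> [x y] Kxy; have /= := hL M LM _ Kxy; rewrite prod_normE ge_max/= !ler_norml => /andP[h1 h2].
  by split; rewrite /= in_itv.
apply: (@le_lt_trans _ _ (lam (closed_box (- M) M (- M) M))).
  apply: le_measure => //; rewrite inE //.
  by apply: compact_plane_measurable; exact: compact_closed_box.
rewrite product_measure1E//= lebesgue_measure_itv/=.
by case: ifPn => _; rewrite ?mule0 ?lte_fin // -EFinB -EFinM ltry.
Qed.

(** Off the closed set K the function vanishes near each point, so its derivative vanishes there too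
    and K still serves as support. *)
Lemma test_function_derive O i (psi : R * R -> R) : test_function O psi ->
  test_function O (fun x => 'D_(dir i) psi x).
Proof.
move=> [Cpsi [K [cK KO K0]]]; split.
  by move=> k; have /= [_ /(_ i)[_]] := Cpsi k.+1.
exists K; split => // x Kx.
have oC : open (~` K).
  by apply: closed_openC; apply: compact_closed cK; exact: norm_hausdorff.
rewrite (@near_eq_derive _ _ _ psi (cst 0)) ?derive_cst//.
near do apply: K0.
Unshelve. all: end_near.
by apply: open_nbhs_nbhs; split.
Qed.

Lemma loc_integrable_testM O u (psi : R * R -> R) : open (O : set (R * R)) ->
  loc_integrable O u -> test_function O psi ->
  lam.-integrable O (EFin \o (fun x => u x * psi x)).
Proof. by move=> oO [mu_ iu]; exact: compact_plane_integrable_test. Qed.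

Lemma loc_integrableD O u v : loc_integrable O u -> loc_integrable O v ->
  loc_integrable O (fun x => u x + v x).
Proof.
move=> [mu_ iu] [mv iv]; split; first exact: measurable_funD.
move=> K cK KO; have mK := compact_plane_measurable cK.
by apply: (integrableDr mK); [exact: iu|exact: iv].
Qed.

Lemma loc_integrableZ O c u : loc_integrable O u ->
  loc_integrable O (fun x => c * u x).
Proof.
move=> [mu_ iu]; split; first exact: measurable_funM.
move=> K cK KO; have mK := compact_plane_measurable cK.
by apply: (integrableZ mK); exact: iu.
Qed.

Lemma loc_integrable_ae_eq O u v : open (O : set (R * R)) -> measurable_fun O v ->
  {ae lam, forall x, O x -> u x = v x} ->
  loc_integrable O u -> loc_integrable O v.
Proof.
move=> oO mv uv [mu_ iu]; split => // K cK KO.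
have mK := compact_plane_measurable cK.
apply: (@ae_eq_integrable _ _ _ _ _ mK u) => //.
- apply: measurable_funS mv => //.
  exact: open_plane_measurable.
- by apply: filterS uv => x h Kx; apply: h; exact: KO.
- exact: iu.
Qed.

Lemma weak_partial_lin O i a b u v g h : open (O : set (R * R)) ->
  weak_partial O i u g -> weak_partial O i v h ->
  weak_partial O i (fun x => a * u x + b * v x) (fun x => a * g x + b * h x).
Proof.
move=> oO [lu lg ug] [lv lh vh]; split.
- by apply: loc_integrableD; exact: loc_integrableZ.
- by apply: loc_integrableD; exact: loc_integrableZ.
move=> psi tpsi; have tdpsi := test_function_derive i tpsi.
have mO := open_plane_measurable oO.
have iu := loc_integrable_testM oO lu tdpsi.
have iv := loc_integrable_testM oO lv tdpsi.
have ig := loc_integrable_testM oO lg tpsi.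
have ih := loc_integrable_testM oO lh tpsi.
transitivity (\int[lam]_(x in O)
    (a * (u x * 'D_(dir i) psi x) + b * (v x * 'D_(dir i) psi x))).
  by apply: eq_Rintegral => x _; ring.
rewrite RintegralD// ?RintegralZl//; [|exact: integrableZ..].
rewrite ug// vh// !mulrN -opprD; congr (- _).
rewrite -RintegralZl// -[X in _ + X]RintegralZl// -RintegralD//; [|exact: integrableZ..].
by apply: eq_Rintegral => x _; ring.
Qed.

Lemma weak_partial_ae_eq O i u v g : open (O : set (R * R)) ->
  measurable_fun O v -> {ae lam, forall x, O x -> u x = v x} ->
  weak_partial O i u g -> weak_partial O i v g.
Proof.
move=> oO mv uv [lu lg ug]; have mO := open_plane_measurable oO.
have lv := loc_integrable_ae_eq oO mv uv lu; split => // psi tpsi.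
have tdpsi := test_function_derive i tpsi.
rewrite -ug//; apply: ae_eq_Rintegral => //.
- exact: integrable_EFin_measurable (loc_integrable_testM oO lv tdpsi).
- exact: integrable_EFin_measurable (loc_integrable_testM oO lu tdpsi).
- by apply: filterS uv => x + Ox => /(_ Ox) ->.
Qed.

(** By linearity g - h is a weak derivative of u - u = 0, so it pairs to 0 with every test
    function. *)
Lemma weak_partial_unique O i u g h : open (O : set (R * R)) ->
  weak_partial O i u g -> weak_partial O i u h ->
  {ae lam, forall x, O x -> g x = h x}.
Proof.
move=> oO wg wh.
have [_ [mgh igh] gh] := weak_partial_lin 1 (-1) oO wg wh.
suff : {ae lam, forall x, O x -> 1 * g x + -1 * h x = 0}.
  by apply: filterS => x + Ox => /(_ Ox); lra.
apply: (test_function_ae_eq0 oO mgh igh) => psi tpsi.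
apply: oppr_inj; rewrite -gh// oppr0.
rewrite (@eq_Rintegral _ _ _ _ _ (cst 0)); last by move=> x _ /=; ring.
by rewrite Rintegral_cst ?mul0r//; exact: open_plane_measurable.
Qed.

Lemma weak_partial_pd O i u g :
  weak_partial O i u g -> weak_partial O i u (pd O i u).
Proof. by move=> ug; apply: (xgetPex (cst 0)); exists g. Qed.

Lemma pd_ae_eq O i u g : open (O : set (R * R)) -> weak_partial O i u g ->
  {ae lam, forall x, O x -> pd O i u x = g x}.
Proof.
by move=> oO ug; apply: (weak_partial_unique oO _ ug); exact: weak_partial_pd ug.
Qed.

Lemma integral_derive_compact_support (f df : R -> R) L :
  (forall x : R, is_derive x (1 : R) f (df x)) -> continuous df ->
  (forall x, L < `|x| -> f x = 0) ->
  (\int[leb R]_x (df x)%:E = 0)%E.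
Proof.
move=> hf cdf f0; pose M := `|L| + 1.
have LM : L < M by rewrite ltr_pwDr// ler_norm.
have M0 : 0 < M by rewrite ltr_pwDr.
have df0 x : L < `|x| -> df x = 0.
  move=> Lx; rewrite -(@derive_val _ _ _ _ _ _ _ (hf x)).
  rewrite (@near_eq_derive _ _ _ f (cst 0)) ?derive_cst//.
  have : \forall y \near x, L < `|y|.
    have := @norm_continuous R R x; move=> /cvgr_gt; exact.
  by apply: filterS => y; exact: f0.
have -> : (\int[leb R]_x (df x)%:E = \int[leb R]_(x in `[(- M)%R, M]) (df x)%:E)%E.
  rewrite [RHS]integral_mkcond; apply: eq_integral => x _.
  rewrite patchE; case: ifPn => //; rewrite notin_setE /= in_itv/= => /negP.
  rewrite -ler_norml -ltNge => Mx; rewrite df0//; exact: lt_trans Mx.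
rewrite (@continuous_FTC2 _ df f)//.
- by rewrite !f0 ?subee// ?normrN gtr0_norm.
- lra.
- exact: continuous_subspaceT.
- have cf := is_derive_continuous hf; split.
  + by move=> x _; exact: (@ex_derive _ _ _ _ _ _ _ (hf x)).
  + exact: cvg_at_right_filter (cf _).
  + exact: cvg_at_left_filter (cf _).
- by move=> x _; rewrite derive1E; exact: (@derive_val _ _ _ _ _ _ _ (hf x)).
Qed.

Lemma is_derive_slice1 (psi : R * R -> R) (x y : R) :
  derivable psi (x, y) ((1, 0) : R * R) ->
  is_derive x (1 : R) (fun t => psi (t, y)) ('D_((1, 0) : R * R) psi (x, y)).
Proof.
move=> h; have hF : (fun h : R => h^-1 *: ((psi \o shift (x, y))
    (h *: ((1, 0) : R * R)) - psi (x, y))) =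
    (fun h : R => h^-1 *: (((fun t => psi (t, y)) \o shift x) (h *: (1 : R)) - psi (x, y))).
  apply/funext => k; congr (_ *: (psi _ - _)); rewrite /= [LHS]surjective_pairing.
  by congr (_, _); rewrite /= /GRing.scale/= ?mulr0 ?add0r.
by move: h; rewrite /derivable /derive hF => h; split.
Qed.

Lemma is_derive_slice2 (psi : R * R -> R) (x y : R) :
  derivable psi (x, y) ((0, 1) : R * R) ->
  is_derive y (1 : R) (fun t => psi (x, t)) ('D_((0, 1) : R * R) psi (x, y)).
Proof.
move=> h; have hF : (fun h : R => h^-1 *: ((psi \o shift (x, y))
    (h *: ((0, 1) : R * R)) - psi (x, y))) =
    (fun h : R => h^-1 *: (((fun t => psi (x, t)) \o shift y) (h *: (1 : R)) - psi (x, y))).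
  apply/funext => k; congr (_ *: (psi _ - _)); rewrite /= [LHS]surjective_pairing.
  by congr (_, _); rewrite /= /GRing.scale/= ?mulr0 ?add0r.
by move: h; rewrite /derivable /derive hF => h; split.
Qed.

Lemma continuous_slice1 (f : R * R -> R) (y : R) :
  continuous f -> continuous (fun x : R => f (x, y)).
Proof.
move=> cf x; apply: (@continuous_comp _ _ _ (fun t : R => (t, y)) f).
  exact: (cvg_pair (@cvg_id _ _) (cvg_cst _)).
exact: cf.
Qed.

Lemma continuous_slice2 (f : R * R -> R) (x : R) :
  continuous f -> continuous (fun y : R => f (x, y)).
Proof.
move=> cf y; apply: (@continuous_comp _ _ _ (fun t : R => (x, t)) f).
  exact: (cvg_pair (cvg_cst _) (@cvg_id _ _)).
exact: cf.
Qed.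

(** By Fubini the integral is taken first along the direction of the derivative, where the
    fundamental theorem of calculus gives 0 on each line. *)
Lemma Rintegral_test_derive_eq0 O i (psi : R * R -> R) : open (O : set (R * R)) ->
  test_function O psi -> \int[lam]_(x in O) 'D_(dir i) psi x = 0.
Proof.
move=> oO tpsi; have tdpsi := test_function_derive i tpsi.
have [Cpsi [K [cK KO K0]]] := tpsi.
have [Cdpsi [K' [cK' KO' K0']]] := tdpsi.
have ipsi : lam.-integrable setT (EFin \o (fun x : plane R => 'D_(dir i) psi x)).
  (* The derivative is a test function on the whole plane, hence integrable as its product with the
     locally integrable constant 1. *)
  have : lam.-integrable setT (EFin \o (fun x : plane R => 1 * 'D_(dir i) psi x)).
    apply: (@compact_plane_integrable_test _ setT (cst 1)) => //.
    + exact: openT.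
    + move=> L cL _; have mL := compact_plane_measurable cL.
      apply: measurable_bounded_integrable => //; last exact: bounded_cst.
      by apply: bounded_plane_fin => //; exact: compact_bounded.
    + by split => //; exists K'; split.
  by under eq_fun do rewrite mul1r.
rewrite Rintegral_mkcond [LHS](@eq_Rintegral _ (plane R) _ _ _ (fun x : plane R => 'D_(dir i) psi x)); last first.
  move=> x _; rewrite patchE; case: ifPn => //; rewrite notin_setE => nOx.
  by rewrite K0'// => /KO'.
rewrite /Rintegral.
have [L [_ hL]] : bounded_set K by exact: compact_bounded.
have psi0 x y : `|L| + 1 < `|x| \/ `|L| + 1 < `|y| -> psi (x, y) = 0.
  move=> h; apply: K0 => Kxy.
  have LM : L < `|L| + 1 by rewrite ltr_pwDr// ler_norm.
  have /= := hL _ LM _ Kxy; rewrite leNgt => /negP; apply; rewrite prod_normE lt_max/=.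
  by case: h => ->; rewrite ?orbT.
have cd : continuous (fun x => 'D_(dir i) psi x) := Cdpsi 0%N.
have [_ /(_ i)[der _]] := Cpsi 1%N.
move: ipsi cd der; rewrite /dir; case: ifPn => _ ipsi cd der.
- rewrite -(integral21_prod_meas1 ipsi) integral0_eq// => y _.
  apply: (@integral_derive_compact_support (fun x : R => psi (x, y : R))
    (fun x : R => 'D_((1, 0) : R * R) psi (x, y : R)) (`|L| + 1)).
  + by move=> x; exact: is_derive_slice1.
  + exact: (@continuous_slice1 (fun z : R * R => 'D_((1, 0) : R * R) psi z) y cd).
  + by move=> x Lx; apply: psi0; left.
- rewrite -(integral12_prod_meas1 ipsi) integral0_eq// => x _.
  apply: (@integral_derive_compact_support (fun y : R => psi (x : R, y))
    (fun y : R => 'D_((0, 1) : R * R) psi (x : R, y)) (`|L| + 1)).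
  + by move=> y; exact: is_derive_slice2.
  + exact: (@continuous_slice2 (fun z : R * R => 'D_((0, 1) : R * R) psi z) x cd).
  + by move=> y Ly; apply: psi0; right.
Qed.

(** Constants must lie in H^1 with zero gradient so that the Neumann condition can be tested with
    the function 1. *)
Lemma weak_partial_cst O i (c : R) : open (O : set (R * R)) ->
  weak_partial O i (fun=> c) (fun=> 0).
Proof.
move=> oO; have mO := open_plane_measurable oO.
have lc (k : R) : loc_integrable O (fun=> k).
  split => // K cK KO; have mK := compact_plane_measurable cK.
  apply: measurable_bounded_integrable => //; last exact: bounded_cst.
  by apply: bounded_plane_fin => //; exact: compact_bounded.
split => // psi tpsi; have tdpsi := test_function_derive i tpsi.
have := loc_integrable_testM oO (lc 1) tdpsi.
under eq_fun do rewrite mul1r; move=> idpsi.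
rewrite RintegralZl// Rintegral_test_derive_eq0// mulr0.
rewrite (@eq_Rintegral _ _ _ _ _ (cst 0)); last by move=> x _ /=; rewrite mul0r.
by rewrite Rintegral_cst// mul0r oppr0.
Qed.

End weak_derivatives.

(** * Sobolev norms as real integrals *)

Section restricted_norms.
Context {R : realType}.
Implicit Types (O : set (plane R)) (u v : plane R -> R).
Local Notation lam := (leb2 R).

(** Evenness removes the absolute value, so that the norm is a root of the integral of a power; used
    with n = 2 and n = 4. *)
Lemma Lpnorm_even O u n : measurable O -> (0 < n)%N -> ~~ odd n ->
  lam.-integrable O (EFin \o (fun x => u x ^+ n)) ->
  Lpnorm O n%:R%:E u = ((\int[lam]_(x in O) (u x ^+ n)) `^ n%:R^-1)%:E.
Proof.
move=> mO n0 en iu; rewrite /Lpnorm unlock /=.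
rewrite -poweR_EFin -EFin_Rintegral//; congr (_ `^ _)%E.
rewrite [RHS]integral_mkcond; apply: eq_integral => x _.
rewrite /= /patch; case: ifPn => _ /=; last first.
  by rewrite normr0 powR0// pnatr_eq0 -lt0n.
rewrite powR_mulrn// -normrX ger0_norm// -(odd_double_half n) (negbTE en) add0n.
by rewrite -mul2n exprM exprn_ge0// sqr_ge0.
Qed.

Lemma inLp2P O u : measurable O -> inLp O 2%:E u <-> sq_integrable lam O u.
Proof.
move=> mO; split => [h|[mu_ iu]].
  have mu_ : measurable_fun O u.
    apply/(measurable_restrictT _ mO).
    by move: h; rewrite /inLp inE => /andP[]; rewrite inE.
  split => //; have := Lfun2_integrable_sqr h.
  move=> h2; have := integrableS measurableT mO (@subsetT _ O) h2.
  by apply: eq_integrable => // x; rewrite inE => Ox; rewrite /= patchE mem_set.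
rewrite /inLp inE; apply/andP; split; rewrite inE /=.
  exact/(measurable_restrictT _ mO).
rewrite /finite_norm -/(Lpnorm O 2%:E u).
by rewrite (@Lpnorm_even O u 2)// ltry.
Qed.

Lemma Lpnorm2E O u : measurable O -> sq_integrable lam O u ->
  Lpnorm O 2%:E u = (Num.sqrt (\int[lam]_(x in O) (u x ^+ 2)))%:E.
Proof.
move=> mO [mu_ iu]; rewrite (@Lpnorm_even O u 2)// powR12_sqrt//.
exact: Rintegral_sqr_ge0.
Qed.

Lemma Lpnorm2_sqr O u : measurable O -> sq_integrable lam O u ->
  (Lpnorm O 2%:E u ^+ 2 = (\int[lam]_(x in O) (u x ^+ 2))%:E)%E.
Proof.
move=> mO su; rewrite Lpnorm2E// -EFin_expe sqr_sqrtr//.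
exact: Rintegral_sqr_ge0.
Qed.

Lemma Lpnorm_cst_sqr O (c : R) : measurable O -> (lam O < +oo)%E ->
  (Lpnorm O 2%:E (cst c) ^+ 2 = (c ^+ 2 * vol O)%:E)%E.
Proof.
move=> mO fO; have sc : sq_integrable lam O (cst c).
  exact/ess_bounded_sq_integrable/ess_bounded_cst.
by rewrite Lpnorm2_sqr//= Rintegral_cst.
Qed.

Lemma Lpnormoo_ae O u (M : R) : (Lpnorm O +oo u <= M%:E)%E ->
  {ae lam, forall x, O x -> `|u x| <= M}.
Proof.
rewrite /Lpnorm unlock; case: ifPn => [_|lam0].
  move=> /ess_supP; apply: filterS => x h Ox; move: h.
  by rewrite /= patchE mem_set// lee_fin.
move=> _; exists setT; split => //; apply/eqP; rewrite eq_le measure_ge0 andbT.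
by rewrite leNgt.
Qed.

(** The real counterpart of [H1norm O u ^+ 2]; [H1norm_sqr] identifies the two on [inH1], where no
    integral is infinite. *)
Definition H1sq O u : R := \int[lam]_(x in O) (u x ^+ 2) +
  \sum_(i < 2) \int[lam]_(x in O) (pd O i u x ^+ 2).

Lemma H1sq_ge0 O u : 0 <= H1sq O u.
Proof.
by rewrite addr_ge0 ?Rintegral_sqr_ge0// sumr_ge0// => i _; exact: Rintegral_sqr_ge0.
Qed.

Lemma inH1_sq_integrable O u : measurable O -> inH1 O u -> sq_integrable lam O u.
Proof. by move=> mO [hu _]; exact/inLp2P. Qed.

Lemma inH1_pd O i u : measurable O -> inH1 O u ->
  weak_partial O i u (pd O i u) /\ sq_integrable lam O (pd O i u).
Proof. by move=> mO [_ /(_ i)[? ?]]; split => //; exact/inLp2P. Qed.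

Lemma H1norm_sqrt O u : measurable O -> inH1 O u ->
  H1norm O u = (Num.sqrt (H1sq O u))%:E.
Proof.
move=> mO hu; rewrite /H1norm Lpnorm2_sqr//; last exact: inH1_sq_integrable.
rewrite (eq_bigr (fun i => (\int[lam]_(x in O) (pd O i u x ^+ 2))%:E)); last first.
  by move=> i _; rewrite Lpnorm2_sqr//; have [] := inH1_pd i mO hu.
by rewrite sumEFin -EFinD poweR_EFin powR12_sqrt// H1sq_ge0.
Qed.

Lemma H1norm_sqr O u : measurable O -> inH1 O u ->
  (H1norm O u ^+ 2 = (H1sq O u)%:E)%E.
Proof.
by move=> mO hu; rewrite H1norm_sqrt// -EFin_expe sqr_sqrtr// H1sq_ge0.
Qed.

Lemma H2norm_lty O u : measurable O -> inH2 O u -> (H2norm O u < +oo)%E.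
Proof.
move=> mO [hu hdu]; apply: poweR_lty; rewrite H1norm_sqr//.
rewrite (eq_bigr (fun i => (\sum_(j < 2)
    \int[lam]_(x in O) (pd O j (pd O i u) x ^+ 2))%:E)); last first.
  move=> i _; rewrite -sumEFin; apply: eq_bigr => j _.
  by rewrite Lpnorm2_sqr//; have [] := inH1_pd j mO (hdu i).
by rewrite sumEFin -EFinD ltry.
Qed.

(** An infinite supremum norm would contradict the Sobolev inequality, whose right-hand side is
    finite on H^2. For the numerical solution only this qualitative fact is used, to make the
    nonlinear terms integrable. *)
Lemma inH2_ess_bounded O u : measurable O -> sobolev_Loo O -> inH2 O u ->
  ess_bounded lam O u.
Proof.
move=> mO [C hC] hu; have [hu1 _] := hu.
split; first by have [] := inH1_sq_integrable mO hu1.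
have N0 : (0 <= Lpnorm O +oo u)%E by exact: Lnorm_ge0.
have : (Lpnorm O +oo u < +oo)%E.
  rewrite ltey; apply/eqP => Ny; have := hC u hu; rewrite Ny.
  have /fineK <- : H2norm O u \is a fin_num.
    by rewrite ge0_fin_numE ?poweR_ge0// H2norm_lty.
  by rewrite H1norm_sqrt// -!EFinM expe2 mulyy leye_eq.
move=> Ny; exists (fine (Lpnorm O +oo u)); apply: Lpnormoo_ae.
by rewrite fineK// ge0_fin_numE.
Qed.

Lemma sobolev_L4_Rintegral O : measurable O -> (lam O < +oo)%E -> sobolev_L4 O ->
  exists S, 0 < S /\ forall u, inH1 O u -> ess_bounded lam O u ->
  \int[lam]_(x in O) (u x ^+ 4) <= S * \int[lam]_(x in O) (u x ^+ 2) * H1sq O u.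
Proof.
(* Squaring the Sobolev inequality produces C^2; the summand 1 makes the constant positive. *)
move=> mO fO [C hC]; exists (C ^+ 2 + 1); split.
  by rewrite ltr_wpDl// sqr_ge0.
move=> u hu bu; have := hC u hu.
have i4 := ess_bounded_integrable mO fO (ess_boundedX 4 bu).
have su := inH1_sq_integrable mO hu.
rewrite (@Lpnorm_even O u 4)// Lpnorm2E// H1norm_sqrt// -EFin_expe -!EFinM lee_fin.
set Q := Rintegral _ _ _; set A := Rintegral _ _ _; set H := H1sq _ _.
have Q0 : 0 <= Q.
  by apply: Rintegral_ge0 => x _; rewrite (exprM _ 2 2) sqr_ge0.
have A0 : 0 <= A by exact: Rintegral_sqr_ge0.
have H0 : 0 <= H by exact: H1sq_ge0.
set b := Q `^ _ => h; have b20 : 0 <= b ^+ 2 := sqr_ge0 b.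
have -> : Q = b ^+ 4.
  by rewrite -powR_mulrn ?powR_ge0// -powRrM mulVf ?powRr1.
have : (b ^+ 2) ^+ 2 <= (C * Num.sqrt A * Num.sqrt H) ^+ 2.
  by apply: lerXn2r => //; rewrite nnegrE// (le_trans _ h).
rewrite -exprM !exprMn !sqr_sqrtr// => /le_trans; apply.
by rewrite !mulrDl mul1r lerDl mulr_ge0.
Qed.

Lemma inH1_lin O a b u v : open (O : set (R * R)) -> inH1 O u -> inH1 O v ->
  inH1 O (fun x => a * u x + b * v x).
Proof.
move=> oO hu hv; have mO := open_plane_measurable oO.
have su := inH1_sq_integrable mO hu; have sv := inH1_sq_integrable mO hv.
split; first by apply/(inLp2P _ mO)/sq_integrableD => //; exact: sq_integrableZ.
move=> i; have [wu du] := inH1_pd i mO hu; have [wv dv] := inH1_pd i mO hv.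
have wuv := weak_partial_lin a b oO wu wv.
have wpd := weak_partial_pd wuv; split; first exact: wpd.
apply/(inLp2P _ mO); have [_ [mpd _] _] := wpd.
apply: (@ae_eq_sq_integrable _ _ _ _ _ mO _ _ mpd _
  (sq_integrableD mO (sq_integrableZ mO a du) (sq_integrableZ mO b dv))).
have := pd_ae_eq oO wuv; apply: filterS => x + Ox => /(_ Ox) ->.
by [].
Qed.

Lemma pd_lin O i a b u v : open (O : set (R * R)) -> inH1 O u -> inH1 O v ->
  {ae lam, forall x, O x -> pd O i (fun y => a * u y + b * v y) x =
    a * pd O i u x + b * pd O i v x}.
Proof.
move=> oO hu hv; have mO := open_plane_measurable oO.
have [wu du] := inH1_pd i mO hu; have [wv dv] := inH1_pd i mO hv.
by apply: (pd_ae_eq oO); exact: weak_partial_lin.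
Qed.

(** Needed to differentiate twice: [pd] of a linear combination is only almost everywhere the
    combination of the [pd], and the next derivative must not see the null set. *)
Lemma inH1_ae_eq O u v : open (O : set (R * R)) -> inH1 O u ->
  measurable_fun O v -> {ae lam, forall x, O x -> u x = v x} ->
  inH1 O v /\ forall i, {ae lam, forall x, O x -> pd O i u x = pd O i v x}.
Proof.
move=> oO hu mv uv; have mO := open_plane_measurable oO.
have key i : weak_partial O i v (pd O i u).
  by have [wu _] := inH1_pd i mO hu; exact: weak_partial_ae_eq wu.
have eq_pd i : {ae lam, forall x, O x -> pd O i u x = pd O i v x}.
  have := pd_ae_eq oO (key i); apply: filterS => x + Ox => /(_ Ox) ->.
  by [].
split; last exact: eq_pd; split.
  apply/(inLp2P _ mO); apply: (ae_eq_sq_integrable mO mv uv).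
  exact: inH1_sq_integrable.
move=> i; have wpd := weak_partial_pd (key i); split; first exact: wpd.
apply/(inLp2P _ mO); have [_ [mpd _] _] := wpd.
apply: (ae_eq_sq_integrable mO mpd (eq_pd i)).
by have [] := inH1_pd i mO hu.
Qed.

Lemma inH1_cst O (c : R) : open (O : set (R * R)) -> (lam O < +oo)%E ->
  inH1 O (fun=> c) /\ forall i, {ae lam, forall x, O x -> pd O i (fun=> c) x = 0}.
Proof.
move=> oO fO; have mO := open_plane_measurable oO.
have wc i := weak_partial_cst i c oO.
have eq0 i := pd_ae_eq oO (wc i).
split; last exact: eq0; split.
  by apply/(inLp2P _ mO); exact/ess_bounded_sq_integrable/ess_bounded_cst.
move=> i; have wpd := weak_partial_pd (wc i); split; first exact: wpd.
apply/(inLp2P _ mO); have [_ [mpd _] _] := wpd.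
have s0 : sq_integrable lam O (fun=> 0 : R).
  exact/ess_bounded_sq_integrable/ess_bounded_cst.
apply: (ae_eq_sq_integrable mO mpd _ s0).
by apply: filterS (eq0 i) => x + Ox => /(_ Ox) ->.
Qed.

Lemma laplacianE O u x : laplacian O u x =
  pd O ord0 (pd O ord0 u) x + pd O ord_max (pd O ord_max u) x.
Proof.
rewrite /laplacian big_ord_recl big_ord1.
by congr (_ + pd _ _ (pd _ _ _) _); exact/val_inj.
Qed.

Lemma inH2_lin O a b u v : open (O : set (R * R)) -> inH2 O u -> inH2 O v ->
  inH2 O (fun x => a * u x + b * v x) /\
  {ae lam, forall x, O x -> laplacian O (fun y => a * u y + b * v y) x =
    a * laplacian O u x + b * laplacian O v x}.
Proof.
move=> oO [hu du] [hv dv]; have mO := open_plane_measurable oO.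
have huv := inH1_lin a b oO hu hv.
have key i : inH1 O (pd O i (fun y => a * u y + b * v y)) /\
    {ae lam, forall x, O x -> pd O i (pd O i (fun y => a * u y + b * v y)) x =
      a * pd O i (pd O i u) x + b * pd O i (pd O i v) x}.
  have hd := inH1_lin a b oO (du i) (dv i).
  have [[_ [mpd _] _] _] := inH1_pd i mO huv.
  have e := pd_lin i a b oO hu hv.
  have e' : {ae lam, forall x, O x -> a * pd O i u x + b * pd O i v x =
      pd O i (fun y => a * u y + b * v y) x}.
    by apply: filterS e => x + Ox => /(_ Ox) ->.
  have [h1 h2] := inH1_ae_eq oO hd mpd e'; split; first exact: h1.
  have := pd_lin i a b oO (du i) (dv i); have := h2 i.
  by apply: filterS2 => x + + Ox => /(_ Ox) <- /(_ Ox) ->.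
split; first by split; [exact: huv|move=> i; exact: (key i).1].
have [_ e0] := key ord0; have [_ e1] := key ord_max.
apply: filterS2 e0 e1 => x + + Ox => /(_ Ox) e0 /(_ Ox) e1.
have alg (x1 x2 y1 y2 : R) : a * x1 + b * y1 + (a * x2 + b * y2) =
  a * (x1 + x2) + b * (y1 + y2) by ring.
apply: (etrans (laplacianE O _ x)); apply: (etrans (congr2 +%R e0 e1)).
apply: (etrans (alg _ _ _ _)).
exact: (esym (congr2 (fun s t => a * s + b * t) (laplacianE O u x) (laplacianE O v x))).
Qed.

Lemma inH2_laplacian O u : open (O : set (R * R)) -> inH2 O u ->
  sq_integrable lam O (laplacian O u).
Proof.
move=> oO [hu du]; have mO := open_plane_measurable oO.
rewrite (_ : laplacian O u = fun x => pd O ord0 (pd O ord0 u) x +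
    pd O ord_max (pd O ord_max u) x).
  apply: sq_integrableD => //.
    by have [] := inH1_pd ord0 mO (du ord0).
  by have [] := inH1_pd ord_max mO (du ord_max).
by apply/funext => x; exact: laplacianE.
Qed.

End restricted_norms.

(** * The exact solution *)

Lemma aeS d (T : measurableType d) (R : realType)
    (mu : {measure set T -> \bar R}) (P Q : T -> Prop) :
  (forall x, P x -> Q x) -> {ae mu, forall x, P x} -> {ae mu, forall x, Q x}.
Proof. by move=> PQ; apply: filterS. Qed.

Lemma aeT d (T : measurableType d) (R : realType)
    (mu : {measure set T -> \bar R}) (P : T -> Prop) :
  ~~ (0 < mu setT)%E -> {ae mu, forall x, P x}.
Proof.
move=> mu0; exists setT; split => //; apply/eqP; rewrite eq_le measure_ge0 andbT.
by rewrite leNgt.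
Qed.

Section null_sections.
Context d1 d2 (T1 : measurableType d1) (T2 : measurableType d2) (R : realType).
Variables (m1 : {sigma_finite_measure set T1 -> \bar R})
  (m2 : {sigma_finite_measure set T2 -> \bar R}).

(** By Tonelli both iterated integrals of the indicator of B agree, so one vanishes with the other,
    and a nonnegative function of zero integral is zero almost everywhere. *)
Lemma ae_null_ysection (B : set (T1 * T2)) : measurable B ->
  {ae m1, forall x, m2 (xsection B x) = 0%E} ->
  {ae m2, forall y, m1 (ysection B y) = 0%E}.
Proof.
move=> mB h.
have mx := measurable_fun_xsection m2 mB; have my := measurable_fun_ysection m1 mB.
have := indic_fubini_tonelli m1 m2 mB.
rewrite indic_fubini_tonelli_FE// indic_fubini_tonelli_GE//.
rewrite (ae_eq_integral (cst 0%E)) ?integral0//; last first.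
  by apply: filterS h => x + _ => /= ->.
move=> /esym h2.
have : (\int[m2]_y `|(m1 \o ysection B) y| = 0)%E.
  by rewrite -h2; apply: eq_integral => y _; rewrite gee0_abs//=.
move=> /(ae_eq_integral_abs m2 measurableT my).
by apply: filterS => y /= /(_ I).
Qed.

End null_sections.

Section time_regularity.
Context {R : realType}.
Implicit Types (O : set (plane R)) (T M : R) (phi phit : R -> plane R -> R).
Local Notation lam := (leb2 R).

Lemma Lp_time_oo_ae T (X : (plane R -> R) -> Prop)
    (normX : (plane R -> R) -> \bar R) u :
  Lp_time T +oo X normX u ->
  exists M, {ae leb R, forall t, 0 < t < T -> (normX (u t) <= M%:E)%E}.
Proof.
move=> [_]; rewrite unlock /=; case: ifPn => [_|]; last first.
  by move=> h _; exists 0; exact: aeT.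
set f := _ \o _ => h.
have [M hM] : exists M, (ess_sup_inf.ess_sup (leb R) f <= M%:E)%E.
  move: h; case: (ess_sup_inf.ess_sup _ _) => [r _|//|_].
    by exists r.
  by exists 0; rewrite leNye.
exists M; move: hM => /ess_supP; apply: aeS => t.
rewrite /f /= => + tT; rewrite tT; apply: le_trans.
exact: lee_abs.
Qed.

(** The hypothesis gives a null set of points for almost each time, whereas the integral formula for
    phi needs a null set of times for almost each point. The exceptional set is jointly measurable,
    so its sections can be exchanged. *)
Lemma ae_bounded_ae_slices O T M phit : measurable O -> (lam O < +oo)%E ->
  jointly_measurable O T phit ->
  {ae leb R, forall t, 0 < t < T -> {ae lam, forall x, O x -> `|phit t x| <= M}} ->
  {ae lam, forall x, O x -> {ae leb R, forall t, 0 < t < T -> `|phit t x| <= M}}.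
Proof.
move=> mO fO jm h.
pose lamO := mfrestr mO fO.
pose B : set (measurableTypeR R * plane R) :=
  (`]0, T[ `*` O) `&` [set z | M < `|phit z.1 z.2|].
have mIO : measurable (`]0, T[ `*` O : set (measurableTypeR R * plane R)).
  by apply: measurableX => //; exact: measurable_itv.
have mB : measurable B.
  have mn : measurable_fun (`]0, T[ `*` O : set (measurableTypeR R * plane R))
      (fun z => `|phit z.1 z.2|) by exact: measurableT_comp.
  rewrite (_ : B = (`]0, T[ `*` O) `&`
    (fun z => `|phit z.1 z.2|) @^-1` `]M, +oo[).
    by apply: mn => //; exact: measurable_itv.
  apply/seteqP; split => z [z1 z2]; split => //; move: z2; rewrite /= in_itv/= andbT //.
have hx : {ae leb R, forall t, lamO (xsection B t) = 0%E}.
  apply: aeS h => t ht.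
  have mxB : measurable (xsection B t) by exact: measurable_xsection.
  rewrite /lamO /mfrestr /mrestr.
  have [tT|ntT] := boolP (0 < t < T); last first.
    rewrite (_ : xsection B t = set0) ?set0I ?measure0//.
    apply/seteqP; split => // x; rewrite /xsection /= inE => -[[]]/=.
    by rewrite in_itv/= (negbTE ntT).
  have [N [mN N0 hN]] := ht tT.
  apply: (subset_measure0 (measurableI _ _ mxB mO) mN _ N0).
  move=> x []; rewrite /xsection /= inE => -[[_ Ox]] /= Mx _; apply: hN => /= /(_ Ox).
  by rewrite leNgt Mx.
have [N [mN N0 hN]] := @ae_null_ysection _ _ _ _ _ (leb R) lamO B mB hx.
exists (N `&` O); split; [exact: measurableI|exact: N0|].
move=> x /= /not_implyP[Ox hx']; split => //; apply: hN => /= hx0; apply: hx'.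
exists (ysection B x); split => //.
  exact: measurable_ysection.
move=> t /= /not_implyP[tT /negP]; rewrite -ltNge => Mt.
by rewrite /ysection /= inE; split => //; split => //=; rewrite in_itv.
Qed.

Lemma time_derivative_lipschitz O T M phi phit : measurable O -> 0 <= M ->
  jointly_measurable O T phit -> time_derivative O T phi phit ->
  {ae lam, forall x, O x -> {ae leb R, forall t, 0 < t < T -> `|phit t x| <= M}} ->
  forall s t, 0 <= s -> s <= t -> t <= T ->
  {ae lam, forall x, O x -> `|phi t x - phi s x| <= M * (t - s)}.
Proof.
move=> mO M0 jm dphi hM s t s0 st tT.
have := dphi s t s0 st tT; apply: filterS2 hM => x hx + Ox => /(_ Ox) ->.
have {}hx := hx Ox.
have [st'|] := ltP s t; last first.
  move=> ts; have -> : t = s by apply/le_anti; rewrite ts st.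
  by rewrite set_itv1 Rintegral_set1 normr0 subrr mulr0.
have mst : measurable (`]s, t[ : set (measurableTypeR R)) by exact: measurable_itv.
have lst : leb R `]s, t[%classic = (t - s)%:E.
  by rewrite lebesgue_measure_itv/= lte_fin st'.
have fst : (leb R `]s, t[%classic < +oo)%E by rewrite lst ltry.
have sub u : `]s, t[%classic u -> 0 < u < T.
  rewrite /= in_itv/= => /andP[su ut].
  by rewrite (le_lt_trans s0 su) (lt_le_trans ut tT).
have mphi : measurable_fun (`]s, t[ : set (measurableTypeR R)) (fun u => phit u x).
  apply: (@measurable_comp _ _ _ _ _ _ (`]0, T[ `*` O)
    (fun z : measurableTypeR R * plane R => phit z.1 z.2) _ (fun u => (u, x))) => //.
  - by apply: measurableX => //; exact: measurable_itv.
  - move=> _ [u hu <-]; split => //=; rewrite in_itv; exact: sub.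
  - by apply: measurable_funTS; exact: pair2_measurable.
have bphi : {ae leb R, forall u, `]s, t[%classic u -> `|phit u x| <= M}.
  by apply: aeS hx => u hu /sub; exact: hu.
have iphi : (leb R).-integrable `]s, t[ (EFin \o (fun u => phit u x)).
  by apply: (ess_bounded_integrable mst fst); split => //; exists M.
(* Measurability and the bound of [phit] are known on ]0, T[ only, so the end points are removed. *)
have -> : \int[leb R]_(tau in `[s, t]) phit tau x =
    \int[leb R]_(tau in `]s, t[) phit tau x.
  congr fine; rewrite -integral_itv_bndo_bndc; last first.
    by apply/measurable_EFinP/measurable_fun_itv_obnd_cbndP.
  by rewrite -integral_itv_obnd_cbnd//; exact/measurable_EFinP.
apply: le_trans (le_normr_Rintegral mst iphi) _.
have -> : M * (t - s) = \int[leb R]_(u in `]s, t[) (cst M u).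
  by rewrite Rintegral_cst//= lst.
apply: (ae_le_Rintegral mst) => //.
- exact: integrable_norm.
- exact: integrable_cstr.
Qed.

Lemma lipschitz_continuous (f : R -> R) (L : R) :
  (forall s t, `|f t - f s| <= L * `|t - s|) -> continuous f.
Proof.
move=> hf x; apply/cvgrPdist_le => e e0.
pose K := `|L| + 1; have K0 : 0 < K by rewrite ltr_wpDl.
near=> y.
apply: le_trans (hf _ _) _.
apply: (@le_trans _ _ (K * `|x - y|)).
  by rewrite ler_wpM2r// (le_trans (ler_norm _))// lerDl.
rewrite mulrC -ler_pdivlMr//; near: y.
have eK : 0 < e / K by rewrite divr_gt0.
by exists (e / K) => //= y /ltW.
Unshelve. all: by end_near. Qed.

End time_regularity.

(** * Increments of the quartic density and of its derivative *)

Section polynomial_bounds.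
Context {R : realType}.
Implicit Types (a e y z M : R).

Lemma e1_densityE (g2 : R) z : e1_density g2 z = g2 * (z ^+ 4 - 2 * z ^+ 3).
Proof. by rewrite /e1_density /fpot; ring. Qed.

Lemma derive1_e1_density (g2 : R) (z : R) :
  derive1 (e1_density g2) z = g2 * (4 * z ^+ 3 - 6 * z ^+ 2).
Proof.
rewrite derive1E.
have h : is_derive z (1 : R) (fun z => g2 * (z ^+ 4 - 2 * z ^+ 3))
    (g2 * (4 * z ^+ 3 - 6 * z ^+ 2)).
  have hX n : is_derive z (1 : R) (fun y : R => y ^+ n) (n%:R * z ^+ n.-1).
    have := is_deriveX n (is_derive_id z (1 : R)); rewrite exprfctE.
    by move/is_derive_eq; apply; rewrite /GRing.scale/= mulr1.
  apply: (is_derive_eq (is_deriveZ g2 (is_deriveB (hX 4) (is_deriveZ 2 (hX 3))))).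
  by rewrite /GRing.scale/=; ring.
rewrite (_ : e1_density g2 = (fun z => g2 * (z ^+ 4 - 2 * z ^+ 3))).
  exact: (@derive_val _ _ _ _ _ _ _ h).
by apply/funext => y; exact: e1_densityE.
Qed.

Lemma ler_normP (x y : R) : (- y <= x) -> x <= y -> `|x| <= y.
Proof. by move=> h1 h2; rewrite ler_norml h1. Qed.

(** Only the exact value [a] is bounded, the perturbed value [a - e] is not; hence the increment of
    this cubic keeps the power |e|^3, and that of the quartic below keeps |e|^4. *)
Lemma derive1_e1_density_diff (g2 : R) M a e : 0 < g2 -> `|a| <= M ->
  `|derive1 (e1_density g2) a - derive1 (e1_density g2) (a - e)| <=
  g2 * (24 * M ^+ 2 + 22) * (`|e| + `|e| ^+ 3).
Proof.
move=> g20 aM.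
have a2 : a ^+ 2 <= M ^+ 2 by rewrite -real_normK ?num_real// lerXn2r// ?nnegrE// (le_trans _ aM).
rewrite !derive1_e1_density.
have -> : g2 * (4 * a ^+ 3 - 6 * a ^+ 2) - g2 * (4 * (a - e) ^+ 3 - 6 * (a - e) ^+ 2) =
  g2 * (e * (12 * a ^+ 2 - 12 * (a * e) + 4 * e ^+ 2 - 12 * a + 6 * e)) by ring.
rewrite normrM (ger0_norm (ltW g20)) -mulrA ler_pM2l// normrM.
have -> : (24 * M ^+ 2 + 22) * (`|e| + `|e| ^+ 3) =
  `|e| * ((24 * M ^+ 2 + 22) * (1 + `|e| ^+ 2)) by ring.
apply: ler_wpM2l => //; rewrite real_normK ?num_real//.
have e0 := sqr_ge0 e; have M0 := sqr_ge0 M; have Me := mulr_ge0 M0 e0.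
have h1 := sqr_ge0 (a - e); have h2 := sqr_ge0 (a + e).
have h3 := sqr_ge0 (a - 1); have h4 := sqr_ge0 (a + 1).
have h5 := sqr_ge0 (e - 1); have h6 := sqr_ge0 (e + 1).
by apply: ler_normP; nra.
Qed.

Lemma e1_density_diff (g2 : R) M a e : 0 < g2 -> `|a| <= M ->
  `|e1_density g2 a - e1_density g2 (a - e)| <=
  g2 * (4 * M ^+ 3 + 12 * M ^+ 2 + 10 * M + 3) * (`|e| + `|e| ^+ 4).
Proof.
move=> g20 aM; rewrite !e1_densityE.
have -> : g2 * (a ^+ 4 - 2 * a ^+ 3) - g2 * ((a - e) ^+ 4 - 2 * (a - e) ^+ 3) =
  g2 * (e * (4 * a ^+ 3 - 6 * (a ^+ 2 * e) + 4 * (a * e ^+ 2) - e ^+ 3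
   - 6 * a ^+ 2 + 6 * (a * e) - 2 * e ^+ 2)) by ring.
rewrite normrM (ger0_norm (ltW g20)) -mulrA ler_pM2l// normrM.
have -> (k : R) : k * (`|e| + `|e| ^+ 4) = `|e| * (k * (1 + `|e| ^+ 3)) by ring.
apply: ler_wpM2l => //.
set y := `|e|; have y0 : 0 <= y by rewrite normr_ge0.
set x := `|a|; have x0 : 0 <= x by rewrite normr_ge0.
apply: (@le_trans _ _ (4 * x ^+ 3 + 6 * (x ^+ 2 * y) + 4 * (x * y ^+ 2) + y ^+ 3
   + 6 * x ^+ 2 + 6 * (x * y) + 2 * y ^+ 2)).
  have mon (m X : R) : `|m| = X -> - X <= m /\ m <= X.
    by move=> <-; rewrite lerNl -normrN ler_norm; split => //; rewrite normrN ler_norm.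
  have [? ?] := mon (a ^+ 3) (x ^+ 3) (normrX _ _).
  have [? ?] := mon (a ^+ 2) (x ^+ 2) (normrX _ _).
  have [? ?] := mon (e ^+ 3) (y ^+ 3) (normrX _ _).
  have [? ?] := mon (e ^+ 2) (y ^+ 2) (normrX _ _).
  have [? ?] : - (x ^+ 2 * y) <= a ^+ 2 * e /\ a ^+ 2 * e <= x ^+ 2 * y.
    by apply: mon; rewrite normrM normrX.
  have [? ?] : - (x * y ^+ 2) <= a * e ^+ 2 /\ a * e ^+ 2 <= x * y ^+ 2.
    by apply: mon; rewrite normrM normrX.
  have [? ?] : - (x * y) <= a * e /\ a * e <= x * y.
    by apply: mon; rewrite normrM.
  by apply: ler_normP; lra.
have y13 : y <= 1 + y ^+ 3 by have [?|?] := leP y 1; nra.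
have y23 : y ^+ 2 <= 1 + y ^+ 3 by have [?|?] := leP y 1; nra.
have M0 : 0 <= M by exact: le_trans aM.
have x2 : x ^+ 2 <= M ^+ 2 by rewrite lerXn2r.
have x3 : x ^+ 3 <= M ^+ 3 by rewrite lerXn2r.
have p1 : x ^+ 2 * y <= M ^+ 2 * (1 + y ^+ 3) by rewrite ler_pM// sqr_ge0.
have p2 : x * y ^+ 2 <= M * (1 + y ^+ 3) by rewrite ler_pM// sqr_ge0.
have p3 : x * y <= M * (1 + y ^+ 3) by rewrite ler_pM.
have Y0 : 0 <= y ^+ 3 by rewrite exprn_ge0.
have q3 : x ^+ 3 <= M ^+ 3 * (1 + y ^+ 3).
  by rewrite (le_trans x3)// ler_peMr ?exprn_ge0// lerDl.
have q2 : x ^+ 2 <= M ^+ 2 * (1 + y ^+ 3).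
  by rewrite (le_trans x2)// ler_peMr ?exprn_ge0// lerDl.
lra.
Qed.

End polynomial_bounds.

Section exact_solution_bounds.
Context {R : realType}.
Implicit Types (O : set (plane R)) (u v : plane R -> R).
Local Notation lam := (leb2 R).

Lemma ess_bounded_e1_density O (g2 : R) u : measurable O -> (lam O < +oo)%E ->
  ess_bounded lam O u -> ess_bounded lam O (fun x => e1_density g2 (u x)).
Proof.
move=> mO fO bu; rewrite (_ : (fun x => _) =
    (fun x => g2 * (u x ^+ 4 - 2 * u x ^+ 3))).
  apply: ess_boundedZ => //; apply: ess_boundedB => //; first exact: ess_boundedX.
  by apply: ess_boundedZ => //; exact: ess_boundedX.
by apply/funext => x; exact: e1_densityE.
Qed.

Lemma clamp_nonexpansive (T s t : R) : 0 < T -> s <= t ->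
  Num.max 0 (Num.min T s) <= Num.max 0 (Num.min T t) /\
  Num.max 0 (Num.min T t) - Num.max 0 (Num.min T s) <= t - s.
Proof.
move=> T0 st; case: (leP T s) => Ts; case: (leP T t) => Tt.
- by rewrite !(max_r (ltW T0)); split; lra.
- by exfalso; lra.
- by rewrite (max_r (ltW T0)); case: (leP 0 s) => s0; split; lra.
- by case: (leP 0 s) => s0; case: (leP 0 t) => t0; split; lra.
Qed.

Lemma E1_diff O (g2 M : R) u v : measurable O -> (lam O < +oo)%E -> 0 < g2 ->
  ess_bounded lam O u -> ess_bounded lam O v ->
  {ae lam, forall x, O x -> `|u x| <= M} ->
  `|E1 O g2 u - E1 O g2 v| <= g2 * (4 * M ^+ 3 + 12 * M ^+ 2 + 10 * M + 3) *
    \int[lam]_(x in O) (`|u x - v x| + `|u x - v x| ^+ 4).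
Proof.
move=> mO fO g20 bu bv uM.
have bw := ess_bounded_norm (ess_boundedB bu bv).
have iw : lam.-integrable O (EFin \o (fun x => `|u x - v x| + `|u x - v x| ^+ 4)).
  apply: (ess_bounded_integrable mO fO); apply: ess_boundedD => //.
  exact: ess_boundedX.
have iu := ess_bounded_integrable mO fO (ess_bounded_e1_density g2 mO fO bu).
have iv := ess_bounded_integrable mO fO (ess_bounded_e1_density g2 mO fO bv).
have iuv := integrableBr mO iu iv.
rewrite /E1 -RintegralB// (le_trans (le_normr_Rintegral mO iuv))//.
rewrite -RintegralZl//; apply: (ae_le_Rintegral mO).
- exact: integrable_norm.
- exact: integrableZ.
apply: aeS uM => x + Ox => /(_ Ox) uM.
by have := e1_density_diff (u x - v x) g20 uM; rewrite subKr.
Qed.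

(** The essential bound of phi_t and the integral form of the time derivative make phi Lipschitz in
    time; together with the boundedness of phi(0) this bounds phi at every time, not only at almost
    every one. Positivity of E1 + C0, known time by time, becomes uniform because its minimum over
    [0, T] is attained. *)
Lemma exact_solution_bounds O (g2 T C0 : R) (phi phit : R -> plane R -> R) :
  open (O : set (R * R)) -> (lam O < +oo)%E -> sobolev_Loo O ->
  0 < g2 -> 0 < T ->
  time_derivative O T phi phit ->
  (forall t, 0 <= t <= T -> inH2 O (phi t) /\ 0 < E1 O g2 (phi t) + C0) ->
  jointly_measurable O T phit -> Lp_time T +oo (inLp O +oo) (Lpnorm O +oo) phit ->
  exists M c, [/\ 0 < M, 0 < c,
    forall t, 0 <= t <= T -> {ae lam, forall x, O x -> `|phi t x| <= M},
    forall s t, 0 <= s -> s <= t -> t <= T ->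
      {ae lam, forall x, O x -> `|phi t x - phi s x| <= M * (t - s)}
    & forall t, 0 <= t <= T -> c <= E1 O g2 (phi t) + C0 <= M].
Proof.
move=> oO fO sO g20 T0 dphi hphi jm hp.
have mO := open_plane_measurable oO.
have bphi t : 0 <= t <= T -> ess_bounded lam O (phi t).
  by move=> /hphi[h _]; exact: inH2_ess_bounded.
have [M1 hM1] := Lp_time_oo_ae hp.
pose L := Num.max M1 0; have L0 : 0 <= L by rewrite le_max lexx orbT.
have hL : {ae leb R, forall t, 0 < t < T -> {ae lam, forall x, O x -> `|phit t x| <= L}}.
  apply: aeS hM1 => t + tT => /(_ tT) h; apply: Lpnormoo_ae.
  by apply: le_trans h _; rewrite lee_fin le_max lexx.
have lip := time_derivative_lipschitz mO L0 jm dphi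
  (ae_bounded_ae_slices mO fO jm hL).
have [_ [M0 hM0]] : ess_bounded lam O (phi 0) by apply: bphi; rewrite lexx ltW.
pose B := `|M0| + L * T; have B0 : 0 <= B by rewrite addr_ge0// mulr_ge0// ltW.
have hB t : 0 <= t <= T -> {ae lam, forall x, O x -> `|phi t x| <= B}.
  move=> /andP[t0 tT]; have := lip 0 t (lexx _) t0 tT.
  apply: filterS2 hM0 => x + + Ox => /(_ Ox) h1 /(_ Ox) h2.
  rewrite -(subrK (phi 0 x) (phi t x)) (le_trans (ler_normD _ _))// addrC.
  apply: lerD; first by rewrite (le_trans h1)// ler_norm.
  by rewrite (le_trans h2)// ler_wpM2l// subr0.
pose KE := g2 * (4 * B ^+ 3 + 12 * B ^+ 2 + 10 * B + 3).
have KE0 : 0 <= KE.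
  by rewrite mulr_ge0 ?(ltW g20)// !addr_ge0// ?mulr_ge0// ?exprn_ge0.
have V0 : 0 <= vol O by rewrite fine_ge0.
(* The Lipschitz constant of E1 along phi: in the fourth power of L (t - s), three factors t - s are
   bounded by T. *)
pose LE := KE * ((L + L ^+ 4 * T ^+ 3) * vol O).
have LE0 : 0 <= LE.
  by rewrite mulr_ge0// mulr_ge0// addr_ge0// mulr_ge0 ?exprn_ge0// ltW.
have lipE s t : 0 <= s -> s <= t -> t <= T ->
    `|E1 O g2 (phi t) - E1 O g2 (phi s)| <= LE * (t - s).
  move=> s0 st tT; have t0 := le_trans s0 st; have sT := le_trans st tT.
  have ht : 0 <= t <= T by rewrite t0.
  have hs : 0 <= s <= T by rewrite s0.
  apply: le_trans (E1_diff mO fO g20 (bphi t ht) (bphi s hs) (hB t ht)) _.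
  rewrite -/KE /LE -mulrA; apply: ler_wpM2l => //.
  have ts0 : 0 <= t - s by rewrite subr_ge0.
  have Ld0 : 0 <= L * (t - s) by rewrite mulr_ge0.
  apply: (@le_trans _ _ (\int[lam]_(x in O) (L * (t - s) + (L * (t - s)) ^+ 4))).
    apply: (ae_le_Rintegral mO).
    - apply: (ess_bounded_integrable mO fO).
      have bw := ess_bounded_norm (ess_boundedB (bphi t ht) (bphi s hs)).
      by apply: ess_boundedD => //; exact: ess_boundedX.
    - exact: integrable_cstr.
    apply: aeS (lip s t s0 st tT) => x + Ox => /(_ Ox) h.
    by rewrite lerD// lerXn2r ?nnegrE.
  rewrite Rintegral_cst// -/(vol O) mulrAC; apply: ler_wpM2r => //.
  rewrite [leRHS]mulrDl lerD2l exprMn -[leRHS]mulrA.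
  apply: ler_wpM2l; first by rewrite exprn_ge0.
  rewrite exprSr; apply: ler_wpM2r => //.
  by apply: lerXn2r; rewrite ?nnegrE ?(ltW T0)//; lra.
(* Clamping to [0, T] extends the function to a continuous one on the whole line, to which the
   extreme value theorem applies. *)
pose clamp t := Num.max 0 (Num.min T t).
have hclamp t : 0 <= clamp t <= T.
  by rewrite /clamp le_max lexx/= ge_max (ltW T0) ge_min lexx.
have clampE t : 0 <= t <= T -> clamp t = t.
  by move=> /andP[t0 tT]; rewrite /clamp min_r// max_r.
have clamp_mono s t : s <= t -> clamp s <= clamp t /\ clamp t - clamp s <= t - s.
  by move=> st; exact: clamp_nonexpansive.
pose f t := E1 O g2 (phi (clamp t)) + C0.
have cf : continuous f.
  apply: (@lipschitz_continuous _ _ LE) => s t; rewrite /f.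
  wlog st : s t / s <= t.
    move=> h; have [/h//|/ltW ts] := leP s t.
    by rewrite distrC (distrC t); exact: h.
  have [h1 h2] := clamp_mono s t st.
  have /andP[s0 _] := hclamp s; have /andP[_ tT] := hclamp t.
  rewrite (_ : _ - _ = E1 O g2 (phi (clamp t)) - E1 O g2 (phi (clamp s))); last by ring.
  apply: le_trans (lipE _ _ s0 h1 tT) _; apply: ler_wpM2l => //.
  by rewrite (le_trans h2)// ler_norm.
have [t1 /[!in_itv]/= t1T hmin] := EVT_min (ltW T0) (continuous_subspaceT cf).
have [t2 /[!in_itv]/= t2T hmax] := EVT_max (ltW T0) (continuous_subspaceT cf).
exists (B + L + `|f t2| + 1), (f t1); split.
- by have := normr_ge0 (f t2); lra.
- by rewrite /f clampE//; have [] := hphi t1 t1T.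
- move=> t tT; apply: aeS (hB t tT) => x + Ox => /(_ Ox) /le_trans; apply.
  by have := normr_ge0 (f t2); lra.
- move=> s t s0 st tT; apply: aeS (lip s t s0 st tT) => x + Ox => /(_ Ox) /le_trans; apply.
  apply: ler_wpM2r; first by rewrite subr_ge0.
  by have := normr_ge0 (f t2); lra.
- move=> t tT; have tin : t \in `[0, T] by rewrite in_itv.
  have := hmin t tin; have := hmax t tin; rewrite {1 4}/f clampE// => h1 ->/=.
  by apply: le_trans h1 _; have := ler_norm (f t2); lra.
Qed.

End exact_solution_bounds.

(** * Energy identity *)

(* Failing unifications would otherwise unfold the integrals and the choice of
   the weak derivatives. *)
#[local] Opaque pd laplacian Rintegral integrable integral.

Section Rintegral_lin.
Context d (T : measurableType d) (R : realType).
Variables (mu : {measure set T -> \bar R}) (D : set T) (mD : measurable D).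

(** Here [I] is the already computed integral of the tail, so that nested uses integrate a long sum
    term by term without rewriting under the integral. *)
Lemma Rintegral_linD (a : R) (f g : T -> R) (I : R) :
  mu.-integrable D (EFin \o f) -> mu.-integrable D (EFin \o g) ->
  \int[mu]_(x in D) g x = I ->
  \int[mu]_(x in D) (a * f x + g x) = a * \int[mu]_(x in D) f x + I.
Proof.
move=> fi gi <-; rewrite RintegralD//; last exact: integrableZ.
by rewrite RintegralZl.
Qed.

End Rintegral_lin.

Section energy_identity.
Context {R : realType}.
Variable O : set (plane R).
Hypotheses (oO : open (O : set (R * R))) (fO : (leb2 R O < +oo)%E).
Implicit Types (u v w : plane R -> R).
Local Notation lam := (leb2 R).

Let mO : measurable O := open_plane_measurable oO.

Let iD f g := @integrableDr _ _ _ lam O mO f g.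
Let rl a f g I := @Rintegral_linD _ _ _ lam O mO a f g I.
Let iZ a f := @integrableZ _ _ _ lam O mO a f.

Lemma Rintegral_sum2 (f : 'I_2 -> plane R -> R) :
  (forall i, lam.-integrable O (EFin \o f i)) ->
  \int[lam]_(x in O) (\sum_(i < 2) f i x) = \sum_(i < 2) \int[lam]_(x in O) f i x.
Proof.
move=> hf; rewrite big_ord_recl big_ord1 -RintegralD//.
by apply: eq_Rintegral => x _; rewrite big_ord_recl big_ord1.
Qed.

Lemma grad_dot_integrable u v i : inH1 O u -> inH1 O v ->
  lam.-integrable O (EFin \o (fun x => pd O i u x * pd O i v x)).
Proof.
move=> hu hv; apply: (sq_integrableM mO).
  by have [] := inH1_pd i mO hu.
by have [] := inH1_pd i mO hv.
Qed.

Definition grad_sq u : R := \sum_(i < 2) \int[lam]_(x in O) (pd O i u x ^+ 2).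

Lemma grad_sq_ge0 u : 0 <= grad_sq u.
Proof. by apply: sumr_ge0 => i _; exact: Rintegral_sqr_ge0. Qed.

Lemma H1sqE u : H1sq O u = \int[lam]_(x in O) (u x ^+ 2) + grad_sq u.
Proof. by []. Qed.

Lemma neumann_lin a b u v : inH2 O u -> inH2 O v ->
  neumann O u -> neumann O v -> neumann O (fun x => a * u x + b * v x).
Proof.
move=> hu hv nu nv w hw.
have [huv elap] := inH2_lin a b oO hu hv; have [huv1 _] := huv.
have [hu1 _] := hu; have [hv1 _] := hv.
have sw := inH1_sq_integrable mO hw.
have iu := sq_integrableM mO (inH2_laplacian oO hu) sw.
have iv := sq_integrableM mO (inH2_laplacian oO hv) sw.
have iuv := sq_integrableM mO (inH2_laplacian oO huv) sw.
transitivity (\int[lam]_(x in O)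
    (a * (laplacian O u x * w x) + b * (laplacian O v x * w x))).
  apply: (ae_eq_Rintegral mO).
  - exact: integrable_EFin_measurable iuv.
  - apply: (integrable_EFin_measurable (mu := lam)).
    apply: (integrableDr mO).
      apply: (integrableZ mO).
      exact: iu.
    apply: (integrableZ mO).
    exact: iv.
  apply: aeS elap => x + Ox => /(_ Ox) ->; move: (laplacian O u x) => p.
  by move: (laplacian O v x) => q; ring.
apply: etrans (rl a iu (iZ b iv) (RintegralZl b mO iv)) _.
apply: etrans (congr2 (fun p q => a * p + b * q) (nu w hw) (nv w hw)) _.
rewrite !Rintegral_sum2; [|by move=> i; exact: grad_dot_integrable..].
rewrite !mulrN -opprD; congr (- _); rewrite !mulr_sumr -big_split/=.
apply: eq_bigr => i _.
have gu := grad_dot_integrable i hu1 hw; have gv := grad_dot_integrable i hv1 hw.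
rewrite -RintegralZl// -[X in _ + X]RintegralZl// -RintegralD//; [|exact: integrableZ..].
apply: (ae_eq_Rintegral mO).
- apply: (integrable_EFin_measurable (mu := lam)).
  by apply: (integrableDr mO); exact: integrableZ.
- exact: integrable_EFin_measurable (grad_dot_integrable i huv1 hw).
apply: aeS (pd_lin i a b oO hu1 hv1) => x + Ox => /(_ Ox) ->.
move: (pd O i u x) (pd O i v x) (pd O i w x) => p q r; ring.
Qed.

(** The Neumann condition is tested with the constant 1, whose weak gradient vanishes. *)
Lemma Rintegral_laplacian_eq0 u : inH2 O u -> neumann O u ->
  \int[lam]_(x in O) laplacian O u x = 0.
Proof.
move=> hu nu; have [hu1 _] := hu; have [h1 pd1] := inH1_cst 1 oO fO.
transitivity (\int[lam]_(x in O) (laplacian O u x * (fun=> 1) x)).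
  by apply: eq_Rintegral => x _; rewrite mulr1.
rewrite (nu _ h1) Rintegral_sum2; last by move=> i; exact: grad_dot_integrable.
rewrite big1 ?oppr0// => i _.
transitivity (\int[lam]_(x in O) (cst (0 : R) x)).
  apply: (ae_eq_Rintegral mO) => //.
    exact: integrable_EFin_measurable (grad_dot_integrable i hu1 h1).
  by apply: aeS (pd1 i) => x + Ox => /(_ Ox) ->; rewrite mulr0.
by rewrite Rintegral_cst// mul0r.
Qed.

(** Green's formula is applied with the test function w1 - w0; the mixed gradient products cancel in
    the sum, which is why the Crank-Nicolson average yields an exact difference. *)
Lemma Rintegral_laplacian_difference w0 w1 :
  inH2 O w0 -> inH2 O w1 -> neumann O w0 -> neumann O w1 ->
  \int[lam]_(x in O) (laplacian O w1 x * (w1 x - w0 x)) +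
  \int[lam]_(x in O) (laplacian O w0 x * (w1 x - w0 x)) =
  grad_sq w0 - grad_sq w1.
Proof.
move=> h0 h1 n0 n1; have [h01 _] := h0; have [h11 _] := h1.
pose del x := 1 * w1 x + -1 * w0 x.
have hdel : inH1 O del := inH1_lin 1 (-1) oO h11 h01.
have delE x : w1 x - w0 x = del x by rewrite /del mul1r mulN1r.
have key w : inH2 O w -> neumann O w ->
    \int[lam]_(x in O) (laplacian O w x * (w1 x - w0 x)) =
    \sum_(i < 2) (\int[lam]_(x in O) (pd O i w x * pd O i w0 x) -
                  \int[lam]_(x in O) (pd O i w x * pd O i w1 x)).
  move=> hw nw; have [hw1 _] := hw.
  transitivity (\int[lam]_(x in O) (laplacian O w x * del x)).
    by apply: eq_Rintegral => x _; rewrite delE.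
  rewrite (nw _ hdel) Rintegral_sum2; last by move=> i; exact: grad_dot_integrable.
  rewrite -sumrN; apply: eq_bigr => i _.
  have g0 := grad_dot_integrable i hw1 h01; have g1 := grad_dot_integrable i hw1 h11.
  rewrite -RintegralB// -mulN1r -RintegralZl//; last exact: grad_dot_integrable.
  apply: (ae_eq_Rintegral mO).
  - apply: (integrable_EFin_measurable (mu := lam)); apply: (integrableZ mO).
    exact: grad_dot_integrable.
  - by apply: (integrable_EFin_measurable (mu := lam)); exact: integrableBr.
  apply: aeS (pd_lin i 1 (-1) oO h11 h01) => x + Ox => /(_ Ox) ->.
  by move: (pd O i w x) (pd O i w1 x) (pd O i w0 x) => p q r; ring.
apply: etrans (congr2 +%R (key w1 h1 n1) (key w0 h0 n0)) _.
rewrite -big_split/=.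
rewrite /grad_sq -sumrB.
apply: eq_bigr => i _.
have -> : \int[lam]_(x in O) (pd O i w0 x ^+ 2) =
    \int[lam]_(x in O) (pd O i w0 x * pd O i w0 x).
  by apply: eq_Rintegral => x _; rewrite expr2.
have -> : \int[lam]_(x in O) (pd O i w1 x ^+ 2) =
    \int[lam]_(x in O) (pd O i w1 x * pd O i w1 x).
  by apply: eq_Rintegral => x _; rewrite expr2.
have -> : \int[lam]_(x in O) (pd O i w1 x * pd O i w0 x) =
    \int[lam]_(x in O) (pd O i w0 x * pd O i w1 x).
  by apply: eq_Rintegral => x _; rewrite mulrC.
set P := \int[lam]_(x in O) (pd O i w0 x * pd O i w1 x); move: P => P.
set A := \int[lam]_(x in O) _; set B := \int[lam]_(x in O) _.
move: A B => A B; ring.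
Qed.

(** The scalar part of the energy identity is isolated so that [field] meets variables in place of
    integrals; [mass_algebra] plays the same part for the mass identity. *)
Lemma energy_algebra (g1 g2 dt m D L1 L0 G0 G1 A0 A1 FD J K : R) : 0 < dt ->
  L1 + L0 = G0 - G1 ->
  dt^-1 * D = g1 / 2 * L1 + (g1 / 2 * L0 + (g2 * A0 + (- g2 * A1 +
    (-1 * FD + (m * J + K))))) ->
  D / dt + (g1 / 2 * G1 + g2 * A1) = (g1 / 2 * G0 + g2 * A0) - FD + m * J + K.
Proof.
move=> dt0 hL hD; rewrite [D / dt]mulrC hD.
have -> : L1 = G0 - G1 - L0 by rewrite -hL addrK.
by field.
Qed.

Lemma mass_algebra (c dt J L1 L0 I M K : R) : 0 < dt ->
  dt^-1 * J = c * L1 + (c * L0 + (-1 * I + (M + K))) ->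
  L1 = 0 -> L0 = 0 -> M = I -> J = dt * K.
Proof.
move=> dt0 h L10 L00 MI; move: h; rewrite MI L10 L00 mulr0 !add0r mulN1r addKr => <-.
by rewrite mulrA mulfV ?gt_eqF// mul1r.
Qed.

(** The equation is paired with w1 - w0, and the averages turn the linear terms into exact
    differences. Since [F] and [tau] are arbitrary, the identity serves both the error equation and,
    with tau = 0, the scheme itself. *)
Lemma energy_identity (g1 g2 dt m : R) w0 w1 F tau : 0 < dt ->
  inH2 O w0 -> inH2 O w1 -> neumann O w0 -> neumann O w1 ->
  ess_bounded lam O w0 -> ess_bounded lam O w1 -> ess_bounded lam O F ->
  sq_integrable lam O tau ->
  {ae lam, forall x, O x -> (w1 x - w0 x) / dt =
     g1 * ((laplacian O w1 x + laplacian O w0 x) / 2)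
     - 2 * g2 * ((w1 x + w0 x) / 2) - F x + m + tau x} ->
  (\int[lam]_(x in O) ((w1 x - w0 x) ^+ 2)) / dt +
   (g1 / 2 * grad_sq w1 + g2 * \int[lam]_(x in O) (w1 x ^+ 2)) =
   (g1 / 2 * grad_sq w0 + g2 * \int[lam]_(x in O) (w0 x ^+ 2))
   - \int[lam]_(x in O) (F x * (w1 x - w0 x))
   + m * \int[lam]_(x in O) (w1 x - w0 x)
   + \int[lam]_(x in O) (tau x * (w1 x - w0 x)).
Proof.
move=> dt0 h0 h1 n0 n1 b0 b1 bF st eqn.
pose del x := w1 x - w0 x.
have bdel : ess_bounded lam O del := ess_boundedB b1 b0.
have sdel := ess_bounded_sq_integrable mO fO bdel.
have l0 := sq_integrableM mO (inH2_laplacian oO h0) sdel.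
have l1 := sq_integrableM mO (inH2_laplacian oO h1) sdel.
have iw0 := ess_bounded_integrable mO fO (ess_boundedX 2 b0).
have iw1 := ess_bounded_integrable mO fO (ess_boundedX 2 b1).
have iF := ess_bounded_integrable mO fO (ess_boundedM bF bdel).
have idel := ess_bounded_integrable mO fO bdel.
have id2 := ess_bounded_integrable mO fO (ess_boundedX 2 bdel).
have itau := sq_integrableM mO st sdel.
have lapdiff := Rintegral_laplacian_difference h0 h1 n0 n1.
have i6 := iD (iZ m idel) itau.
have i5 := iD (iZ (-1) iF) i6.
have i4 := iD (iZ (- g2) iw1) i5.
have i3 := iD (iZ g2 iw0) i4.
have i2 := iD (iZ (g1 / 2) l0) i3.
have i1 := iD (iZ (g1 / 2) l1) i2.
have : \int[lam]_(x in O) (dt^-1 * del x ^+ 2) = \int[lam]_(x in O)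
    (g1 / 2 * (laplacian O w1 x * del x) + (g1 / 2 * (laplacian O w0 x * del x) +
     (g2 * w0 x ^+ 2 + (- g2 * w1 x ^+ 2 +
       (-1 * (F x * del x) + (m * del x + tau x * del x)))))).
  apply: (ae_eq_Rintegral mO).
  - by apply: (integrable_EFin_measurable (mu := lam)); exact: integrableZ.
  - exact: integrable_EFin_measurable i1.
  apply: aeS eqn => x + Ox => /(_ Ox) eqx.
  transitivity (((w1 x - w0 x) / dt) * del x).
    by rewrite /del expr2 mulrCA mulrA.
  rewrite eqx /del; move: (laplacian O w1 x) (laplacian O w0 x) => p q.
  by move: (w0 x) (w1 x) (F x) (tau x) => y0 y1 f t; field.
have rhs := rl (g1 / 2) l1 i2 (rl (g1 / 2) l0 i3 (rl g2 iw0 i4 (rl (- g2) iw1 i5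
  (rl (-1) iF i6 (rl m idel itau erefl))))).
move=> lhs.
exact: energy_algebra dt0 lapdiff (etrans (etrans (esym (RintegralZl dt^-1 mO id2)) lhs) rhs).
Qed.

(** Integrating the equation over O kills the Laplacians, and the Lagrange multiplier cancels the
    remaining terms: mass is conserved up to tau. *)
Lemma mass_identity (g1 g2 dt : R) w0 w1 F tau : 0 < dt -> 0 < vol O ->
  inH2 O w0 -> inH2 O w1 -> neumann O w0 -> neumann O w1 ->
  ess_bounded lam O w0 -> ess_bounded lam O w1 -> ess_bounded lam O F ->
  sq_integrable lam O tau ->
  {ae lam, forall x, O x -> (w1 x - w0 x) / dt =
     g1 * ((laplacian O w1 x + laplacian O w0 x) / 2)
     - 2 * g2 * ((w1 x + w0 x) / 2) - F x
     + mean O (fun y => 2 * g2 * ((w1 y + w0 y) / 2) + F y) + tau x} ->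
  \int[lam]_(x in O) (w1 x - w0 x) = dt * \int[lam]_(x in O) tau x.
Proof.
move=> dt0 V0 h0 h1 n0 n1 b0 b1 bF st eqn.
have idel := ess_bounded_integrable mO fO (ess_boundedB b1 b0).
have l0 := sq_integrable_integrable mO fO (inH2_laplacian oO h0).
have l1 := sq_integrable_integrable mO fO (inH2_laplacian oO h1).
have it := sq_integrable_integrable mO fO st.
pose f y := 2 * g2 * ((w1 y + w0 y) / 2) + F y.
have bf : ess_bounded lam O f.
  apply: ess_boundedD => //; apply: ess_boundedZ.
  rewrite (_ : (fun x => _) = (fun x => 2^-1 * (w1 x + w0 x))).
    exact/ess_boundedZ/ess_boundedD.
  by apply/funext => x; rewrite mulrC.
have if_ := ess_bounded_integrable mO fO bf.
set m := mean O f in eqn.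
have im := integrable_cstr mO fO m.
have i4 := iD im it.
have i3 := iD (iZ (-1) if_) i4.
have i2 := iD (iZ (g1 / 2) l0) i3.
have i1 := iD (iZ (g1 / 2) l1) i2.
have : \int[lam]_(x in O) (dt^-1 * (w1 x - w0 x)) = \int[lam]_(x in O)
    (g1 / 2 * laplacian O w1 x + (g1 / 2 * laplacian O w0 x +
     (-1 * f x + (m + tau x)))).
  apply: (ae_eq_Rintegral mO).
  - by apply: (integrable_EFin_measurable (mu := lam)); exact: integrableZ.
  - exact: integrable_EFin_measurable i1.
  apply: aeS eqn => x + Ox => /(_ Ox) eqx.
  rewrite mulrC eqx /f; move: (laplacian O w1 x) (laplacian O w0 x) => p q.
  by move: (w0 x) (w1 x) (F x) (tau x) => y0 y1 g t; field.
have rhs := rl (g1 / 2) l1 i2 (rl (g1 / 2) l0 i3 (rl (-1) if_ i4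
  (RintegralD mO im it))).
move=> lhs.
apply: (mass_algebra dt0 (etrans (etrans (esym (RintegralZl dt^-1 mO idel)) lhs) rhs)).
- exact: Rintegral_laplacian_eq0.
- exact: Rintegral_laplacian_eq0.
- rewrite Rintegral_cst// -/(vol O) /m /mean; move: (\int[lam]_(x in O) f x) => I.
  by rewrite mulrAC mulVf ?gt_eqF// mul1r.
Qed.

Lemma H1sq_lin_le u v : inH1 O u -> inH1 O v ->
  H1sq O (fun x => u x - v x) <= 2 * (H1sq O u + H1sq O v).
Proof.
move=> hu hv.
have E : (fun x => u x - v x) = (fun x => 1 * u x + -1 * v x).
  by apply/funext => x; rewrite mul1r mulN1r.
rewrite E; have huv := inH1_lin 1 (-1) oO hu hv.
have key (f g h : plane R -> R) : sq_integrable lam O f -> sq_integrable lam O g ->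
    sq_integrable lam O h -> {ae lam, forall x, O x -> h x = 1 * f x + -1 * g x} ->
    \int[lam]_(x in O) (h x ^+ 2) <= 2 * (\int[lam]_(x in O) (f x ^+ 2) +
       \int[lam]_(x in O) (g x ^+ 2)).
  move=> [_ if_] [_ ig] [_ ih] hE; rewrite -RintegralD// -RintegralZl//; last first.
    exact: (integrableDr mO).
  apply: (ae_le_Rintegral mO) => //.
    by apply: (integrableZ mO); exact: (integrableDr mO).
  apply: aeS hE => x + Ox => /(_ Ox) ->.
  by have := sqr_ge0 (f x + g x); nra.
rewrite /H1sq.
rewrite addrACA mulrDr.
apply: lerD.
  by apply: key; [exact: inH1_sq_integrable..|exact: aeW].
rewrite -big_split/= mulr_sumr; apply: ler_sum => i _.
apply: key.
- by have [] := inH1_pd i mO hu.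
- by have [] := inH1_pd i mO hv.
- by have [] := inH1_pd i mO huv.
- exact: pd_lin.
Qed.

End energy_identity.

(** * Estimates of the nonlinear terms *)

Section nonlinear_integrals.
Context d (T : measurableType d) (R : realType).
Variables (mu : {measure set T -> \bar R}) (D : set T).
Hypotheses (mD : measurable D) (fD : (mu D < +oo)%E).
Implicit Types (e f g z : T -> R).

Let V := fine (mu D).

Let iB f := @ess_bounded_integrable _ _ _ mu D mD fD f.

Let le_int f g : ess_bounded mu D f -> ess_bounded mu D g ->
  {ae mu, forall x, D x -> f x <= g x} ->
  \int[mu]_(x in D) f x <= \int[mu]_(x in D) g x.
Proof. by move=> bf bg; exact: (ae_le_Rintegral mD (iB bf) (iB bg)). Qed.

Lemma measure_fine_ge0 : 0 <= V.
Proof. exact: fine_ge0. Qed.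

Lemma Rintegral_abs_sqr_le f : ess_bounded mu D f ->
  (\int[mu]_(x in D) `|f x|) ^+ 2 <= V * \int[mu]_(x in D) (f x ^+ 2).
Proof.
move=> bf; have sf := ess_bounded_sq_integrable mD fD (ess_bounded_norm bf).
have s1 := ess_bounded_sq_integrable mD fD (ess_bounded_cst mu D (1 : R)).
have := cauchy_schwarz_Rintegral mD s1 sf.
rewrite (eq_Rintegral _ (g := fun x => `|f x|)); last by move=> x _; rewrite mul1r.
rewrite (eq_Rintegral _ (g := fun=> 1) (f := fun=> 1 ^+ 2)); last by move=> x _; rewrite expr1n.
rewrite Rintegral_cst// mul1r -/V (eq_Rintegral _ (g := fun x => f x ^+ 2) (f := fun x => `|f x| ^+ 2))//.
by move=> x _; rewrite real_normK ?num_real.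
Qed.

Lemma Rintegral_sqr_cross e z : ess_bounded mu D e -> ess_bounded mu D z ->
  (\int[mu]_(x in D) (e x ^+ 2 * z x ^+ 2)) ^+ 2 <=
  \int[mu]_(x in D) (e x ^+ 4) * \int[mu]_(x in D) (z x ^+ 4).
Proof.
move=> be bz.
have se := ess_bounded_sq_integrable mD fD (ess_boundedX 2 be).
have sz := ess_bounded_sq_integrable mD fD (ess_boundedX 2 bz).
apply: le_trans (cauchy_schwarz_Rintegral mD se sz) _.
rewrite (eq_Rintegral _ (g := fun x => e x ^+ 4) (f := fun x => (e x ^+ 2) ^+ 2)).
  rewrite (eq_Rintegral _ (g := fun x => z x ^+ 4) (f := fun x => (z x ^+ 2) ^+ 2))//.
  by move=> x _; rewrite -exprM.
by move=> x _; rewrite -exprM.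
Qed.

(** By [E1_diff] this controls the change of E1, hence of the square root in [sfun]: it is the
    nonlocal part of the error of s. *)
Definition eta e := \int[mu]_(x in D) (`|e x| + `|e x| ^+ 4).

Lemma eta_ge0 e : 0 <= eta e.
Proof. by apply: Rintegral_ge0 => x _; rewrite addr_ge0 ?exprn_ge0. Qed.

Lemma etaE e : ess_bounded mu D e ->
  eta e = \int[mu]_(x in D) `|e x| + \int[mu]_(x in D) (e x ^+ 4).
Proof.
move=> be; rewrite /eta.
have b1 := ess_bounded_norm be.
rewrite (RintegralD mD (iB b1) (iB (ess_boundedX 4 b1))); congr (_ + _).
by apply: eq_Rintegral => x _; rewrite -normrX ger0_norm// (exprM _ 2 2) sqr_ge0.
Qed.

(** Cauchy-Schwarz gives (int |e|)^2 <= V H, and the L^4 bound gives int e^4 <= S H, whose square is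
    at most S^2 H when H <= 1. *)
Lemma eta_sqr_le (S H : R) e : ess_bounded mu D e -> 0 <= S ->
  \int[mu]_(x in D) (e x ^+ 2) <= H -> H <= 1 ->
  \int[mu]_(x in D) (e x ^+ 4) <= S * \int[mu]_(x in D) (e x ^+ 2) * H ->
  eta e ^+ 2 <= (2 * V + 2 * S ^+ 2) * H.
Proof.
move=> be S0; rewrite (etaE be); have := Rintegral_abs_sqr_le be.
have Q0 : 0 <= \int[mu]_(x in D) (e x ^+ 4).
  by apply: Rintegral_ge0 => x _; rewrite (exprM _ 2 2) sqr_ge0.
have := Rintegral_sqr_ge0 mu D e; have := measure_fine_ge0.
move: Q0; move: (\int[mu]_(x in D) `|e x|) (\int[mu]_(x in D) (e x ^+ 2)) => B A.
move: (\int[mu]_(x in D) (e x ^+ 4)) => Q Q0 V0 A0 hB AH H1 hQ.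
have H0 : 0 <= H := le_trans A0 AH.
have B2 : B ^+ 2 <= V * H by rewrite (le_trans hB)// ler_wpM2l.
have Q1 : Q <= S * H.
  rewrite (le_trans hQ)// -mulrA ler_wpM2l// ler_piMl// (le_trans AH)//.
have Q2 : Q ^+ 2 <= S ^+ 2 * H.
  apply: (@le_trans _ _ ((S * H) ^+ 2)); first by rewrite lerXn2r// nnegrE mulr_ge0.
  by rewrite exprMn ler_wpM2l ?sqr_ge0// expr2 ler_piMl.
by have := sqr_ge0 (B - Q); nra.
Qed.

Lemma Rintegral_abs_le_eta (C : R) e z : 0 <= C -> ess_bounded mu D e ->
  ess_bounded mu D z ->
  {ae mu, forall x, D x -> `|z x| <= C * (eta e + `|e x| + `|e x| ^+ 3)} ->
  \int[mu]_(x in D) `|z x| <= C * (V + 2) * eta e.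
Proof.
move=> C0 be bz hz; have b1 := ess_bounded_norm be.
have b4 := ess_boundedX 4 b1.
(* For y >= 0, y + y^3 <= 2 (y + y^4), by comparing y^3 with y when y <= 1 and with y^4
   otherwise. *)
apply: (@le_trans _ _ (\int[mu]_(x in D) (C * (eta e + 2 * (`|e x| + `|e x| ^+ 4))))).
  apply: le_int; first exact: ess_bounded_norm.
    apply: ess_boundedZ; apply: ess_boundedD; first exact: ess_bounded_cst.
    exact/ess_boundedZ/ess_boundedD.
  move: hz; apply: filterS => x + Dx => /(_ Dx) h; apply: le_trans h _.
  apply: ler_wpM2l => //; rewrite -addrA lerD2l; have := normr_ge0 (e x).
  move: (`|e x|) => y y0; have [y1|y1] := leP y 1; first by nra.
  by have := exprn_ege1 3 (ltW y1); nra.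
have b14 := ess_boundedD b1 b4; have bc := ess_bounded_cst mu D (eta e).
rewrite (RintegralZl C mD (iB (ess_boundedD bc (ess_boundedZ 2 b14)))).
rewrite (RintegralD mD (iB bc) (iB (ess_boundedZ 2 b14))) (RintegralZl 2 mD (iB b14)).
rewrite -/(eta e) Rintegral_cst// -/V -mulrA ler_wpM2l//.
by rewrite (mulrDl V 2) [X in X + _]mulrC.
Qed.

(** Young's inequality with a free weight l lets the part in f^2 be fitted into the dissipation. The
    cubic term is split as (e^4 + e^2 f^2)/2 instead, because the L^4 inequality controls fourth
    powers and not e^6. *)
Lemma Rintegral_pairing_le (C l : R) e z f : 0 <= C -> 0 < l ->
  ess_bounded mu D e -> ess_bounded mu D z -> ess_bounded mu D f ->
  {ae mu, forall x, D x -> `|z x| <= C * (eta e + `|e x| + `|e x| ^+ 3)} ->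
  \int[mu]_(x in D) (`|z x| * `|f x|) <=
  C * (2 * l * \int[mu]_(x in D) (f x ^+ 2) +
    ((4 * l)^-1 * (V * eta e ^+ 2 + \int[mu]_(x in D) (e x ^+ 2)) +
     2^-1 * (\int[mu]_(x in D) (e x ^+ 4) +
             \int[mu]_(x in D) (e x ^+ 2 * f x ^+ 2)))).
Proof.
move=> C0 l0 be bz bf hz.
have f2 := ess_boundedX 2 bf; have e2 := ess_boundedX 2 be.
have e4 := ess_boundedX 4 be; have ef := ess_boundedM e2 f2.
have bc := ess_bounded_cst mu D (eta e ^+ 2).
have bce := ess_boundedD bc e2; have bee := ess_boundedD e4 ef.
have bs := ess_boundedD (ess_boundedZ (4 * l)^-1 bce) (ess_boundedZ 2^-1 bee).
have bt := ess_boundedD (ess_boundedZ (2 * l) f2) bs.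
have -> : C * (2 * l * \int[mu]_(x in D) (f x ^+ 2) +
    ((4 * l)^-1 * (V * eta e ^+ 2 + \int[mu]_(x in D) (e x ^+ 2)) +
     2^-1 * (\int[mu]_(x in D) (e x ^+ 4) +
             \int[mu]_(x in D) (e x ^+ 2 * f x ^+ 2)))) =
   \int[mu]_(x in D) (C * (2 * l * f x ^+ 2 + ((4 * l)^-1 * (eta e ^+ 2 + e x ^+ 2) +
     2^-1 * (e x ^+ 4 + e x ^+ 2 * f x ^+ 2)))).
  rewrite (RintegralZl C mD (iB bt)); congr (C * _).
  rewrite (RintegralD mD (iB (ess_boundedZ (2 * l) f2)) (iB bs)).
  rewrite (RintegralZl (2 * l) mD (iB f2)); congr (_ + _).
  rewrite (RintegralD mD (iB (ess_boundedZ (4 * l)^-1 bce)) (iB (ess_boundedZ 2^-1 bee))).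
  rewrite (RintegralZl (4 * l)^-1 mD (iB bce)) (RintegralZl 2^-1 mD (iB bee)).
  rewrite (RintegralD mD (iB bc) (iB e2)) (RintegralD mD (iB e4) (iB ef)).
  by rewrite Rintegral_cst// -/V [V * _]mulrC.
apply: le_int.
- exact: (ess_boundedM (ess_bounded_norm bz) (ess_bounded_norm bf)).
- exact: ess_boundedZ.
move: hz; apply: filterS => x + Dx => /(_ Dx) h.
apply: (@le_trans _ _ (C * (eta e + `|e x| + `|e x| ^+ 3) * `|f x|)).
  by apply: ler_wpM2r.
rewrite -mulrA; apply: ler_wpM2l => //.
rewrite -[f x ^+ 2]real_normK ?num_real// -[e x ^+ 2]real_normK ?num_real//.
have -> : e x ^+ 4 = `|e x| ^+ 4 by rewrite -normrX ger0_norm// (exprM _ 2 2) sqr_ge0.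
move: (eta e) (normr_ge0 (e x)) (normr_ge0 (f x)) (`|e x|) (`|f x|) => h0 p0 q0 p q.
have young a : a * q <= l * q ^+ 2 + (4 * l)^-1 * a ^+ 2.
  rewrite -subr_ge0 (_ : _ - _ = l^-1 * (l * q - a / 2) ^+ 2); last by field; rewrite gt_eqF.
  by rewrite mulr_ge0 ?invr_ge0 ?(ltW l0)// sqr_ge0.
have cub : p ^+ 3 * q <= 2^-1 * (p ^+ 4 + p ^+ 2 * q ^+ 2).
  rewrite -subr_ge0 (_ : _ - _ = 2^-1 * (p * (p - q)) ^+ 2); last by field.
  by rewrite mulr_ge0 ?sqr_ge0.
have -> : (h0 + p + p ^+ 3) * q = h0 * q + p * q + p ^+ 3 * q by ring.
have := young h0; have := young p; rewrite mulrDr; lra.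
Qed.

End nonlinear_integrals.

(** * Local Lipschitz estimate for s *)

Section sfun_estimates.
Context {R : realType}.
Variable O : set (plane R).
Hypotheses (mO : measurable O) (fO : (leb2 R O < +oo)%E).
Implicit Types (a b u v : plane R -> R).
Local Notation lam := (leb2 R).

Lemma ess_bounded_U (g2 : R) u : ess_bounded lam O u -> ess_bounded lam O (U g2 u).
Proof.
move=> bu; rewrite (_ : U g2 u = (fun x => g2 * (4 * u x ^+ 3 - 6 * u x ^+ 2))).
  by apply: ess_boundedZ; apply: ess_boundedB; apply: ess_boundedZ; exact: ess_boundedX.
by apply/funext => x; rewrite /U derive1_e1_density.
Qed.

Lemma ess_bounded_sfun (g2 C0 : R) u : ess_bounded lam O u ->
  ess_bounded lam O (Defs.sfun O g2 C0 u).
Proof.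
move=> bu; rewrite (_ : Defs.sfun _ _ _ _ =
    (fun x => (2 * Num.sqrt (E1 O g2 u + C0))^-1 * U g2 u x)).
  exact/ess_boundedZ/ess_bounded_U.
by apply/funext => x; rewrite /Defs.sfun mulrC.
Qed.

Lemma derive1_e1_density_le (g2 M z : R) : 0 < g2 -> `|z| <= M ->
  `|derive1 (e1_density g2) z| <= g2 * (4 * M ^+ 3 + 6 * M ^+ 2).
Proof.
move=> g20 zM; rewrite derive1_e1_density normrM (ger0_norm (ltW g20)) ler_pM2l//.
apply: le_trans (ler_normB _ _) _; rewrite (normrM 4) (normrM 6) !normrX.
rewrite (ger0_norm (ler0n _ 4)) (ger0_norm (ler0n _ 6)).
by have M0 := le_trans (normr_ge0 z) zM; rewrite lerD// ler_wpM2l// lerXn2r.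
Qed.

(** Rationalising gives a difference of squares over 2 s t (s + t), and s, t >= k bounds this
    denominator below by k^3. *)
Lemma inv_sqrt_diff (k p q : R) : 0 < k -> k ^+ 2 <= p -> k ^+ 2 <= q ->
  [/\ `|(2 * Num.sqrt q)^-1| <= k^-1 &
   `|(2 * Num.sqrt p)^-1 - (2 * Num.sqrt q)^-1| <= (k ^+ 3)^-1 * `|p - q|].
Proof.
move=> k0 kp kq.
have hs (y : R) : k ^+ 2 <= y -> k <= Num.sqrt y /\ Num.sqrt y ^+ 2 = y.
  move=> ky; have y0 : 0 <= y by rewrite (le_trans _ ky)// sqr_ge0.
  by rewrite sqr_sqrtr// -[X in X <= _](gtr0_norm k0) -sqrtr_sqr ler_wsqrtr.
have [sp pE] := hs p kp; have [sq qE] := hs q kq.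
have -> : p - q = Num.sqrt p ^+ 2 - Num.sqrt q ^+ 2 by rewrite pE qE.
 move: (Num.sqrt p) (Num.sqrt q) sp sq => s t ks kt.
have s0 : 0 < s := lt_le_trans k0 ks; have t0 : 0 < t := lt_le_trans k0 kt.
split.
  rewrite ger0_norm ?invr_ge0 ?mulr_ge0 ?(ltW t0)// lef_pV2 ?posrE ?mulr_gt0//; lra.
have -> : (2 * s)^-1 - (2 * t)^-1 = - ((2 * s * t * (s + t))^-1 * (s ^+ 2 - t ^+ 2)).
  by field; rewrite !gt_eqF// addr_gt0.
rewrite normrN normrM; apply: ler_wpM2r => //.
have P0 : 0 < 2 * s * t * (s + t) by rewrite !mulr_gt0// addr_gt0.
rewrite ger0_norm ?invr_ge0 ?(ltW P0)// lef_pV2 ?posrE ?exprn_gt0//.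
have st : k * k <= s * t by rewrite ler_pM// ltW.
have : k * k * k <= s * t * (s + t).
  by rewrite ler_pM ?mulr_ge0// ?(ltW k0)//; lra.
have := mulr_gt0 (mulr_gt0 s0 t0) (addr_gt0 s0 t0); nra.
Qed.

(** In s = U / (2 sqrt(E1 + C0)) the numerator moves pointwise, by |e| + |e|^3, and the denominator
    globally, by eta. The constants precede C0, a and b, hence are common to all steps. *)
Lemma sfun_diff (g2 M c : R) : 0 < g2 -> 0 < M -> 0 < c ->
  exists h C : R, [/\ 0 < h, 0 < C & forall C0 a b,
    ess_bounded lam O a -> ess_bounded lam O b ->
    {ae lam, forall x, O x -> `|a x| <= M} -> c <= E1 O g2 a + C0 ->
    eta lam O (fun x => a x - b x) <= h ->
    {ae lam, forall x, O x -> `|Defs.sfun O g2 C0 a x - Defs.sfun O g2 C0 b x| <=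
       C * (eta lam O (fun x => a x - b x) + `|a x - b x| + `|a x - b x| ^+ 3)} /\
    {ae lam, forall x, O x -> `|Defs.sfun O g2 C0 a x| <= C}].
Proof.
move=> g20 M0 c0.
pose KE := g2 * (4 * M ^+ 3 + 12 * M ^+ 2 + 10 * M + 3).
pose k := Num.sqrt (c / 2); have k0 : 0 < k by rewrite sqrtr_gt0 divr_gt0.
have k2 : k ^+ 2 = c / 2 by rewrite sqr_sqrtr// divr_ge0// ltW.
pose KU := g2 * (4 * M ^+ 3 + 6 * M ^+ 2).
pose KD := g2 * (24 * M ^+ 2 + 22).
have M3 : 0 < M ^+ 3 by rewrite exprn_gt0.
have M2 : 0 < M ^+ 2 by rewrite exprn_gt0.
have KE0 : 0 < KE by rewrite mulr_gt0//; lra.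
have KU0 : 0 < KU by rewrite mulr_gt0//; lra.
have KD0 : 0 < KD by rewrite mulr_gt0//; lra.
pose C1 := k^-1 * KD; pose C2 := KU * ((k ^+ 3)^-1 * KE); pose C3 := KU * k^-1.
have C10 : 0 < C1 by rewrite mulr_gt0// invr_gt0.
have C20 : 0 < C2 by apply: mulr_gt0 => //; apply: mulr_gt0 => //; rewrite invr_gt0 exprn_gt0.
have C30 : 0 < C3 by rewrite mulr_gt0// invr_gt0.
(* For eta <= c / (2 KE) the value of E1 moves by at most c / 2, so that E1 + C0 stays above c / 2 =
   k^2 for b as well. *)
exists (c / 2 / KE), (C1 + C2 + C3); split; [by rewrite !divr_gt0|lra|].
move=> C0 a b ba bb aM hc het.
have hE := E1_diff mO fO g20 ba bb aM; rewrite -/KE -/(eta lam O (fun x => a x - b x)) in hE.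
have eta0 := eta_ge0 lam O (fun x => a x - b x).
move: (eta lam O (fun x => a x - b x)) eta0 het hE => et et0 het hE.
have hE2 : `|E1 O g2 a - E1 O g2 b| <= c / 2.
  by rewrite (le_trans hE)// mulrC -ler_pdivlMr.
have kp : k ^+ 2 <= E1 O g2 a + C0 by rewrite k2; lra.
have kq : k ^+ 2 <= E1 O g2 b + C0.
  by rewrite k2; have := le_trans (ler_norm _) hE2; lra.
have [iq dpq] := inv_sqrt_diff k0 kp kq.
have [ip _] := inv_sqrt_diff k0 kq kp.
have pqE : E1 O g2 a + C0 - (E1 O g2 b + C0) = E1 O g2 a - E1 O g2 b by ring.
rewrite pqE in dpq; rewrite /Defs.sfun /U.
move: (2 * Num.sqrt (E1 O g2 a + C0)) (2 * Num.sqrt (E1 O g2 b + C0)) iq dpq ip.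
move: (E1 O g2 a - E1 O g2 b) hE => dE hE p q iq dpq ip.
have k3 : 0 <= (k ^+ 3)^-1 by rewrite invr_ge0 exprn_ge0// ltW.
have {}dpq : `|p^-1 - q^-1| <= (k ^+ 3)^-1 * KE * et.
  by rewrite (le_trans dpq)// -mulrA ler_wpM2l.
split; move: aM; apply: aeS => x + Ox => /(_ Ox) aM; last first.
  have := derive1_e1_density_le g20 aM; rewrite -/KU => hU.
  rewrite normrM; apply: (@le_trans _ _ C3); last by lra.
  by rewrite ler_pM.
have hD := derive1_e1_density_diff (a x - b x) g20 aM; rewrite subKr -/KD in hD.
have hU := derive1_e1_density_le g20 aM; rewrite -/KU in hU.
move: (derive1 (e1_density g2) (a x)) (derive1 (e1_density g2) (b x)) hU hD => ua ub hU hD.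
have n0 := normr_ge0 (a x - b x); have n3 : 0 <= `|a x - b x| ^+ 3 by rewrite exprn_ge0.
move: (`|a x - b x|) (`|a x - b x| ^+ 3) n0 n3 hD => y y3 y0 y30 hD.
(* The split lets the change of the denominator multiply the bounded [ua] only; [ub] is never
   estimated alone. *)
have -> : ua / p - ub / q = q^-1 * (ua - ub) + ua * (p^-1 - q^-1) by ring.
apply: le_trans (ler_normD _ _) _; rewrite !normrM.
have t1 : `|q^-1| * `|ua - ub| <= C1 * (y + y3) by rewrite -mulrA ler_pM.
have t2 : `|ua| * `|p^-1 - q^-1| <= C2 * et by rewrite /C2 -[X in _ <= X]mulrA ler_pM.
have := mulr_ge0 (ltW C10) et0; have := mulr_ge0 (ltW C20) (addr_ge0 y0 y30).
have := mulr_ge0 (ltW C30) (addr_ge0 et0 (addr_ge0 y0 y30)); lra.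
Qed.

End sfun_estimates.

(** * One step of the scheme *)

Section scheme_identities.
Context {R : realType}.
Variable O : set (plane R).
Hypotheses (oO : open (O : set (R * R))) (fO : (leb2 R O < +oo)%E).
Hypotheses (V0 : 0 < vol O) (sO : sobolev_Loo O).
Variables (g1 g2 C0 dt : R).
Hypothesis dt0 : 0 < dt.
Implicit Types (a b : nat -> plane R -> R) (p q : nat -> R) (n : nat).
Local Notation lam := (leb2 R).
Local Notation sb := (s_bar O g2 C0).

Let mO : measurable O := open_plane_measurable oO.
Let iB f := @ess_bounded_integrable _ _ _ lam O mO fO f.

Lemma ess_bounded_s_bar a n : ess_bounded lam O (a n) ->
  ess_bounded lam O (a n.-1) -> ess_bounded lam O (sb a n).
Proof.
move=> b1 b0; rewrite /s_bar /extrap.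
apply: ess_boundedB; apply: ess_boundedZ; exact: ess_bounded_sfun.
Qed.

Lemma inH2_phi_mid a n : inH2 O (a n.+1) -> inH2 O (a n) ->
  inH2 O (phi_mid a n) /\
  {ae lam, forall x, O x -> laplacian O (phi_mid a n) x =
    (laplacian O (a n.+1) x + laplacian O (a n) x) / 2}.
Proof.
move=> h1 h0; have [hl el] := inH2_lin 2^-1 2^-1 oO h1 h0.
have -> : phi_mid a n = (fun x => 2^-1 * a n.+1 x + 2^-1 * a n x).
  by apply/funext => x; rewrite /phi_mid /mid mulrDl ![_ / 2]mulrC.
split; first exact: hl.
apply: aeS el => x + Ox => /(_ Ox) ->.
by move: (laplacian O (a n.+1) x) (laplacian O (a n) x) => u v; field.
Qed.

Lemma ess_bounded_phi_mid a n : ess_bounded lam O (a n.+1) ->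
  ess_bounded lam O (a n) -> ess_bounded lam O (phi_mid a n).
Proof.
move=> b1 b0.
have -> : phi_mid a n = (fun x => 2^-1 * (a n.+1 x + a n x)).
  by apply/funext => x; rewrite /phi_mid /mid mulrC.
exact/ess_boundedZ/ess_boundedD.
Qed.

Lemma phi_residual_equation a p n : inH2 O (a n.+1) -> inH2 O (a n) ->
  {ae lam, forall x, O x -> (a n.+1 x - a n x) / dt =
     g1 * ((laplacian O (a n.+1) x + laplacian O (a n) x) / 2)
     - 2 * g2 * ((a n.+1 x + a n x) / 2) - 2 * mid p n * sb a n x
     + mean O (fun y => 2 * g2 * ((a n.+1 y + a n y) / 2) + 2 * mid p n * sb a n y)
     + phi_residual O g1 g2 C0 dt a p n x}.
Proof.
move=> h1 h0; have [_ el] := inH2_phi_mid h1 h0.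
apply: aeS el => x + Ox => /(_ Ox) el; rewrite /phi_residual el.
rewrite /phi_mid /mid; set m := mean O _; move: m => m.
move: (laplacian O (a n.+1) x) (laplacian O (a n) x) (sb a n x) => u v s.
move: (a n.+1 x) (a n x) => y z; ring.
Qed.

Lemma phi_residual_sq_integrable a p n : inH2 O (a n.+1) -> inH2 O (a n) ->
  inH2 O (a n.-1) -> sq_integrable lam O (phi_residual O g1 g2 C0 dt a p n).
Proof.
move=> h2 h1 h0; have [hm _] := inH2_phi_mid h2 h1.
have b2 := inH2_ess_bounded mO sO h2; have b1 := inH2_ess_bounded mO sO h1.
have b0 := inH2_ess_bounded mO sO h0.
have bs := ess_bounded_s_bar b1 b0; have bm := ess_bounded_phi_mid b2 b1.
pose m := mean O (fun y => 2 * g2 * phi_mid a n y + 2 * mid p n * sb a n y).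
have -> : phi_residual O g1 g2 C0 dt a p n = (fun x =>
    (dt^-1 * (a n.+1 x - a n x) + 2 * g2 * phi_mid a n x +
     2 * mid p n * sb a n x - m) - g1 * laplacian O (phi_mid a n) x).
  apply/funext => x; rewrite /phi_residual -/m.
  move: (laplacian O (phi_mid a n) x) (sb a n x) (phi_mid a n x) => u s y; ring.
apply: (sq_integrableB mO); last exact/(sq_integrableZ mO)/(inH2_laplacian oO).
apply: (ess_bounded_sq_integrable mO fO); apply: ess_boundedB; last exact: ess_bounded_cst.
apply: ess_boundedD; last exact: ess_boundedZ.
apply: ess_boundedD; last exact: ess_boundedZ.
exact/ess_boundedZ/ess_boundedB.
Qed.

Lemma meanB f g : ess_bounded lam O f -> ess_bounded lam O g ->
  mean O f - mean O g = mean O (fun x => f x - g x).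
Proof.
by move=> bf bg; rewrite /mean (RintegralB mO (iB bf) (iB bg)) mulrBr.
Qed.

Definition sbdiff a b n : plane R -> R := fun x => sb a n x - sb b n x.

(** The difference of the terms 2 r s, split so that the numerical s, for which no bound is known,
    multiplies the scalar error only; this is the part that the equation for r removes. *)
Definition forcing_diff a b p q n : plane R -> R := fun x =>
  2 * mid (fun k => p k - q k) n * sb b n x + 2 * mid p n * sbdiff a b n x.

Lemma error_equation a b p q n :
  inH2 O (a n.+1) -> inH2 O (a n) -> inH2 O (a n.-1) ->
  inH2 O (b n.+1) -> inH2 O (b n) -> inH2 O (b n.-1) ->
  {ae lam, forall x, O x -> phi_residual O g1 g2 C0 dt b q n x = 0} ->
  let e k x := a k x - b k x in
  let F := forcing_diff a b p q n in
  {ae lam, forall x, O x -> (e n.+1 x - e n x) / dt =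
     g1 * ((laplacian O (e n.+1) x + laplacian O (e n) x) / 2)
     - 2 * g2 * ((e n.+1 x + e n x) / 2) - F x
     + mean O (fun y => 2 * g2 * ((e n.+1 y + e n y) / 2) + F y)
     + phi_residual O g1 g2 C0 dt a p n x}.
Proof.
move=> a2 a1 a0 b2 b1 b0 rb e F.
have ba2 := inH2_ess_bounded mO sO a2; have ba1 := inH2_ess_bounded mO sO a1.
have ba0 := inH2_ess_bounded mO sO a0.
have bb2 := inH2_ess_bounded mO sO b2; have bb1 := inH2_ess_bounded mO sO b1.
have bb0 := inH2_ess_bounded mO sO b0.
have lapE k : inH2 O (a k) -> inH2 O (b k) -> {ae lam, forall x, O x ->
    laplacian O (e k) x = laplacian O (a k) x - laplacian O (b k) x}.
  move=> ha hb; have [_ el] := inH2_lin 1 (-1) oO ha hb.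
  have -> : e k = (fun x => 1 * a k x + -1 * b k x).
    by apply/funext => x; rewrite mul1r mulN1r.
  by apply: aeS el => x + Ox => /(_ Ox) ->; rewrite mul1r mulN1r.
have l2 := lapE _ a2 b2; have l1 := lapE _ a1 b1.
have ea := phi_residual_equation p a2 a1; have eb := phi_residual_equation q b2 b1.
have bf r (c : nat -> plane R -> R) : ess_bounded lam O (c n.+1) ->
    ess_bounded lam O (c n) -> ess_bounded lam O (c n.-1) ->
    ess_bounded lam O (fun y => 2 * g2 * ((c n.+1 y + c n y) / 2) + 2 * r * sb c n y).
  move=> c2 c1 c0; apply: ess_boundedD; apply: ess_boundedZ.
    exact: (ess_bounded_phi_mid c2 c1).
  exact: ess_bounded_s_bar.
have mE : mean O (fun y => 2 * g2 * ((e n.+1 y + e n y) / 2) + F y) =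
    mean O (fun y => 2 * g2 * ((a n.+1 y + a n y) / 2) + 2 * mid p n * sb a n y) -
    mean O (fun y => 2 * g2 * ((b n.+1 y + b n y) / 2) + 2 * mid q n * sb b n y).
  rewrite (meanB (bf (mid p n) a ba2 ba1 ba0) (bf (mid q n) b bb2 bb1 bb0)).
  congr (mean O _); apply/funext => x; rewrite /e /F /forcing_diff /sbdiff /mid.
  by move: (sb a n x) (sb b n x) => s t; field.
set m := mean O (fun y => _ + F y) in mE *.
set ma := mean O (fun y => _ + _ * sb a n y) in mE ea *.
set mb := mean O (fun y => _ + _ * sb b n y) in mE eb *.
rewrite mE {mE}; move: (m) (ma) (mb) ea eb => {m ma mb} _ ma mb ea eb.
apply: aeS (filterI (filterI l2 l1) (filterI (filterI ea eb) rb)).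
move=> x [[l2x l1x] [[eax ebx] rbx]] Ox.
move: (l2x Ox) (l1x Ox) (eax Ox) (ebx Ox) (rbx Ox) => -> -> {}eax {}ebx {}rbx.
rewrite rbx addr0 in ebx.
have -> : (e n.+1 x - e n x) / dt =
  (a n.+1 x - a n x) / dt - (b n.+1 x - b n x) / dt by rewrite /e; ring.
rewrite eax ebx /e /F /forcing_diff /sbdiff /mid.
move: (laplacian O (a n.+1) x) (laplacian O (a n) x) (sb a n x) => u v s.
move: (laplacian O (b n.+1) x) (laplacian O (b n) x) (sb b n x) => u' v' s'.
move: (phi_residual _ _ _ _ _ _ _ _ _) (a n.+1 x) (a n x) (b n.+1 x) (b n x) => t y z y' z'.
by field.
Qed.

(** Evaluated on the errors, and also on the numerical values themselves, where it is the modified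
    energy that the scheme dissipates. *)
Definition energy (u : plane R -> R) (r : R) : R :=
  g1 / 2 * grad_sq O u + g2 * \int[lam]_(x in O) (u x ^+ 2) + r ^+ 2.

(** The pairing [SD] of del with the numerical s is replaced by rho1 - rho0 - ZA - res, and 2 pm
    (rho1 - rho0) = rho1^2 - rho0^2 because pm is the mean of the two. *)
Lemma step_algebra (SD X Y0 Y1 FD ZD ZA m J K pm rho0 rho1 res r : R) :
  X + Y1 = Y0 - FD + m * J + K ->
  FD = 2 * pm * SD + 2 * r * ZD ->
  rho1 - rho0 = ZA + SD + res -> pm = (rho1 + rho0) / 2 ->
  X + (Y1 + rho1 ^+ 2) = Y0 + rho0 ^+ 2 - 2 * r * ZD + 2 * pm * (ZA + res) + m * J + K.
Proof.
move=> h1 h2 h3 h4.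
have hS : SD = rho1 - rho0 - ZA - res by rewrite h3; ring.
have -> : X + (Y1 + rho1 ^+ 2) = (X + Y1) + rho1 ^+ 2 by ring.
by rewrite h1 h2 hS h4; field.
Qed.

Lemma step_identity a b p q n :
  inH2 O (a n.+1) -> inH2 O (a n) -> inH2 O (a n.-1) ->
  inH2 O (b n.+1) -> inH2 O (b n) -> inH2 O (b n.-1) ->
  neumann O (a n.+1) -> neumann O (a n) -> neumann O (b n.+1) -> neumann O (b n) ->
  {ae lam, forall x, O x -> phi_residual O g1 g2 C0 dt b q n x = 0} ->
  r_residual O g2 C0 b q n = 0 ->
  let e k x := a k x - b k x in
  let rho k := p k - q k in
  let z := sbdiff a b n in
  let tau := phi_residual O g1 g2 C0 dt a p n in
  (\int[lam]_(x in O) ((e n.+1 x - e n x) ^+ 2)) / dt + energy (e n.+1) (rho n.+1) =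
  energy (e n) (rho n)
  - 2 * mid p n * \int[lam]_(x in O) (z x * (e n.+1 x - e n x))
  + 2 * mid rho n * (\int[lam]_(x in O) (z x * (a n.+1 x - a n x)) +
                     r_residual O g2 C0 a p n)
  + mean O (fun y => 2 * g2 * ((e n.+1 y + e n y) / 2) + forcing_diff a b p q n y) *
    (dt * \int[lam]_(x in O) tau x)
  + \int[lam]_(x in O) (tau x * (e n.+1 x - e n x)).
Proof.
move=> a2 a1 a0 b2 b1 b0 na2 na1 nb2 nb1 rb rr e rho z tau.
have ba2 := inH2_ess_bounded mO sO a2; have ba1 := inH2_ess_bounded mO sO a1.
have ba0 := inH2_ess_bounded mO sO a0.
have bb2 := inH2_ess_bounded mO sO b2; have bb1 := inH2_ess_bounded mO sO b1.
have bb0 := inH2_ess_bounded mO sO b0.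
have eE k : e k = (fun x => 1 * a k x + -1 * b k x).
  by apply/funext => x; rewrite mul1r mulN1r.
have he2 : inH2 O (e n.+1) by rewrite eE; have [] := inH2_lin 1 (-1) oO a2 b2.
have he1 : inH2 O (e n) by rewrite eE; have [] := inH2_lin 1 (-1) oO a1 b1.
have ne2 : neumann O (e n.+1) by rewrite eE; exact: neumann_lin.
have ne1 : neumann O (e n) by rewrite eE; exact: neumann_lin.
have be2 : ess_bounded lam O (e n.+1) := ess_boundedB ba2 bb2.
have be1 : ess_bounded lam O (e n) := ess_boundedB ba1 bb1.
have bsa := ess_bounded_s_bar ba1 ba0; have bsb := ess_bounded_s_bar bb1 bb0.
have bz : ess_bounded lam O z := ess_boundedB bsa bsb.
have bF : ess_bounded lam O (forcing_diff a b p q n).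
  exact: (ess_boundedD (ess_boundedZ _ bsb) (ess_boundedZ _ bz)).
have st := phi_residual_sq_integrable p a2 a1 a0.
have eqn := error_equation p a2 a1 a0 b2 b1 b0 rb.
have bd := ess_boundedB be2 be1.
have hJ := mass_identity oO fO dt0 V0 he1 he2 ne1 ne2 be1 be2 bF st eqn.
rewrite -hJ.
have hid := energy_identity oO fO dt0 he1 he2 ne1 ne2 be1 be2 bF st eqn.
rewrite /energy.
apply: (@step_algebra (\int[lam]_(x in O) (sb b n x * (e n.+1 x - e n x)))
  _ _ _ _ _ _ _ _ _ (mid rho n) (rho n) (rho n.+1) (r_residual O g2 C0 a p n)
  (mid p n) hid) => //.
  have h := @Rintegral_linD _ _ _ lam O mO (2 * mid rho n) _ _ _
    (iB (ess_boundedM bsb bd)) (iB (ess_boundedZ (2 * mid p n) (ess_boundedM bz bd)))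
    (RintegralZl (2 * mid p n) mO (iB (ess_boundedM bz bd))).
  apply: etrans h; apply: eq_Rintegral => x _.
  by rewrite /forcing_diff mulrDl !mulrA.
have hr : rho n.+1 - rho n = r_residual O g2 C0 a p n - r_residual O g2 C0 b q n +
    (\int[lam]_(x in O) (sb a n x * (a n.+1 x - a n x)) -
     \int[lam]_(x in O) (sb b n x * (b n.+1 x - b n x))).
  rewrite /r_residual /rho; move: (Rintegral _ _ _) (Rintegral _ _ _) => A B; ring.
rewrite hr rr subr0 addrC; congr (_ + _).
have bda := ess_boundedB ba2 ba1; have bdb := ess_boundedB bb2 bb1.
rewrite -(RintegralB mO (iB (ess_boundedM bsa bda)) (iB (ess_boundedM bsb bdb))).
(* With increments da and db, s_a da - s_b db = z da + s_b del: the error z meets the exact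
   increment, which is O(dt). *)
apply: etrans (RintegralD mO (iB (ess_boundedM bz bda)) (iB (ess_boundedM bsb bd))).
apply: eq_Rintegral => x _; rewrite /z /sbdiff /e.
by move: (sb a n x) (sb b n x) => s t; ring.
Qed.

(** In the energy identity with tau = 0 the pairing with the nonlinear term is exactly q_(n+1)^2 -
    q_n^2 by the equation for r, and the multiplier term vanishes by conservation of mass. The size
    of dt does not enter. *)
Lemma numerical_energy_decreases b q n :
  inH2 O (b n.+1) -> inH2 O (b n) -> inH2 O (b n.-1) ->
  neumann O (b n.+1) -> neumann O (b n) ->
  {ae lam, forall x, O x -> phi_residual O g1 g2 C0 dt b q n x = 0} ->
  r_residual O g2 C0 b q n = 0 ->
  energy (b n.+1) (q n.+1) <= energy (b n) (q n).
Proof.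
move=> b2 b1 b0 nb2 nb1 rb rr.
have bb2 := inH2_ess_bounded mO sO b2; have bb1 := inH2_ess_bounded mO sO b1.
have bb0 := inH2_ess_bounded mO sO b0.
have bs := ess_bounded_s_bar bb1 bb0; have bd := ess_boundedB bb2 bb1.
have bF := ess_boundedZ (2 * mid q n) bs.
have s0 := ess_bounded_sq_integrable mO fO (ess_bounded_cst lam O (0 : R)).
have eqn : {ae lam, forall x, O x -> (b n.+1 x - b n x) / dt =
     g1 * ((laplacian O (b n.+1) x + laplacian O (b n) x) / 2)
     - 2 * g2 * ((b n.+1 x + b n x) / 2) - 2 * mid q n * sb b n x
     + mean O (fun y => 2 * g2 * ((b n.+1 y + b n y) / 2) + 2 * mid q n * sb b n y)
     + 0}.
  apply: aeS (filterI (phi_residual_equation q b2 b1) rb) => x [+ h] Ox.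
  by move=> /(_ Ox); rewrite (h Ox).
have hJ := mass_identity oO fO dt0 V0 b1 b2 nb1 nb2 bb1 bb2 bF s0 eqn.
have := energy_identity oO fO dt0 b1 b2 nb1 nb2 bb1 bb2 bF s0 eqn.
have I0 : \int[lam]_(x in O) ((fun=> 0) x : R) = 0 by rewrite Rintegral_cst// mul0r.
rewrite hJ I0 mulr0 mulr0 addr0.
have -> : \int[lam]_(x in O) ((fun=> 0) x * (b n.+1 x - b n x)) = 0.
  by rewrite -[RHS]I0; apply: eq_Rintegral => x _; rewrite mul0r.
have -> : \int[lam]_(x in O) (2 * mid q n * sb b n x * (b n.+1 x - b n x)) =
    (q n.+1 + q n) * (q n.+1 - q n).
  have -> : q n.+1 - q n = \int[lam]_(x in O) (sb b n x * (b n.+1 x - b n x)).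
    by apply/eqP; rewrite -subr_eq0; apply/eqP; exact: rr.
  rewrite -(RintegralZl _ mO (iB (ess_boundedM bs bd))).
  by apply: eq_Rintegral => x _; rewrite /mid; field.
have := Rintegral_sqr_ge0 lam O (fun x => b n.+1 x - b n x).
rewrite /energy; move: (\int[lam]_(x in O) ((b n.+1 x - b n x) ^+ 2)) => D D0.
move: (grad_sq O (b n.+1)) (grad_sq O (b n)) => G1 G0.
move: (\int[lam]_(x in O) (b n.+1 x ^+ 2)) (\int[lam]_(x in O) (b n x ^+ 2)) => A1 A0 h.
have : 0 <= D / dt by rewrite divr_ge0// ltW.
by move: (D / dt) h => {D D0} D h D0; move: (q n.+1) (q n) h => y z h; nra.
Qed.

End scheme_identities.

(** * Integral inequalities for the error terms *)

Section weighted_integrals.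
Context d (T : measurableType d) (R : realType).
Variables (mu : {measure set T -> \bar R}) (D : set T).
Hypotheses (mD : measurable D) (fD : (mu D < +oo)%E).
Implicit Types (e f g u v : T -> R).

Let iB f := @ess_bounded_integrable _ _ _ mu D mD fD f.

Let le_int f g : ess_bounded mu D f -> ess_bounded mu D g ->
  {ae mu, forall x, D x -> f x <= g x} ->
  \int[mu]_(x in D) f x <= \int[mu]_(x in D) g x.
Proof. by move=> bf bg; exact: (ae_le_Rintegral mD (iB bf) (iB bg)). Qed.

Lemma Rintegral_abs_lin2 (j k : R) g u v : ess_bounded mu D u -> ess_bounded mu D v ->
  ess_bounded mu D g ->
  \int[mu]_(x in D) (`|j * u x + k * v x| * `|g x|) <=
  `|j| * \int[mu]_(x in D) (`|u x| * `|g x|) + `|k| * \int[mu]_(x in D) (`|v x| * `|g x|).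
Proof.
move=> bu bv bg; have ng := ess_bounded_norm bg.
have ug := ess_boundedM (ess_bounded_norm bu) ng.
have vg := ess_boundedM (ess_bounded_norm bv) ng.
rewrite -(RintegralZl `|j| mD (iB ug)) -(RintegralZl `|k| mD (iB vg)).
rewrite -(RintegralD mD (iB (ess_boundedZ _ ug)) (iB (ess_boundedZ _ vg))).
apply: le_int.
- by apply: ess_boundedM => //; apply/ess_bounded_norm/ess_boundedD; exact: ess_boundedZ.
- by apply: ess_boundedD; exact: ess_boundedZ.
apply: aeW => x Dx; rewrite !mulrA -mulrDl -(normrM j) -(normrM k).
by rewrite ler_wpM2r// ler_normD.
Qed.

Lemma normr_Rintegral_le_abs u : ess_bounded mu D u ->
  `|\int[mu]_(x in D) u x| <= \int[mu]_(x in D) `|u x|.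
Proof. by move=> bu; exact: (le_normr_Rintegral mD (iB bu)). Qed.

Lemma normr_RintegralM_le u f : ess_bounded mu D u -> ess_bounded mu D f ->
  `|\int[mu]_(x in D) (u x * f x)| <= \int[mu]_(x in D) (`|u x| * `|f x|).
Proof.
move=> bu bf; apply: le_trans (normr_Rintegral_le_abs (ess_boundedM bu bf)) _.
by rewrite le_eqVlt; apply/orP; left; apply/eqP/eq_Rintegral => x _; rewrite normrM.
Qed.

Lemma Rintegral_abs_mulr1 u :
  \int[mu]_(x in D) `|u x| = \int[mu]_(x in D) (`|u x| * `|(fun=> 1 : R) x|).
Proof. by apply: eq_Rintegral => x _; rewrite normr1 mulr1. Qed.

Lemma normr_RintegralM_le_bound (B : R) u f : 0 <= B -> ess_bounded mu D u ->
  ess_bounded mu D f -> {ae mu, forall x, D x -> `|f x| <= B} ->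
  `|\int[mu]_(x in D) (u x * f x)| <= B * \int[mu]_(x in D) `|u x|.
Proof.
move=> B0 bu bf hf; apply: le_trans (normr_RintegralM_le bu bf) _.
rewrite -(RintegralZl B mD (iB (ess_bounded_norm bu))).
apply: le_int.
- exact: (ess_boundedM (ess_bounded_norm bu) (ess_bounded_norm bf)).
- exact/ess_boundedZ/ess_bounded_norm.
by move: hf; apply: filterS => x + Dx => /(_ Dx) h; rewrite mulrC ler_wpM2r.
Qed.

Lemma Rintegral_abs_lin (j k : R) u v : ess_bounded mu D u -> ess_bounded mu D v ->
  \int[mu]_(x in D) `|j * u x + k * v x| <=
  `|j| * \int[mu]_(x in D) `|u x| + `|k| * \int[mu]_(x in D) `|v x|.
Proof.
move=> bu bv; rewrite (Rintegral_abs_mulr1 u) (Rintegral_abs_mulr1 v).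
rewrite (Rintegral_abs_mulr1 (fun x => j * u x + k * v x)).
exact: Rintegral_abs_lin2 bu bv (ess_bounded_cst mu D 1).
Qed.

Lemma Rintegral_sqr_le u : sq_integrable mu D u ->
  (\int[mu]_(x in D) u x) ^+ 2 <= fine (mu D) * \int[mu]_(x in D) (u x ^+ 2).
Proof.
move=> su; have s1 := ess_bounded_sq_integrable mD fD (ess_bounded_cst mu D (1 : R)).
have := cauchy_schwarz_Rintegral mD s1 su.
have -> : \int[mu]_(x in D) (1 * u x) = \int[mu]_(x in D) u x.
  by apply: eq_Rintegral => x _; rewrite mul1r.
have -> : \int[mu]_(x in D) (1 ^+ 2) = fine (mu D) :> R; last by [].
by rewrite Rintegral_cst// expr1n mul1r.
Qed.

Lemma Rintegral_abs_le_cst (B : R) u : ess_bounded mu D u ->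
  {ae mu, forall x, D x -> `|u x| <= B} ->
  \int[mu]_(x in D) `|u x| <= B * fine (mu D).
Proof.
move=> bu h; rewrite -(Rintegral_cst mu mD B).
by apply: le_int => //; [exact: ess_bounded_norm|exact: ess_bounded_cst].
Qed.

End weighted_integrals.

(** * Absorption inequalities between real numbers *)

Section real_estimates.
Context {R : realType}.
Implicit Types (D H Q P w : R).

Lemma le_of_sqr_le (x y : R) : 0 <= y -> x ^+ 2 <= y ^+ 2 -> x <= y.
Proof.
move=> y0 xy; have [x0|/ltW x0] := leP 0 x; last exact: le_trans y0.
by rewrite -(ler_pXn2r (n := 2)).
Qed.

(** Here [P] stands for int e^2 del^2: Cauchy-Schwarz splits it into the fourth powers [Q] and [Qd],
    each bounded by the L^4 inequality. *)
Lemma cross_le (S H Hd P Q Qd : R) : 0 <= S -> 0 <= H -> 0 <= Hd -> 0 <= Q ->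
  P ^+ 2 <= Q * Qd -> Q <= S * H ^+ 2 -> Qd <= S * Hd ^+ 2 -> P <= S * (H * Hd).
Proof.
move=> S0 H0 Hd0 Q0 hP hQ hQd; apply: le_of_sqr_le; first by rewrite !mulr_ge0.
apply: le_trans hP _; have -> : (S * (H * Hd)) ^+ 2 = (S * H ^+ 2) * (S * Hd ^+ 2) by ring.
apply: (@le_trans _ _ (Q * (S * Hd ^+ 2))); first exact: ler_wpM2l.
by rewrite ler_wpM2r// mulr_ge0// sqr_ge0.
Qed.

(** With Young weight L / dt the part in |del|^2 is a fixed fraction of the dissipation, and the
    reciprocal weight supplies the factor dt in front of the errors. The cubic part carries no such
    factor; it obtains it from H <= dt. *)
Lemma pairing_absorb (Cs L S V Ce dt D H H1 H2 Hd N2 A Q P w : R) :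
  0 <= Cs -> 0 < L -> 0 <= S -> 0 <= V -> 0 <= Ce -> 0 < dt ->
  0 <= H -> 0 <= H1 -> 0 <= H2 -> 0 <= Hd ->
  w <= Cs * (2 * (L / dt) * D + ((4 * (L / dt))^-1 * (V * N2 + A) + 2^-1 * (Q + P))) ->
  N2 <= Ce * H -> A <= H -> Q <= S * H ^+ 2 -> P <= S * (H * Hd) ->
  Hd <= 2 * (H2 + H1) -> H <= dt ->
  w <= 2 * Cs * L * (D / dt) + dt * (Cs * ((V * Ce + 1) / (4 * L) + S)) * (H + H1 + H2).
Proof.
move=> Cs0 L0 S0 V0 Ce0 dt0 H0 H10 H20 Hd0 hw hN hA hQ hP hHd Hdt.
apply: le_trans hw _.
have -> : 2 * Cs * L * (D / dt) + dt * (Cs * ((V * Ce + 1) / (4 * L) + S)) * (H + H1 + H2) =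
  Cs * (2 * (L / dt) * D + (dt / (4 * L) * ((V * Ce + 1) * (H + H1 + H2)) +
    S * dt * (H + H1 + H2))) by field; rewrite !gt_eqF.
apply: ler_wpM2l => //; rewrite lerD2l; apply: lerD.
  have -> : (4 * (L / dt))^-1 = dt / (4 * L) by field; rewrite !gt_eqF.
  apply: ler_wpM2l; first by rewrite divr_ge0 ?mulr_ge0// ltW.
  have h1 : V * N2 <= V * (Ce * H) by rewrite ler_wpM2l.
  have := mulr_ge0 (mulr_ge0 V0 Ce0) (addr_ge0 H10 H20); lra.
have q1 : Q <= S * (dt * H).
  by rewrite (le_trans hQ)// ler_wpM2l// expr2 ler_wpM2r.
have p1 : P <= S * (dt * (2 * (H2 + H1))).
  rewrite (le_trans hP)// ler_wpM2l// ler_pM//.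
have := mulr_ge0 (mulr_ge0 S0 (ltW dt0)) H0; lra.
Qed.

(** In the application [Dd] is |del|^2/dt, [W] is (z, del), [X] is (z, dphi), [J] is int tau and [E]
    is (tau, del). Half of [Dd] is spent, a quarter on - 2 r W and a quarter on [E]; the other
    products are split into dt times squares. *)
Lemma step_combine (dt Dd W X res m J E Y0 Y1 r pm I Sg Rg Zg Mr M K V Cw Ci Cm : R) :
  0 < dt -> 0 <= Dd -> 0 < Mr -> 0 <= M -> 0 <= K -> 0 <= I ->
  Dd + Y1 = Y0 - 2 * r * W + 2 * pm * (X + res) + m * (dt * J) + E ->
  `|r| <= Mr -> `|W| <= 2 * ((16 * Mr)^-1 * Dd + dt * (2 * Cw * Sg)) ->
  `|X| <= M * dt * I -> I ^+ 2 <= Ci * Sg -> `|res| <= K * dt ^+ 3 -> pm ^+ 2 <= Rg ->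
  m ^+ 2 <= Cm * Zg -> J ^+ 2 <= V * (K * dt ^+ 2) ^+ 2 ->
  E <= Dd / 4 + dt * (K * dt ^+ 2) ^+ 2 ->
  Y1 <= Y0 + dt * (8 * Mr * Cw * Sg + 2 * Rg + M ^+ 2 * (Ci * Sg) + Cm * Zg)
        + (2 * K ^+ 2 + V * K ^+ 2) * dt ^+ 5.
Proof.
move=> dt0 Dd0 Mr0 M0 K0 I0 hid hr hW hX hI hres hpm hm hJ hE.
have t1 : - (r * W) <= Mr * (2 * ((16 * Mr)^-1 * Dd + dt * (2 * Cw * Sg))).
  by apply: le_trans (ler_norm _) _; rewrite normrN normrM ler_pM.
have t1' : Mr * (2 * ((16 * Mr)^-1 * Dd + dt * (2 * Cw * Sg))) =
   Dd / 8 + dt * (4 * Mr * Cw * Sg) by field; rewrite gt_eqF.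
have t2 : pm * X <= `|pm| * (M * dt * I).
  by apply: le_trans (ler_norm _) _; rewrite normrM ler_wpM2l.
have t3 : pm * res <= `|pm| * (K * dt ^+ 3).
  by apply: le_trans (ler_norm _) _; rewrite normrM ler_wpM2l.
have y2 : 2 * (`|pm| * (M * dt * I)) <= dt * (pm ^+ 2 + M ^+ 2 * I ^+ 2).
  rewrite -(real_normK (num_real pm)) -subr_ge0.
  rewrite (_ : _ - _ = dt * (`|pm| - M * I) ^+ 2); last by ring.
  by rewrite mulr_ge0 ?sqr_ge0// ltW.
have y3 : 2 * (`|pm| * (K * dt ^+ 3)) <= dt * (pm ^+ 2 + K ^+ 2 * dt ^+ 4).
  rewrite -(real_normK (num_real pm)) -subr_ge0.
  rewrite (_ : _ - _ = dt * (`|pm| - K * dt ^+ 2) ^+ 2); last by ring.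
  by rewrite mulr_ge0 ?sqr_ge0// ltW.
have y4 : m * (dt * J) <= dt * (m ^+ 2 + J ^+ 2).
  have -> : m * (dt * J) = dt * (m * J) by ring.
  by rewrite ler_wpM2l ?(ltW dt0)//; have := sqr_ge0 (m - J); have := sqr_ge0 (m + J); lra.
have z1 : dt * (pm ^+ 2 + M ^+ 2 * I ^+ 2) <= dt * (Rg + M ^+ 2 * (Ci * Sg)).
  by rewrite ler_wpM2l ?(ltW dt0)// lerD// ler_wpM2l ?sqr_ge0.
have z2 : dt * (pm ^+ 2 + K ^+ 2 * dt ^+ 4) <= dt * (Rg + K ^+ 2 * dt ^+ 4).
  by rewrite ler_wpM2l ?(ltW dt0)// lerD2r.
have z3 : dt * (m ^+ 2 + J ^+ 2) <= dt * (Cm * Zg + V * (K * dt ^+ 2) ^+ 2).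
  by rewrite ler_wpM2l ?(ltW dt0)// lerD.
rewrite t1' in t1.
clear -hid t1 t2 t3 y2 y3 y4 z1 z2 z3 hE Dd0.
have hY : Y1 <= Y0 + 2 * (- (r * W)) + 2 * (pm * X) + 2 * (pm * res) + m * (dt * J) + E - Dd.
  by lra.
apply: le_trans hY _.
have -> : Y0 + dt * (8 * Mr * Cw * Sg + 2 * Rg + M ^+ 2 * (Ci * Sg) + Cm * Zg) +
  (2 * K ^+ 2 + V * K ^+ 2) * dt ^+ 5 =
  Y0 + 2 * (dt * (4 * Mr * Cw * Sg)) + dt * (Rg + M ^+ 2 * (Ci * Sg)) +
  dt * (Rg + K ^+ 2 * dt ^+ 4) + dt * (Cm * Zg + V * (K * dt ^+ 2) ^+ 2) +
  dt * (K * dt ^+ 2) ^+ 2 by ring.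
lra.
Qed.

End real_estimates.

(** * Stability of one step of the error *)

Section step_estimate.
Context {R : realType}.
Variable O : set (plane R).
Hypotheses (oO : open (O : set (R * R))) (fO : (leb2 R O < +oo)%E).
Hypotheses (V0 : 0 < vol O) (sO : sobolev_Loo O).
Variable S : R.
Hypotheses (S0 : 0 < S) (hS : forall u, inH1 O u -> ess_bounded (leb2 R) O u ->
  \int[leb2 R]_(x in O) (u x ^+ 4) <=
  S * \int[leb2 R]_(x in O) (u x ^+ 2) * H1sq O u).
Variables (g1 g2 M c Mr K : R).
Hypotheses (g20 : 0 < g2) (M0 : 0 < M) (c0 : 0 < c) (Mr0 : 0 < Mr) (K0 : 0 <= K).
Local Notation lam := (leb2 R).
Local Notation V := (vol O).

Let mO : measurable O := open_plane_measurable oO.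
Let iB f := @ess_bounded_integrable _ _ _ lam O mO fO f.

Lemma Rintegral_sqr_le_H1sq (u : plane R -> R) :
  \int[lam]_(x in O) (u x ^+ 2) <= H1sq O u.
Proof. by rewrite H1sqE lerDl grad_sq_ge0. Qed.

Lemma Rintegral_pow4_le (u : plane R -> R) : inH1 O u -> ess_bounded lam O u ->
  \int[lam]_(x in O) (u x ^+ 4) <= S * H1sq O u ^+ 2.
Proof.
move=> hu bu; apply: le_trans (hS hu bu) _.
rewrite -mulrA ler_wpM2l ?(ltW S0)// expr2 ler_wpM2r ?H1sq_ge0//.
exact: Rintegral_sqr_le_H1sq.
Qed.

Lemma eta_sqr_le_H1sq (u : plane R -> R) : inH1 O u -> ess_bounded lam O u ->
  H1sq O u <= 1 -> eta lam O u ^+ 2 <= (2 * V + 2 * S ^+ 2) * H1sq O u.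
Proof.
move=> hu bu H1; apply: (eta_sqr_le mO fO bu (ltW S0) _ H1 (hS hu bu)).
exact: Rintegral_sqr_le_H1sq.
Qed.

Lemma le_1Dsqr (x : R) : x <= 1 + x ^+ 2.
Proof. by have := sqr_ge0 (x - 1); have := sqr_ge0 x; nra. Qed.

Lemma extrap_sqr_le (I j1 j0 : R) : 0 <= I -> I <= 3 / 2 * j1 + 1 / 2 * j0 ->
  I ^+ 2 <= 5 * (j1 ^+ 2 + j0 ^+ 2).
Proof.
move=> I0 hI; apply: (@le_trans _ _ ((3 / 2 * j1 + 1 / 2 * j0) ^+ 2)).
  by rewrite lerXn2r ?nnegrE ?(le_trans I0 hI).
by have := sqr_ge0 (j1 - j0); have := sqr_ge0 j1; have := sqr_ge0 j0; nra.
Qed.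

(** The second bound is not small; it serves to bound the extrapolated numerical s in L^1. *)
Lemma extrap_bound (I j1 j0 C h1 h0 h2 : R) : 0 <= I ->
  I <= 3 / 2 * j1 + 1 / 2 * j0 -> j1 ^+ 2 <= C * h1 -> j0 ^+ 2 <= C * h0 ->
  0 <= C -> 0 <= h2 -> h1 <= 1 -> h0 <= 1 ->
  I ^+ 2 <= 5 * C * (h0 + h1 + h2) /\ I <= 1 + 2 * (5 * C).
Proof.
move=> I0 hI i1 i0 C0 h20 h11 h01; have h := extrap_sqr_le I0 hI; split.
  by have := mulr_ge0 C0 h20; lra.
apply: le_trans (le_1Dsqr I) _; rewrite lerD2l.
have := ler_wpM2l C0 h11; have := ler_wpM2l C0 h01; lra.
Qed.

Lemma sums_le (x0 x1 x2 y0 y1 y2 : R) :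
  0 <= x0 -> 0 <= x1 -> 0 <= x2 -> 0 <= y0 -> 0 <= y1 -> 0 <= y2 ->
  [/\ x0 + x1 + x2 <= (x2 + y2) + (x1 + y1) + (x0 + y0),
     y2 + y1 <= (x2 + y2) + (x1 + y1) + (x0 + y0) &
     0 <= (x2 + y2) + (x1 + y1) + (x0 + y0)].
Proof. by move=> *; split; lra. Qed.

Lemma pairing_sum (al dC w1 w0 Wz Dd h2 h1 h0 : R) :
  0 <= dC -> 0 <= h0 -> 0 <= h1 -> 0 <= h2 ->
  Wz <= 3 / 2 * w1 + 1 / 2 * w0 -> w1 <= al * Dd + dC * (h1 + h1 + h2) ->
  w0 <= al * Dd + dC * (h0 + h1 + h2) ->
  Wz <= 2 * (al * Dd + 2 * dC * (h0 + h1 + h2)).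
Proof.
move=> d0 p0 p1 p2; have := mulr_ge0 d0 p0; have := mulr_ge0 d0 p1.
have := mulr_ge0 d0 p2; lra.
Qed.

Lemma absorb_constants (Y0 dt k1 k2 Cm k3 Sg Rg Zg d5 t1 t2 : R) : 0 < dt -> 0 <= d5 ->
  0 <= k1 -> 0 <= k2 -> 0 <= Cm -> 0 <= k3 -> 0 <= Zg -> Sg <= Zg -> Rg <= Zg ->
  t1 = k1 * Sg -> t2 = k2 * Sg ->
  Y0 + dt * (t1 + 2 * Rg + t2 + Cm * Zg) + k3 * d5 <=
  Y0 + (k1 + 2 + k2 + Cm + k3) * dt * Zg + (k1 + 2 + k2 + Cm + k3) * d5.
Proof.
move=> dt0 d50 k10 k20 Cm0 k30 Z0 SZ RZ -> ->; apply: lerD; last first.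
  by apply: ler_wpM2r => //; lra.
rewrite lerD2l [_ * dt]mulrC -mulrA ler_pM2l//.
by have := ler_wpM2l k10 SZ; have := ler_wpM2l k20 SZ; have := mulr_ge0 k30 Z0; lra.
Qed.

Lemma extrap_norm_le (y1 y0 C : R) : `|y1| <= C -> `|y0| <= C ->
  `|3 / 2 * y1 - 1 / 2 * y0| <= 2 * C.
Proof. by rewrite !ler_norml => /andP[? ?] /andP[? ?]; apply/andP; split; lra. Qed.

Lemma abs_lin_combine (g X Y j2 j1 al be y I w : R) : 0 < g ->
  X <= `|1| * j2 + `|1| * j1 -> Y <= `|2 * al| * y + `|2 * be| * I ->
  `|be| <= w -> 0 <= I ->
  `|g| * X + `|1| * Y <= g * (j2 + j1) + 2 * `|al| * y + 2 * w * I.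
Proof.
move=> g0; rewrite !normr1 !mul1r (gtr0_norm g0) !normrM (ger0_norm (ler0n _ 2)).
move=> hX hY hb I0; rewrite -addrA; apply: lerD; first by rewrite ler_pM2l.
by apply: le_trans hY _; rewrite lerD2l ler_wpM2r// ler_pM2l.
Qed.

Lemma half_sum_sqr_le (x y : R) : ((x + y) / 2) ^+ 2 <= x ^+ 2 + y ^+ 2.
Proof. by have := sqr_ge0 (x - y); have := sqr_ge0 x; have := sqr_ge0 y; nra. Qed.

Lemma sum_sqr_le (v x y hx hy h : R) : x ^+ 2 <= v * hx -> y ^+ 2 <= v * hy ->
  0 <= v * h -> (x + y) ^+ 2 <= 2 * (v * (h + hy + hx)).
Proof. by have := sqr_ge0 (x - y); nra. Qed.

(** The L^1 norm [y] of the numerical s is bounded and not small, but it is multiplied by the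
    midpoint error [pm] of r, so that the square of each of the three terms is of the order of
    [Zg]. *)
Lemma mean_algebra (v m g x y B w pm I Ci Sg Rg Zg j : R) : 0 < v -> 0 <= g ->
  `|v * m| <= g * x + 2 * `|pm| * y + 2 * w * I ->
  0 <= x -> x ^+ 2 <= 2 * (v * Sg) -> 0 <= y -> y <= B -> 0 <= w -> 0 <= I ->
  I ^+ 2 <= Ci * Sg ->
  pm ^+ 2 <= Rg -> Sg <= Zg -> Rg <= Zg -> 0 <= Ci ->
  m ^+ 2 <= (3 * (2 * g ^+ 2 * v + 4 * B ^+ 2 + 4 * w ^+ 2 * Ci)) / v ^+ 2 * Zg.
Proof.
move=> v0 g0 hm x0 hx y0 yB w0 I0 hI hpm SZ RZ Ci0.
rewrite mulrAC ler_pdivlMr ?exprn_gt0//.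
rewrite [m ^+ 2 * _]mulrC -exprMn -real_normK ?num_real//.
have h1 : `|v * m| ^+ 2 <= (g * x + 2 * `|pm| * y + 2 * w * I) ^+ 2.
  by rewrite lerXn2r ?nnegrE ?(le_trans (normr_ge0 _) hm).
apply: le_trans h1 _.
have sq3 (t u z : R) : (t + u + z) ^+ 2 <= 3 * (t ^+ 2 + u ^+ 2 + z ^+ 2).
  have := sqr_ge0 (t - u); have := sqr_ge0 (t - z); have := sqr_ge0 (u - z); nra.
apply: le_trans (sq3 _ _ _) _; rewrite -[X in _ <= X]mulrA ler_pM2l//.
rewrite !exprMn real_normK ?num_real//.
have t1 : g ^+ 2 * x ^+ 2 <= 2 * g ^+ 2 * v * Zg.
  have -> : 2 * g ^+ 2 * v * Zg = g ^+ 2 * (2 * (v * Zg)) by ring.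
  rewrite ler_wpM2l ?sqr_ge0// (le_trans hx)// ler_pM2l// ler_pM2l//.
have t2 : 2 ^+ 2 * pm ^+ 2 * y ^+ 2 <= 4 * B ^+ 2 * Zg.
  have -> : 4 * B ^+ 2 * Zg = 2 ^+ 2 * Zg * B ^+ 2 by ring.
  apply: ler_pM (mulr_ge0 (sqr_ge0 _) (sqr_ge0 _)) (sqr_ge0 _) _ _.
    by apply: ler_wpM2l; [exact: sqr_ge0|exact: le_trans hpm RZ].
  by rewrite lerXn2r ?nnegrE ?(le_trans y0 yB).
have t3 : 2 ^+ 2 * w ^+ 2 * I ^+ 2 <= 4 * w ^+ 2 * Ci * Zg.
  have -> : 4 * w ^+ 2 * Ci * Zg = 2 ^+ 2 * w ^+ 2 * (Ci * Zg) by ring.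
  by rewrite ler_wpM2l ?mulr_ge0 ?sqr_ge0// (le_trans hI)// ler_wpM2l.
by apply: le_trans (lerD (lerD t1 t2) t3) _; rewrite -!mulrDl.
Qed.

(** No smallness is asked of the error at n + 1: it appears on the right with a factor dt and is
    left to the discrete Gronwall inequality. The constants precede C0, dt and the sequences, hence
    are uniform in N. *)
Lemma step_estimate : exists C1 h1 : R, [/\ 0 < C1, 0 < h1 &
  forall (C0 dt : R) (a b : nat -> plane R -> R) (p q : nat -> R) (n : nat), 0 < dt ->
  inH2 O (a n.+1) -> inH2 O (a n) -> inH2 O (a n.-1) ->
  inH2 O (b n.+1) -> inH2 O (b n) -> inH2 O (b n.-1) ->
  neumann O (a n.+1) -> neumann O (a n) -> neumann O (b n.+1) -> neumann O (b n) ->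
  {ae lam, forall x, O x -> `|a n x| <= M} ->
  {ae lam, forall x, O x -> `|a n.-1 x| <= M} ->
  c <= E1 O g2 (a n) + C0 -> c <= E1 O g2 (a n.-1) + C0 ->
  {ae lam, forall x, O x -> `|a n.+1 x - a n x| <= M * dt} -> `|mid p n| <= Mr ->
  {ae lam, forall x, O x -> phi_residual O g1 g2 C0 dt b q n x = 0} ->
  r_residual O g2 C0 b q n = 0 ->
  \int[lam]_(x in O) (phi_residual O g1 g2 C0 dt a p n x ^+ 2) <= (K * dt ^+ 2) ^+ 2 ->
  `|r_residual O g2 C0 a p n| <= K * dt ^+ 3 ->
  let e k x := a k x - b k x in
  let rho k := p k - q k in
  let Z k := H1sq O (e k) + rho k ^+ 2 in
  H1sq O (e n) <= Num.min h1 dt -> H1sq O (e n.-1) <= Num.min h1 dt ->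
  energy O g1 g2 (e n.+1) (rho n.+1) <= energy O g1 g2 (e n) (rho n) +
    C1 * dt * (Z n.+1 + Z n + Z n.-1) + C1 * dt ^+ 5].
Proof.
have [h [Cs [h0 Cs0 hsf]]] := sfun_diff mO fO g20 M0 c0.
have V0' := ltW V0; have S0' := ltW S0; have Cs0' := ltW Cs0.
pose Ce := 2 * V + 2 * S ^+ 2.
have Ce0 : 0 < Ce by rewrite ltr_pwDl ?mulr_gt0// mulr_ge0// sqr_ge0.
(* The bound 1 makes eta^2 <= Ce H available, and then H <= h^2 / Ce gives eta <= h, as [sfun_diff]
   requires. *)
pose h1 := Num.min 1 (h ^+ 2 / Ce).
have h10 : 0 < h1 by rewrite lt_min ltr01 divr_gt0 ?exprn_gt0.
(* With Young weight L / dt the pairings of del with the two past levels use up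
   at most a quarter of the dissipation |del|^2 / dt. *)
pose L := (32 * Mr * Cs)^-1.
have L0 : 0 < L by rewrite invr_gt0 !mulr_gt0.
pose Cw := Cs * ((V * Ce + 1) / (4 * L) + S).
have Cw0 : 0 <= Cw.
  rewrite mulr_ge0// addr_ge0// divr_ge0// ?mulr_ge0 ?(ltW L0)//.
  by rewrite addr_ge0 ?mulr_ge0// ltW.
pose Ci0 := (Cs * (V + 2)) ^+ 2 * Ce.
have Ci00 : 0 <= Ci0 by rewrite mulr_ge0 ?sqr_ge0// ltW.
pose Ci := 5 * Ci0; have Ci_ge0 : 0 <= Ci by rewrite mulr_ge0.
(* An L^1 bound of the extrapolated numerical s: 2 Cs V for the exact one, 1 + 2 Ci for the
   difference. *)
pose B := 2 * Cs * V + (1 + 2 * Ci).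
pose Cm := (3 * (2 * g2 ^+ 2 * V + 4 * B ^+ 2 + 4 * Mr ^+ 2 * Ci)) / V ^+ 2.
have Cm0 : 0 <= Cm.
  apply: divr_ge0 (sqr_ge0 _); apply: mulr_ge0 => //; apply: addr_ge0; first apply: addr_ge0.
  - by apply: mulr_ge0 => //; apply: mulr_ge0 => //; exact: sqr_ge0.
  - by apply: mulr_ge0 => //; exact: sqr_ge0.
  - by apply: mulr_ge0 => //; apply: mulr_ge0 => //; exact: sqr_ge0.
pose C1 := 8 * Mr * Cw + 2 + M ^+ 2 * Ci + Cm + (2 * K ^+ 2 + V * K ^+ 2).
have k1 : 0 <= 8 * Mr * Cw by rewrite mulr_ge0// mulr_ge0// ltW.
have k2 : 0 <= M ^+ 2 * Ci by rewrite mulr_ge0// sqr_ge0.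
have k3 : 0 <= 2 * K ^+ 2 + V * K ^+ 2 by rewrite addr_ge0// mulr_ge0// sqr_ge0.
exists C1, h1; split => //; first by rewrite /C1; lra.
move=> C0 dt a b p q n dt0 a2 a1 a0 b2 b1 b0 na2 na1 nb2 nb1 Ma1 Ma0 c1 c0' Mda hmid rb rr
  htau hres e rho Z He1 He0.
have ba2 := inH2_ess_bounded mO sO a2; have ba1 := inH2_ess_bounded mO sO a1.
have ba0 := inH2_ess_bounded mO sO a0.
have bb2 := inH2_ess_bounded mO sO b2; have bb1 := inH2_ess_bounded mO sO b1.
have bb0 := inH2_ess_bounded mO sO b0.
have be2 : ess_bounded lam O (e n.+1) := ess_boundedB ba2 bb2.
have be1 : ess_bounded lam O (e n) := ess_boundedB ba1 bb1.
have be0 : ess_bounded lam O (e n.-1) := ess_boundedB ba0 bb0.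
have inH1B u v : inH2 O u -> inH2 O v -> inH1 O (fun x => u x - v x).
  move=> [hu _] [hv _].
  have -> : (fun x => u x - v x) = (fun x => 1 * u x + -1 * v x).
    by apply/funext => x; rewrite mul1r mulN1r.
  exact: inH1_lin.
have he2 : inH1 O (e n.+1) := inH1B _ _ a2 b2.
have he1 : inH1 O (e n) := inH1B _ _ a1 b1.
have he0 : inH1 O (e n.-1) := inH1B _ _ a0 b0.
pose del x := e n.+1 x - e n x.
have bdel : ess_bounded lam O del := ess_boundedB be2 be1.
have hdel : inH1 O del.
  rewrite (_ : del = (fun x => 1 * e n.+1 x + -1 * e n x)).
    exact: inH1_lin.
  by apply/funext => x; rewrite mul1r mulN1r.
have Hdel : H1sq O del <= 2 * (H1sq O (e n.+1) + H1sq O (e n)) := H1sq_lin_le oO he2 he1.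
have st := phi_residual_sq_integrable oO fO sO g1 g2 C0 dt p a2 a1 a0.
have hid := step_identity oO fO V0 sO dt0 p a2 a1 a0 b2 b1 b0 na2 na1 nb2 nb1 rb rr.
pose dk k x := Defs.sfun O g2 C0 (a k) x - Defs.sfun O g2 C0 (b k) x.
have bdk k : ess_bounded lam O (a k) -> ess_bounded lam O (b k) -> ess_bounded lam O (dk k).
  by move=> ha hb; apply: ess_boundedB; exact: ess_bounded_sfun.
have bd1 := bdk n ba1 bb1; have bd0 := bdk n.-1 ba0 bb0.
(* One past level of the extrapolation. Levels n and n - 1 are paired with the same del, so the
   errors at n and n + 1 enter the right-hand side in both cases. *)
have level k : ess_bounded lam O (a k) -> ess_bounded lam O (b k) -> inH1 O (e k) ->
    {ae lam, forall x, O x -> `|a k x| <= M} -> c <= E1 O g2 (a k) + C0 ->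
    H1sq O (e k) <= Num.min h1 dt ->
    [/\ H1sq O (e k) <= 1, H1sq O (e k) <= dt,
     (\int[lam]_(x in O) `|dk k x|) ^+ 2 <= Ci0 * H1sq O (e k),
     \int[lam]_(x in O) (`|dk k x| * `|del x|) <=
       2 * Cs * L * ((\int[lam]_(x in O) (del x ^+ 2)) / dt) +
       dt * Cw * (H1sq O (e k) + H1sq O (e n) + H1sq O (e n.+1)) &
     {ae lam, forall x, O x -> `|Defs.sfun O g2 C0 (a k) x| <= Cs}].
  move=> ha hb hek Mk ck; rewrite le_min => /andP[Hk Hkdt].
  have Hk1 : H1sq O (e k) <= 1 by apply: le_trans Hk _; rewrite ge_min lexx.
  have bek : ess_bounded lam O (e k) := ess_boundedB ha hb.
  have heta2 := eta_sqr_le_H1sq hek bek Hk1; rewrite -/Ce in heta2.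
  have heta : eta lam O (e k) <= h.
    apply: le_of_sqr_le; first exact: ltW.
    apply: le_trans heta2 _; rewrite -ler_pdivlMl// mulrC.
    by apply: le_trans Hk _; rewrite ge_min lexx orbT.
  have [hd hs] := hsf C0 (a k) (b k) ha hb Mk ck heta.
  split => //.
    have := Rintegral_abs_le_eta mO fO Cs0' bek (bdk k ha hb) hd.
    have I0 : 0 <= \int[lam]_(x in O) `|dk k x| by apply: Rintegral_ge0.
    move=> hI.
    apply: (@le_trans _ _ ((Cs * (V + 2) * eta lam O (e k)) ^+ 2)).
      by rewrite lerXn2r ?nnegrE ?(le_trans I0 hI).
    by rewrite exprMn /Ci0 -mulrA ler_wpM2l ?sqr_ge0.
  have Ldt0 : 0 < L / dt by rewrite divr_gt0.
  have hp := Rintegral_pairing_le mO fO Cs0' Ldt0 bek (bdk k ha hb) bdel hd.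
  apply: (pairing_absorb Cs0' L0 S0' V0' (ltW Ce0) dt0 _ _ _ _ hp heta2 _
    (Rintegral_pow4_le hek bek) _ Hdel Hkdt); do ?exact: H1sq_ge0.
    exact: Rintegral_sqr_le_H1sq.
  apply: (cross_le S0' (H1sq_ge0 _ _) (H1sq_ge0 _ _) _
    (Rintegral_sqr_cross mO fO bek bdel) (Rintegral_pow4_le hek bek)
    (Rintegral_pow4_le hdel bdel)).
  by apply: Rintegral_ge0 => x _; rewrite (exprM _ 2 2) sqr_ge0.
have [H11 H1dt i1 w1 s1] := level n ba1 bb1 he1 Ma1 c1 He1.
have [H01 H0dt i0 w0 s0] := level n.-1 ba0 bb0 he0 Ma0 c0' He0.
have zE : sbdiff O g2 C0 a b n = (fun x => 3 / 2 * dk n x + - (1 / 2) * dk n.-1 x).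
  by apply/funext => x; rewrite /sbdiff /s_bar /extrap /dk; ring.
have bsa := ess_bounded_s_bar g2 C0 ba1 ba0; have bsb := ess_bounded_s_bar g2 C0 bb1 bb0.
have bz : ess_bounded lam O (sbdiff O g2 C0 a b n) := ess_boundedB bsa bsb.
have abs32 : `|3 / 2 : R| = 3 / 2 by rewrite ger0_norm// divr_ge0.
have abs12 : `|- (1 / 2) : R| = 1 / 2 by rewrite normrN ger0_norm// divr_ge0.
have hW : \int[lam]_(x in O) (`|sbdiff O g2 C0 a b n x| * `|del x|) <=
    3 / 2 * \int[lam]_(x in O) (`|dk n x| * `|del x|) +
    1 / 2 * \int[lam]_(x in O) (`|dk n.-1 x| * `|del x|).
  by rewrite zE -{2}abs32 -{2}abs12; exact: (Rintegral_abs_lin2 mO fO).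
have hI : \int[lam]_(x in O) `|sbdiff O g2 C0 a b n x| <=
    3 / 2 * \int[lam]_(x in O) `|dk n x| + 1 / 2 * \int[lam]_(x in O) `|dk n.-1 x|.
  by rewrite zE -{2}abs32 -{2}abs12; exact: (Rintegral_abs_lin mO fO).
have I0 : 0 <= \int[lam]_(x in O) `|sbdiff O g2 C0 a b n x| by apply: Rintegral_ge0.
have hX := normr_RintegralM_le_bound mO fO (ltW (mulr_gt0 M0 dt0)) bz (ess_boundedB ba2 ba1) Mda.
have hWn := normr_RintegralM_le mO fO bz bdel.
have Iabs k : 0 <= \int[lam]_(x in O) `|dk k x| by apply: Rintegral_ge0.
pose Sg := H1sq O (e n.-1) + H1sq O (e n) + H1sq O (e n.+1).
have H2p := H1sq_ge0 O (e n.+1); have H1p := H1sq_ge0 O (e n); have H0p := H1sq_ge0 O (e n.-1).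
pose I := \int[lam]_(x in O) `|sbdiff O g2 C0 a b n x|.
have [hI2 Iup] : I ^+ 2 <= Ci * Sg /\ I <= 1 + 2 * Ci.
  exact: extrap_bound I0 hI i1 i0 Ci00 H2p H11 H01.
pose pm := mid rho n; pose Rg := rho n.+1 ^+ 2 + rho n ^+ 2.
have hpm : pm ^+ 2 <= Rg.
  exact: half_sum_sqr_le.
pose Zg := Z n.+1 + Z n + Z n.-1.
have r0p := sqr_ge0 (rho n.-1); have r1p := sqr_ge0 (rho n); have r2p := sqr_ge0 (rho n.+1).
have [SZ RZ Zg0] : [/\ Sg <= Zg, Rg <= Zg & 0 <= Zg].
  exact: sums_le H0p H1p H2p r0p r1p r2p.
have hSb : \int[lam]_(x in O) `|s_bar O g2 C0 b n x| <= B.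
  apply: (@le_trans _ _ (\int[lam]_(x in O) `|s_bar O g2 C0 a n x| + I)).
    have bna := ess_bounded_norm bsa; have bnz := ess_bounded_norm bz.
    rewrite -(RintegralD mO (iB bna) (iB bnz)).
    apply: (ae_le_Rintegral mO (iB (ess_bounded_norm bsb)) (iB (ess_boundedD bna bnz))).
    apply: aeW => x Ox; apply: le_trans (ler_normB _ _).
    by rewrite /sbdiff subKr.
  rewrite /B lerD//; apply: (Rintegral_abs_le_cst mO fO bsa).
  by apply: aeS (filterI s1 s0) => x [s1x s0x] Ox; exact: extrap_norm_le (s1x Ox) (s0x Ox).
pose m := mean O (fun y => 2 * g2 * ((e n.+1 y + e n y) / 2) +
  forcing_diff O g2 C0 a b p q n y).
pose J1 := \int[lam]_(x in O) `|e n x|; pose J2 := \int[lam]_(x in O) `|e n.+1 x|.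
have J10 : 0 <= J1 by apply: Rintegral_ge0.
have J20 : 0 <= J2 by apply: Rintegral_ge0.
have Sb0 : 0 <= \int[lam]_(x in O) `|s_bar O g2 C0 b n x| by apply: Rintegral_ge0.
have hVm : `|V * m| <= g2 * (J2 + J1) +
    2 * `|pm| * \int[lam]_(x in O) `|s_bar O g2 C0 b n x| + 2 * Mr * I.
  have -> : V * m = \int[lam]_(x in O) (g2 * (1 * e n.+1 x + 1 * e n x) +
      1 * (2 * pm * s_bar O g2 C0 b n x + 2 * mid p n * sbdiff O g2 C0 a b n x)).
    rewrite /m /mean mulrA mulfV; last by rewrite gt_eqF.
    rewrite mul1r; apply: eq_Rintegral => x _; rewrite /forcing_diff -/pm.
    move: (s_bar _ _ _ _ _ _) (sbdiff _ _ _ _ _ _ _) (e n.+1 x) (e n x) => {}Sb0 s t u.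
    by field.
  have bee := ess_boundedD (ess_boundedZ 1 be2) (ess_boundedZ 1 be1).
  have bfz := ess_boundedD (ess_boundedZ (2 * pm) bsb) (ess_boundedZ (2 * mid p n) bz).
  apply: le_trans (normr_Rintegral_le_abs mO fO
    (ess_boundedD (ess_boundedZ g2 bee) (ess_boundedZ 1 bfz))) _.
  apply: le_trans (Rintegral_abs_lin mO fO g2 1 bee bfz) _.
  exact: abs_lin_combine g20 (Rintegral_abs_lin mO fO 1 1 be2 be1)
    (Rintegral_abs_lin mO fO _ _ bsb bz) hmid I0.
have hj : (J2 + J1) ^+ 2 <= 2 * (V * Sg).
  have hj1 := Rintegral_abs_sqr_le mO fO be1; have hj2 := Rintegral_abs_sqr_le mO fO be2.
  have g1' := le_trans hj1 (ler_wpM2l V0' (Rintegral_sqr_le_H1sq (e n))).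
  have g2' := le_trans hj2 (ler_wpM2l V0' (Rintegral_sqr_le_H1sq (e n.+1))).
  exact: sum_sqr_le g2' g1' (mulr_ge0 V0' H0p).
have hm : m ^+ 2 <= Cm * Zg.
  exact: mean_algebra V0 (ltW g20) hVm (addr_ge0 J20 J10) hj Sb0 hSb
    (ltW Mr0) I0 hI2 hpm SZ RZ Ci_ge0.
pose D := \int[lam]_(x in O) (del x ^+ 2).
have D0 : 0 <= D := Rintegral_sqr_ge0 _ _ _.
have Dd0 : 0 <= D / dt by rewrite divr_ge0// ltW.
pose J := \int[lam]_(x in O) phi_residual O g1 g2 C0 dt a p n x.
have hJ : J ^+ 2 <= V * (K * dt ^+ 2) ^+ 2.
  by apply: le_trans (Rintegral_sqr_le mO fO st) _; rewrite ler_wpM2l.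
pose E := \int[lam]_(x in O) (phi_residual O g1 g2 C0 dt a p n x * del x).
(* Cauchy-Schwarz, then 4 x y <= (x + y)^2 with x = D / (4 dt) and y = dt (K dt^2)^2. *)
have hE : E <= D / dt / 4 + dt * (K * dt ^+ 2) ^+ 2.
  have := cauchy_schwarz_Rintegral mO st (ess_bounded_sq_integrable mO fO bdel).
  rewrite -/E -/D => hE; apply: le_of_sqr_le.
    exact: addr_ge0 (divr_ge0 Dd0 (ler0n _ 4)) (mulr_ge0 (ltW dt0) (sqr_ge0 _)).
  apply: le_trans hE _; apply: (@le_trans _ _ ((K * dt ^+ 2) ^+ 2 * D)).
    exact: ler_wpM2r.
  rewrite -subr_ge0 (_ : _ - _ = (D / dt / 4 - dt * (K * dt ^+ 2) ^+ 2) ^+ 2) ?sqr_ge0//.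
  by field; rewrite gt_eqF.
have h2Cs : 2 * Cs * L = (16 * Mr)^-1 by rewrite /L; field; rewrite !gt_eqF.
rewrite h2Cs -/D in w1 w0.
have hWf : `|\int[lam]_(x in O) (sbdiff O g2 C0 a b n x * del x)| <=
    2 * ((16 * Mr)^-1 * (D / dt) + dt * (2 * Cw * Sg)).
  apply: le_trans hWn _.
  have -> : dt * (2 * Cw * Sg) = 2 * (dt * Cw) * Sg by ring.
  exact: pairing_sum (mulr_ge0 (ltW dt0) Cw0) H0p H1p H2p hW w1 w0.
have := step_combine dt0 Dd0 Mr0 (ltW M0) K0 I0 hid hmid hWf hX hI2 hres hpm hm hJ hE.
move/le_trans; apply.
apply: (absorb_constants _ dt0 _ k1 k2 Cm0 k3 Zg0 SZ RZ erefl (mulrA _ _ _)).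
by rewrite exprn_ge0// ltW.
Qed.

End step_estimate.

(** * Convergence *)

Section auxiliary.
Context {R : realType}.

Lemma vol_gt0 (O : set (plane R)) : open (O : set (R * R)) -> O !=set0 ->
  (leb2 R O < +oo)%E -> 0 < vol O.
Proof.
move=> oO [p Op] fO.
have [[[a b] [c d]] /= cbO [/= px py]] : (\bigcup_(q in [set q : (rat * rat) * (rat * rat) |
      closed_box (ratr q.1.1) (ratr q.1.2) (ratr q.2.1) (ratr q.2.2) `<=` O])
    open_box (ratr q.1.1) (ratr q.1.2) (ratr q.2.1) (ratr q.2.2)) p.
  by rewrite -open_bigcup_rat_boxes.
move: (ratr a : R) (ratr b : R) (ratr c : R) (ratr d : R) cbO px py => {}a {}b {}c {}d cbO.
rewrite !in_itv/= => /andP[ap pb] /andP[cp pd].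
have ab : a < b := lt_trans ap pb; have cd : c < d := lt_trans cp pd.
apply: fine_gt0; rewrite fO andbT.
apply: (@lt_le_trans _ _ (leb2 R (open_box a b c d))); last first.
  apply: le_measure; rewrite ?inE; [exact: open_box_measurable|exact: open_plane_measurable|].
  by apply: subset_trans cbO; exact: open_sub_closed_box.
rewrite product_measure1E//= !lebesgue_measure_itv/= !lte_fin ab cd.
by rewrite -!EFinB -EFinM lte_fin mulr_gt0// subr_gt0.
Qed.

Lemma finite_uniform (P : nat -> R -> Prop) N :
  (forall n x y, x <= y -> P n x -> P n y) -> (forall n, exists x, P n x) ->
  exists x, forall n, (n <= N)%N -> P n x.
Proof.
move=> mono ex; elim: N => [|N [x hx]].
  by have [x hx] := ex 0%N; exists x => n; rewrite leqn0 => /eqP ->.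
have [y hy] := ex N.+1; exists (Num.max x y) => n; rewrite leq_eqVlt => /predU1P[->|].
  by apply: mono hy; rewrite le_max lexx orbT.
by rewrite ltnS => /hx; apply: mono; rewrite le_max lexx.
Qed.

(** The recursion is available only while two consecutive values lie below [th]. The induction keeps
    such a pair under a majorant whose final bound is itself assumed to be below [th], so each step
    licenses the next. *)
Lemma gronwall_bootstrap (C K1 dt T th : R) (N : nat) (Y : nat -> R) :
  0 <= C -> 0 <= K1 -> 0 < dt -> N%:R * dt = T -> 4 * C * dt <= 1 ->
  Y 0%N <= K1 * dt ^+ 4 -> Y 1%N <= K1 * dt ^+ 4 ->
  (forall n, (1 <= n < N)%N -> Y n <= th -> Y n.-1 <= th ->
    Y n.+1 <= Y n + C * dt * (Y n.+1 + Y n + Y n.-1) + C * dt ^+ 5) ->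
  (K1 + 2 * C * T) * expR (8 * C * T) * dt ^+ 4 <= th ->
  forall n, (n <= N)%N -> Y n <= (K1 + 2 * C * T) * expR (8 * C * T) * dt ^+ 4.
Proof.
move=> C0 K10 dt0 NT Cdt Y0 Y1 step hth.
pose x := C * dt; have x0 : 0 <= x by rewrite mulr_ge0// ltW.
have x4 : 4 * x <= 1 by rewrite /x mulrA.
(* The power is the discrete exponential; 2 C n dt accumulates the truncation, each step adding 2 C
   dt^5 before amplification. *)
pose B n := (K1 + 2 * C * (n%:R * dt)) * dt ^+ 4 * (1 + 8 * x) ^+ n.
have dt4 : 0 <= dt ^+ 4 by rewrite exprn_ge0// ltW.
have BT n : (n <= N)%N -> B n <= (K1 + 2 * C * T) * expR (8 * C * T) * dt ^+ 4.
  move=> nN; have nT : n%:R * dt <= T by rewrite -NT ler_pM2r// ler_nat.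
  have n0 : 0 <= n%:R * dt by rewrite mulr_ge0// ltW.
  have f1 : K1 + 2 * C * (n%:R * dt) <= K1 + 2 * C * T.
    by rewrite lerD2l ler_wpM2l// mulr_ge0.
  have f2 : (1 + 8 * x) ^+ n <= expR (8 * C * T).
    apply: (@le_trans _ _ (expR (8 * x) ^+ n)).
      by rewrite lerXn2r ?nnegrE ?expR_ge0 ?expR_ge1Dx// addr_ge0// mulr_ge0.
    rewrite -expRM_natl ler_expR.
    have -> : n%:R * (8 * x) = 8 * C * (n%:R * dt) by rewrite /x; ring.
    by rewrite ler_wpM2l// mulr_ge0.
  rewrite /B mulrAC ler_wpM2r//; apply: ler_pM => //.
    by rewrite addr_ge0// !mulr_ge0// ltW.
  by rewrite exprn_ge0// addr_ge0// mulr_ge0.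
have B0 n : 0 <= B n.
  rewrite /B; apply: mulr_ge0; last by rewrite exprn_ge0// addr_ge0// mulr_ge0.
  by apply: mulr_ge0 => //; rewrite addr_ge0// mulr_ge0 ?mulr_ge0// ltW.
have e5 : 0 <= C * dt ^+ 5 by rewrite mulr_ge0// exprn_ge0// ltW.
have BS n : B n * (1 + 8 * x) + 2 * (C * dt ^+ 5) <= B n.+1.
  have -> : B n.+1 = B n * (1 + 8 * x) + 2 * (C * dt ^+ 5) * (1 + 8 * x) ^+ n.+1.
    by rewrite /B -natr1 (exprS (1 + 8 * x)) /x; ring.
  rewrite lerD2l; apply: ler_peMr; first exact: mulr_ge0.
  by apply: exprn_ege1; rewrite lerDl mulr_ge0.
have BSle n : B n <= B n.+1.
  by apply: le_trans (BS n); have := mulr_ge0 (B0 n) x0; lra.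
suff key n : (n < N)%N -> Y n <= B n /\ Y n.+1 <= B n.+1.
  case=> [|n] nN; last by apply: le_trans (BT _ nN); have [] := key n nN.
  by apply: le_trans (BT 0%N _) => //; rewrite /B mul0r mulr0 addr0 expr0 mulr1.
elim: n => [|n ih] nN.
  have B00 : Y 0%N <= B 0%N by rewrite /B mul0r mulr0 addr0 expr0 mulr1.
  split => //; apply: le_trans Y1 (le_trans _ (BSle 0%N)).
  by rewrite /B mul0r mulr0 addr0 expr0 mulr1.
have [hn hn1] := ih (ltnW nN); split => //.
have hB : B n.+1 <= th := le_trans (BT _ (ltnW nN)) hth.
have := step n.+1 nN (le_trans hn1 hB) (le_trans (le_trans hn (BSle n)) hB).
rewrite -/x /= => hs; apply: le_trans (BS n.+1).
have hn' := le_trans hn (BSle n).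
have Bn0 := B0 n.+1.
move: (B n.+1) (Y n.+2) (Y n.+1) (Y n) (C * dt ^+ 5) hs hn' hn1 e5 Bn0 => b y2 y1 y0 s hs h0 h1 s0 b0.
(* The step is implicit: (1 - x) y2 <= (1 + x) y1 + x y0 + s. For 4 x <= 1, (1 + 2 x)/(1 - x) <= 1 +
   8 x and 1/(1 - x) <= 2. *)
have x1 : 0 < 1 - x by lra.
rewrite -(ler_pM2l x1).
have xb := mulr_ge0 x0 b0; have xs := mulr_ge0 x0 s0.
have q1 : x * y1 <= x * b by exact: ler_wpM2l.
have q0 : x * y0 <= x * b by exact: ler_wpM2l.
have q2 : 4 * x * (x * b) <= x * b by rewrite ler_piMl.
have q3 : 4 * x * s <= s by rewrite ler_piMl.
lra.
Qed.

Lemma error_of_energies (c V He Ha Hp Em W r s : R) : 0 < c -> 0 <= V -> 0 <= He ->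
  He <= 2 * (Ha + Hp) -> Ha + r ^+ 2 <= Em -> c * (Hp + s ^+ 2) <= W ->
  He + (r - s) ^+ 2 * V <= 2 * (Em + W / c) * (1 + V).
Proof.
move=> c0 V0 He0 hHe hE hW.
have {}hW : Hp + s ^+ 2 <= W / c by rewrite ler_pdivlMr// mulrC.
apply: (@le_trans _ _ ((He + (r - s) ^+ 2) * (1 + V))).
  by have := sqr_ge0 (r - s); have := mulr_ge0 He0 V0; lra.
rewrite ler_wpM2r ?addr_ge0//.
by have := sqr_ge0 (r + s); nra.
Qed.

Lemma small_step_conditions (C K c h dt : R) : 0 <= C -> 0 <= K -> 0 < c -> 0 < h -> 0 < dt ->
  dt * (1 + 4 * C + K / (c * h) + K / c) <= 1 ->
  [/\ dt <= 1, 4 * C * dt <= 1, K * dt <= c * h & K * dt <= c].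
Proof.
move=> C0 K0 c0 h0 dt0; have ch0 : 0 < c * h by rewrite mulr_gt0.
have t1 : 0 <= dt * (4 * C) by rewrite mulr_ge0 ?(ltW dt0)// mulr_ge0.
have t2 : 0 <= dt * (K / (c * h)) by rewrite mulr_ge0 ?(ltW dt0)// divr_ge0// ltW.
have t3 : 0 <= dt * (K / c) by rewrite mulr_ge0 ?(ltW dt0)// divr_ge0// ltW.
rewrite !mulrDr mulr1 => hq; split.
- lra.
- by rewrite mulrC; lra.
- by rewrite -[leRHS]mul1r -ler_pdivrMr// mulrAC mulrC; lra.
- by rewrite -[leRHS]mul1r -ler_pdivrMr// mulrAC mulrC; lra.
Qed.

(** One of the four powers of dt meets the step size conditions; the other three leave a factor at
    most 1 against h and at most dt against dt. *)
Lemma small_step_threshold (K c h dt : R) : 0 <= K -> 0 < c -> 0 < dt -> dt <= 1 ->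
  K * dt <= c * h -> K * dt <= c -> K * dt ^+ 4 <= c * Num.min h dt.
Proof.
move=> K0 c0 dt0 dt1 h1 h2; have dt' := ltW dt0.
have Kd : 0 <= K * dt by rewrite mulr_ge0.
have E : K * dt ^+ 4 = K * dt * dt ^+ 3 by ring.
rewrite E; case: (leP h dt) => _.
  by rewrite (le_trans _ h1)// ler_piMr// exprn_ile1.
apply: ler_pM => //; first by rewrite exprn_ge0.
by rewrite exprS ler_piMr// exprn_ile1.
Qed.

Lemma sqrt_le_1D (x y : R) : 0 <= x -> x <= y -> Num.sqrt x <= 1 + y.
Proof.
move=> x0 xy; apply: le_trans (le_1Dsqr _) _.
by rewrite sqr_sqrtr// lerD2l.
Qed.

Lemma mid_norm_le (p : nat -> R) (n : nat) (B : R) :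
  `|p n.+1| <= B -> `|p n| <= B -> `|mid p n| <= B.
Proof.
by rewrite /mid !ler_norml => /andP[? ?] /andP[? ?]; apply/andP; split; lra.
Qed.

Lemma step_to_energy (c C dt z2 z1 z0 y2 y1 y0 : R) : 0 < c -> 0 < C -> 0 < dt ->
  c * z2 <= y2 -> c * z1 <= y1 -> c * z0 <= y0 -> 0 <= y2 -> 0 <= y1 -> 0 <= y0 ->
  y1 + C * dt * (z2 + z1 + z0) + C * dt ^+ 5 <=
  y1 + (C / c + C) * dt * (y2 + y1 + y0) + (C / c + C) * dt ^+ 5.
Proof.
move=> c0 C0 dt0 h2 h1 h0 p2 p1 p0; have Cc : 0 <= C / c by rewrite divr_ge0// ltW.
apply: lerD; last first.
  by rewrite ler_wpM2r ?exprn_ge0 ?(ltW dt0)// lerDr.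
rewrite lerD2l; apply: (@le_trans _ _ (C / c * dt * (y2 + y1 + y0))); last first.
  rewrite ler_wpM2r ?addr_ge0// ler_wpM2r ?(ltW dt0)// lerDl; exact: ltW.
have -> : C * dt * (z2 + z1 + z0) = C / c * dt * (c * z2 + c * z1 + c * z0).
  by field; rewrite gt_eqF.
apply: ler_wpM2l; first exact: mulr_ge0 Cc (ltW dt0).
by apply: lerD => //; exact: lerD.
Qed.

(** The error of r is measured in L^2(O) as a constant function, which brings in the weight V = vol
    O. *)
Lemma weighted_error_le (c V h s B d4 : R) : 0 < c -> 0 <= V -> 0 <= h ->
  c * (h + s ^+ 2) <= B * d4 -> h + s ^+ 2 * V <= B / c * (1 + V) * d4.
Proof.
move=> c0 V0 h0 hB.
have {}hB : h + s ^+ 2 <= B / c * d4 by rewrite mulrAC ler_pdivlMr// mulrC.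
have -> : B / c * (1 + V) * d4 = B / c * d4 * (1 + V) by ring.
apply: (@le_trans _ _ ((h + s ^+ 2) * (1 + V))).
  by have := sqr_ge0 s; have := mulr_ge0 h0 V0; lra.
by rewrite ler_wpM2r ?addr_ge0.
Qed.

End auxiliary.

(** * Error bound over all steps and all N *)

Section convergence.
Context {R : realType}.
Variables (O : set (plane R)) (g1 g2 T C0 : R).
Variables (phi phit : R -> plane R -> R).
Variable Psi : R -> (plane R -> R) * R -> (plane R -> R) * R.
Hypotheses (hO : smooth_domain O) (hg1 : 0 < g1) (hg2 : 0 < g2) (hT : 0 < T).
Hypotheses (hphi : AC_solution O g1 g2 T C0 phi phit) (hreg : regular O T phi phit).
Hypothesis htrunc : truncation_O2 O g1 g2 T C0 phi.
Hypothesis hPsi : first_order O g2 T C0 phi Psi.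
Local Notation lam := (leb2 R).
Local Notation r := (rfun O g2 C0).

Let oO : open (O : set (R * R)). Proof. by have [[]] := hO. Qed.
Let mO : measurable O := open_plane_measurable oO.
Let fO : (lam O < +oo)%E.
Proof. by apply: bounded_plane_fin => //; have [[]] := hO. Qed.
Let V0 : 0 < vol O.
Proof. by apply: vol_gt0 => //; have [[]] := hO. Qed.
Let sO : sobolev_Loo O. Proof. by have [] := hO. Qed.

Let hphi2 t : 0 <= t <= T -> inH2 O (phi t).
Proof. by have [_ h _ _] := hphi; move=> /h[]. Qed.

Let c0 := Num.min (Num.min (g1 / 2) g2) 1.
Let c0_gt0 : 0 < c0.
Proof. by rewrite !lt_min divr_gt0// hg2 ltr01. Qed.

Lemma energy_ge (u : plane R -> R) (s : R) :
  c0 * (H1sq O u + s ^+ 2) <= energy O g1 g2 u s.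
Proof.
have := grad_sq_ge0 O u; have := Rintegral_sqr_ge0 lam O u; have := sqr_ge0 s.
have h1 : c0 <= g1 / 2 by rewrite /c0 !ge_min lexx.
have h2 : c0 <= g2 by rewrite /c0 !ge_min lexx orbT.
have h3 : c0 <= 1 by rewrite /c0 ge_min lexx orbT.
rewrite H1sqE /energy; move: (\int[lam]_(x in O) _) (grad_sq O u) (s ^+ 2) => A G s2 s0 A0 G0.
have := ler_wpM2r G0 h1; have := ler_wpM2r A0 h2; have := ler_wpM2r s0 h3.
by move: c0 => c; rewrite !mulrDr; lra.
Qed.

Lemma energy_nonneg (u : plane R -> R) (s : R) : 0 <= energy O g1 g2 u s.
Proof.
apply: le_trans (energy_ge u s).
by apply: mulr_ge0 (ltW c0_gt0) (addr_ge0 (H1sq_ge0 O u) (sqr_ge0 s)).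
Qed.

Lemma energy_le (u : plane R -> R) (s : R) :
  energy O g1 g2 u s <= (g1 / 2 + g2 + 1) * (H1sq O u + s ^+ 2).
Proof.
have := grad_sq_ge0 O u; have := Rintegral_sqr_ge0 lam O u; have := sqr_ge0 s.
rewrite H1sqE /energy; move: (\int[lam]_(x in O) _) (grad_sq O u) (s ^+ 2) => A G s2 s0 A0 G0.
have g1' := ltW hg1; have g2' := ltW hg2.
have := mulr_ge0 g1' A0; have := mulr_ge0 g1' s0.
by have := mulr_ge0 g2' G0; have := mulr_ge0 g2' s0; lra.
Qed.

Let time_in N k : (0 < N)%N -> (k <= N)%N -> 0 <= k%:R * (T / N%:R) <= T.
Proof.
move=> N0 kN; have N0' : 0 < N%:R :> R by rewrite ltr0n.
rewrite mulr_ge0 ?divr_ge0 ?(ltW hT)//= mulrCA ler_piMr ?(ltW hT)//.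
by rewrite ler_pdivrMr// mul1r ler_nat.
Qed.

Section scheme.
Variables (N : nat) (phin : nat -> plane R -> R) (rn : nat -> R).
Hypothesis N0 : (0 < N)%N.
Let dt := T / N%:R.
Hypotheses (hstart : LSAV_start O g2 C0 dt Psi (phi 0) phin rn)
  (hsteps : LSAV_steps O g1 g2 C0 dt N phin rn).

Let dt0 : 0 < dt. Proof. by rewrite divr_gt0// ltr0n. Qed.

Let e k x := phi (k%:R * dt) x - phin k x.
Let rho k := r (phi (k%:R * dt)) - rn k.

Lemma inH2_phin k : (k <= N)%N -> inH2 O (phin k).
Proof.
case: k => [_|k kN]; last by have [h _] := hsteps; have [] := h k.+1 kN.
by have [-> _ _] := hstart; apply: hphi2; rewrite lexx ltW.
Qed.

Lemma inH1_error k : (k <= N)%N -> inH1 O (e k).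
Proof.
move=> kN; have [h1 _] := inH2_phin kN; have [h2 _] := hphi2 (time_in N0 kN).
have -> : e k = (fun x => 1 * phi (k%:R * dt) x + -1 * phin k x).
  by apply/funext => x; rewrite mul1r mulN1r.
exact: inH1_lin.
Qed.

Lemma error_normE k : (k <= N)%N ->
  (H1norm O (phi (k%:R * dt) \- phin k)%R ^+ 2 + Lpnorm O 2%:E (cst (rho k)) ^+ 2)%E =
  (H1sq O (e k) + rho k ^+ 2 * vol O)%:E.
Proof.
by move=> kN; rewrite (H1norm_sqr mO (inH1_error kN)) (Lpnorm_cst_sqr _ mO fO).
Qed.

Lemma start_valueE : (phin 1%N, rn 1%N) = Psi dt (phi 0, r (phi 0)).
Proof. by have [e0 er ->] := hstart; rewrite er e0. Qed.

(** Both errors vanish at step 0, but [pd] of the zero function is a chosen representative and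
    vanishes almost everywhere only. *)
Lemma initial_error_eq0 : energy O g1 g2 (e 0) (rho 0%N) = 0.
Proof.
have [e0 er _] := hstart.
have -> : rho 0%N = 0 by rewrite /rho mul0r er e0 subrr.
have -> : e 0 = (fun=> 0) by apply/funext => x; rewrite /e mul0r e0 subrr.
have [hc pc] := inH1_cst 0 oO fO.
have I0 : \int[lam]_(x in O) ((fun=> 0) x : R) = 0 by rewrite Rintegral_cst// mul0r.
have H0 : H1sq O (fun=> 0) = 0.
  rewrite /H1sq [X in X + _](_ : _ = 0); last first.
    by rewrite -[RHS]I0; apply: eq_Rintegral => x _; rewrite expr0n.
  rewrite add0r big1// => i _; rewrite -[RHS]I0.
  have [_ [mp _]] := inH1_pd i mO hc.
  apply: (ae_eq_Rintegral mO) => //; first exact: measurable_funX.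
  by apply: aeS (pc i) => x + Ox => /(_ Ox) ->; rewrite expr0n.
have Z0 : H1sq O (fun=> 0) + 0 ^+ 2 = 0 by rewrite H0 expr0n addr0.
apply/eqP; rewrite eq_le; apply/andP; split.
  by apply: le_trans (energy_le _ _) _; rewrite Z0 mulr0.
by apply: le_trans (energy_ge _ _); rewrite Z0 mulr0.
Qed.

(** A local error K dt^2 in norm is of order dt^4 in energy, already the order of the final
    estimate; this is why a first order start suffices. The factor 1 / vol O turns the L^2 norm of a
    constant into its value. *)
Lemma first_step_error (K : R) : (forall dt, 0 < dt <= T ->
    let start := Psi dt (phi 0, r (phi 0)) in
    (H1norm O (phi dt \- start.1)%R + Lpnorm O 2%:E (cst (r (phi dt) - start.2)%R)
     <= (K * dt ^+ 2)%:E)%E) ->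
  energy O g1 g2 (e 1) (rho 1%N) <=
    (g1 / 2 + g2 + 1) * (K ^+ 2 * (1 + (vol O)^-1)) * dt ^+ 4.
Proof.
move=> hK; have dtT : 0 < dt <= T.
  by rewrite dt0 ler_pdivrMr ?ltr0n// ler_peMr ?ler1n// ltW.
have := hK dt dtT; rewrite /= -start_valueE /=.
have := inH1_error N0; rewrite /e /rho !mul1r => he.
rewrite (H1norm_sqrt mO he); set rr := r (phi dt) - rn 1%N.
have sc : sq_integrable lam O (cst rr).
  exact: (ess_bounded_sq_integrable mO fO (ess_bounded_cst lam O rr)).
rewrite (Lpnorm2E mO sc) -EFinD lee_fin.
have -> : \int[lam]_(x in O) (cst rr x ^+ 2) = rr ^+ 2 * vol O.
  exact: (Rintegral_cst lam mO (rr ^+ 2)).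
set H := H1sq O _ => hle.
have H0 : 0 <= H := H1sq_ge0 _ _.
have rV0 : 0 <= rr ^+ 2 * vol O by rewrite mulr_ge0 ?sqr_ge0// ltW.
have p1 := sqrtr_ge0 H; have p2 := sqrtr_ge0 (rr ^+ 2 * vol O).
have q1 : H <= (K * dt ^+ 2) ^+ 2.
  by rewrite -[X in X <= _](sqr_sqrtr H0) lerXn2r ?nnegrE//; lra.
have q2 : rr ^+ 2 * vol O <= (K * dt ^+ 2) ^+ 2.
  by rewrite -[X in X <= _](sqr_sqrtr rV0) lerXn2r ?nnegrE//; lra.
have q3 : rr ^+ 2 <= (K * dt ^+ 2) ^+ 2 * (vol O)^-1 by rewrite ler_pdivlMr.
apply: le_trans (energy_le _ _) _; rewrite -mulrA ler_wpM2l//.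
  by rewrite !addr_ge0// ?divr_ge0// ltW.
apply: le_trans (lerD q1 q3) _; rewrite le_eqVlt; apply/orP; left; apply/eqP; ring.
Qed.

End scheme.

(* Nothing is small here: the numerical energy is nonincreasing from step 1 on,
   and its value at step 1 is fixed by Psi and N. *)
Lemma error_bound_fixed_N N : (0 < N)%N -> exists C : R,
  forall (phin : nat -> plane R -> R) (rn : nat -> R),
  LSAV_start O g2 C0 (T / N%:R) Psi (phi 0) phin rn ->
  LSAV_steps O g1 g2 C0 (T / N%:R) N phin rn -> forall n, (n <= N)%N ->
  H1sq O (fun x => phi (n%:R * (T / N%:R)) x - phin n x) +
    (r (phi (n%:R * (T / N%:R))) - rn n) ^+ 2 * vol O <= C * (T / N%:R) ^+ 4.
Proof.
move=> N0; set dt := T / N%:R.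
have dt0 : 0 < dt by rewrite divr_gt0// ltr0n.
pose start := Psi dt (phi 0, r (phi 0)).
have [W0 hW0] : exists W, energy O g1 g2 (phi 0) (r (phi 0)) <= W /\
    energy O g1 g2 start.1 start.2 <= W.
  exists (Num.max (energy O g1 g2 (phi 0) (r (phi 0))) (energy O g1 g2 start.1 start.2)).
  by rewrite !le_max !lexx orbT.
have ex k : exists z, H1sq O (phi (k%:R * dt)) + r (phi (k%:R * dt)) ^+ 2 <= z.
  by eexists; exact: lexx.
have [Em hEm] := @finite_uniform R
  (fun k z => H1sq O (phi (k%:R * dt)) + r (phi (k%:R * dt)) ^+ 2 <= z) N
  (fun k x y xy h => le_trans h xy) ex.
pose Q := 2 * (Em + W0 / c0) * (1 + vol O).
(* With N fixed so is dt, and any bound is a multiple of dt^4. *)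
exists (Q / dt ^+ 4) => phin rn hs hst n nN.
rewrite divfK; last by rewrite gt_eqF// exprn_gt0.
have en k : (k <= N)%N -> energy O g1 g2 (phin k) (rn k) <= W0.
  have [e0 er _] := hs; have hsv := start_valueE hs; have [hin hres] := hst.
  elim: k => [_|[_ _|k ih kN]].
  - by rewrite er e0; case: hW0.
  - have [p1 r1] : phin 1%N = start.1 /\ rn 1%N = start.2 by rewrite /start -hsv.
    by rewrite p1 r1; case: hW0.
  have k1N : (1 <= k.+1 < N)%N by [].
  have [rb rr] := hres k.+1 k1N.
  apply: le_trans (ih (ltnW kN)).
  have [_ n2] := hin k.+2 kN; have [_ n1] := hin k.+1 (ltnW kN).
  apply: (numerical_energy_decreases oO fO V0 sO dt0 _ _ _ n2 n1 rb rr).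
  - exact: (inH2_phin hs hst).
  - exact: (inH2_phin hs hst (ltnW kN)).
  - exact: (inH2_phin hs hst (ltnW (ltnW kN))).
have h1 := le_trans (energy_ge _ _) (en n nN).
have h2 := hEm n nN.
have [hp _] := inH2_phin hs hst nN; have [he _] := hphi2 (time_in N0 nN).
have h3 := H1sq_lin_le oO he hp; rewrite -/dt in h3.
exact: error_of_energies c0_gt0 (ltW V0) (H1sq_ge0 _ _) h3 h2 h1.
Qed.

Lemma error_bound_large_N : exists C N0, forall N, (0 < N)%N -> (N0 <= N)%N ->
  forall (phin : nat -> plane R -> R) (rn : nat -> R),
  LSAV_start O g2 C0 (T / N%:R) Psi (phi 0) phin rn ->
  LSAV_steps O g1 g2 C0 (T / N%:R) N phin rn -> forall n, (n <= N)%N ->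
  H1sq O (fun x => phi (n%:R * (T / N%:R)) x - phin n x) +
    (r (phi (n%:R * (T / N%:R))) - rn n) ^+ 2 * vol O <= C * (T / N%:R) ^+ 4.
Proof.
have [M [c [M0 c_gt0 hM hlip hE]]] : exists M c, [/\ 0 < M, 0 < c,
    forall t, 0 <= t <= T -> {ae lam, forall x, O x -> `|phi t x| <= M},
    forall s t, 0 <= s -> s <= t -> t <= T ->
      {ae lam, forall x, O x -> `|phi t x - phi s x| <= M * (t - s)}
    & forall t, 0 <= t <= T -> c <= E1 O g2 (phi t) + C0 <= M].
  have [h1 h2 _ _] := hphi; have [[_ jm] _ _ hp _] := hreg.
  exact: exact_solution_bounds oO fO sO hg2 hT h1 h2 jm hp.
have [S [S0 hS]] : exists S, 0 < S /\ forall u, inH1 O u -> ess_bounded lam O u ->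
    \int[lam]_(x in O) (u x ^+ 4) <= S * \int[lam]_(x in O) (u x ^+ 2) * H1sq O u.
  by apply: (sobolev_L4_Rintegral mO fO); have [] := hO.
have [K0 hK0] := htrunc; pose K := `|K0|.
have [K1 hK1] := hPsi.
(* The bound for r = sqrt(E1 + C0), from sqrt y <= 1 + y and E1 + C0 <= M. *)
have Mr0 : 0 < 1 + M by rewrite addr_gt0.
have [C1 [h1 [C10 h10 hstep]]] :=
  step_estimate oO fO V0 sO S0 hS g1 hg2 M0 c_gt0 Mr0 (normr_ge0 K0).
pose C := C1 / c0 + C1.
have Cge0 : 0 <= C1 / c0 by rewrite divr_ge0 ?(ltW C10)// ltW.
have C_ge0 : 0 <= C by rewrite addr_ge0// ltW.
pose Ki := (g1 / 2 + g2 + 1) * (K1 ^+ 2 * (1 + (vol O)^-1)).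
have Ki0 : 0 <= Ki.
  apply: mulr_ge0; first by rewrite !addr_ge0// ?divr_ge0// ltW.
  by rewrite mulr_ge0 ?sqr_ge0// addr_ge0// invr_ge0 ltW.
pose K2 := (Ki + 2 * C * T) * expR (8 * C * T).
have K20 : 0 <= K2.
  by rewrite mulr_ge0 ?expR_ge0// addr_ge0// mulr_ge0 ?mulr_ge0// ltW.
(* The single condition dt q <= 1, that is N >= T q, packs four: dt <= 1, 4 C dt <= 1, K2 dt <= c0
   h1 and K2 dt <= c0. *)
pose q := 1 + 4 * C + K2 / (c0 * h1) + K2 / c0.
have k1 : 0 <= K2 / (c0 * h1) by rewrite divr_ge0// mulr_ge0// ltW.
have k2 : 0 <= K2 / c0 by rewrite divr_ge0// ltW.
have q0 : 0 <= T * q by rewrite mulr_ge0 ?(ltW hT)// !addr_ge0// mulr_ge0.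
exists (K2 / c0 * (1 + vol O)), (Num.bound (T * q)) => N N_gt0 NN phin rn hs hst.
set dt := T / N%:R in hs hst *.
have N0' : 0 < N%:R :> R by rewrite ltr0n.
have dt0 : 0 < dt by rewrite divr_gt0.
have dtq : dt * q <= 1.
  rewrite /dt mulrAC ler_pdivrMr// mul1r.
  by apply: (le_trans (ltW (archi_boundP q0))); rewrite ler_nat.
have [dt1 dt4 dth dtc] : [/\ dt <= 1, 4 * C * dt <= 1, K2 * dt <= c0 * h1 & K2 * dt <= c0].
  exact: small_step_conditions C_ge0 K20 c0_gt0 h10 dt0 dtq.
pose e k x := phi (k%:R * dt) x - phin k x.
pose rho k := r (phi (k%:R * dt)) - rn k.
pose Y k := energy O g1 g2 (e k) (rho k).
have NT : N%:R * dt = T by rewrite /dt mulrC divfK// gt_eqF.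
have hth : K2 * dt ^+ 4 <= c0 * Num.min h1 dt.
  exact: small_step_threshold K20 c0_gt0 dt0 dt1 dth dtc.
(* The Gronwall argument runs on the energy, whereas the step asks for a small H^1 norm; coercivity
   with constant [c0] translates the threshold. *)
have Hle k : Y k <= c0 * Num.min h1 dt -> H1sq O (e k) <= Num.min h1 dt.
  move=> hY; rewrite -(ler_pM2l c0_gt0); apply: le_trans hY; apply: le_trans (energy_ge _ _).
  by rewrite ler_pM2l// lerDl sqr_ge0.
have Y0 : Y 0%N <= Ki * dt ^+ 4.
  by rewrite /Y (initial_error_eq0 hs) mulr_ge0// exprn_ge0// ltW.
have Y1 : Y 1%N <= Ki * dt ^+ 4 := first_step_error N_gt0 hs hst hK1.
have tin k : (k <= N)%N -> 0 <= k%:R * dt <= T by exact: time_in.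
have Ystep n : (1 <= n < N)%N -> Y n <= c0 * Num.min h1 dt -> Y n.-1 <= c0 * Num.min h1 dt ->
    Y n.+1 <= Y n + C * dt * (Y n.+1 + Y n + Y n.-1) + C * dt ^+ 5.
  move=> /[dup] nN /andP[n0 nltN] hn hn1.
  have nN' := ltnW nltN; have n1N : (n.-1 <= N)%N := leq_trans (leq_pred n) nN'.
  have [hin hres] := hst; have [rb rr] := hres n nN.
  have [_ nb2] := hin n.+1 nltN.
  have [_ nb1] : inH2 O (phin n) /\ neumann O (phin n) by apply: hin; rewrite n0.
  (* The Neumann condition of the exact solution holds at positive times only. The step uses it at
     levels n and n + 1, and n >= 1. *)
  have npos k : (0 < k)%N -> (k <= N)%N -> neumann O (phi (k%:R * dt)).
    move=> k0 kN; have [_ _ hn' _] := hphi; apply: hn'.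
    by have /andP[_ ->] := tin k kN; rewrite mulr_gt0// ltr0n.
  pose a k := phi (k%:R * dt); pose p k := r (a k).
  have ha k : (k <= N)%N -> inH2 O (a k) by move=> /tin/hphi2.
  have hr k : (k <= N)%N -> `|p k| <= 1 + M.
    move=> kN; have /andP[l1 l2] := hE _ (tin k kN); rewrite /p /rfun ger0_norm ?sqrtr_ge0//.
    exact: sqrt_le_1D (le_trans (ltW c_gt0) l1) l2.
  have [htr hrr] := hK0 N n nN.
  have st := phi_residual_sq_integrable oO fO sO g1 g2 C0 dt p
    (ha n.+1 nltN) (ha n nN') (ha n.-1 n1N).
  have htau : \int[lam]_(x in O) (phi_residual O g1 g2 C0 dt a p n x ^+ 2) <=
      (K * dt ^+ 2) ^+ 2.
    have := htr; rewrite (Lpnorm2E mO st) lee_fin => h.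
    have I0 := Rintegral_sqr_ge0 lam O (phi_residual O g1 g2 C0 dt a p n).
    rewrite -[X in X <= _](sqr_sqrtr I0) lerXn2r ?nnegrE ?sqrtr_ge0//.
      exact: mulr_ge0 (normr_ge0 _) (sqr_ge0 _).
    by apply: le_trans h _; rewrite ler_wpM2r ?sqr_ge0// ler_norm.
  (* The truncation hypothesis bounds the residual of r divided by dt, which accounts for the third
     power. *)
  have hres3 : `|r_residual O g2 C0 a p n| <= K * dt ^+ 3.
    move: hrr; rewrite normrM normfV (gtr0_norm dt0) ler_pdivrMr// => /le_trans; apply.
    by rewrite -mulrA -exprSr ler_wpM2r ?exprn_ge0 ?(ltW dt0)// ler_norm.
  have lip : {ae lam, forall x, O x -> `|a n.+1 x - a n x| <= M * dt}.
    have /andP[s0 _] := tin n nN'; have /andP[_ tT] := tin n.+1 nltN.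
    have stt : n%:R * dt <= n.+1%:R * dt by rewrite ler_pM2r// ler_nat.
    have -> : M * dt = M * (n.+1%:R * dt - n%:R * dt) by rewrite -natr1; ring.
    exact: hlip.
  have hmid : `|mid p n| <= 1 + M.
    exact: mid_norm_le (hr n.+1 nltN) (hr n nN').
  have /andP[cn _] := hE _ (tin n nN'); have /andP[cn1 _] := hE _ (tin n.-1 n1N).
  have := hstep C0 dt a phin p rn n dt0 (ha n.+1 nltN) (ha n nN') (ha n.-1 n1N)
    (inH2_phin hs hst nltN) (inH2_phin hs hst nN') (inH2_phin hs hst n1N)
    (npos n.+1 (ltn0Sn n) nltN) (npos n n0 nN') nb2 nb1
    (hM _ (tin n nN')) (hM _ (tin n.-1 n1N)) cn cn1 lip hmid rb rr htau hres3
    (Hle n hn) (Hle n.-1 hn1).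
  move/le_trans; apply.
  exact: step_to_energy c0_gt0 C10 dt0 (energy_ge _ _) (energy_ge _ _) (energy_ge _ _)
    (energy_nonneg _ _) (energy_nonneg _ _) (energy_nonneg _ _).
have hY := gronwall_bootstrap C_ge0 Ki0 dt0 NT dt4 Y0 Y1 Ystep hth.
move=> n nN; have hYn := hY n nN; have he := le_trans (energy_ge _ _) hYn.
exact: weighted_error_le c0_gt0 (ltW V0) (H1sq_ge0 _ _) he.
Qed.

Lemma error_bound : exists C : R, forall N, (0 < N)%N ->
  forall (phin : nat -> plane R -> R) (rn : nat -> R),
  LSAV_start O g2 C0 (T / N%:R) Psi (phi 0) phin rn ->
  LSAV_steps O g1 g2 C0 (T / N%:R) N phin rn -> forall n, (n <= N)%N ->
  H1sq O (fun x => phi (n%:R * (T / N%:R)) x - phin n x) +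
    (r (phi (n%:R * (T / N%:R))) - rn n) ^+ 2 * vol O <= C * (T / N%:R) ^+ 4.
Proof.
have [C [N0 hC]] := error_bound_large_N.
pose P N x := (0 < N)%N -> forall (phin : nat -> plane R -> R) (rn : nat -> R),
  LSAV_start O g2 C0 (T / N%:R) Psi (phi 0) phin rn ->
  LSAV_steps O g1 g2 C0 (T / N%:R) N phin rn -> forall n, (n <= N)%N ->
  H1sq O (fun x => phi (n%:R * (T / N%:R)) x - phin n x) +
    (r (phi (n%:R * (T / N%:R))) - rn n) ^+ 2 * vol O <= x * (T / N%:R) ^+ 4.
have mono N x y : x <= y -> P N x -> P N y.
  move=> xy h N_gt0 phin rn hs hst n nN; apply: le_trans (h N_gt0 phin rn hs hst n nN) _.
  by apply: ler_wpM2r => //; rewrite exprn_ge0// divr_ge0// ltW.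
have ex N : exists x, P N x.
  have [->|N_gt0] := posnP N; first by exists 0.
  by have [x hx] := error_bound_fixed_N N_gt0; exists x => _.
have [C' hC'] := finite_uniform N0 mono ex.
exists (Num.max C C') => N N_gt0; have [NN|NN] := leqP N0 N.
  have CC : C <= Num.max C C' by rewrite le_max lexx.
  exact: mono CC (fun N_gt0 => hC N N_gt0 NN) N_gt0.
have CC : C' <= Num.max C C' by rewrite le_max lexx orbT.
exact: mono CC (hC' N (ltnW NN)) N_gt0.
Qed.

End convergence.

Theorem theorem4p4 (R : realType) (O : set (plane R)) (g1 g2 T C0 : R)
    (phi phit : R -> plane R -> R)
    (Psi : R -> (plane R -> R) * R -> (plane R -> R) * R)
    (hO : smooth_domain O) (hg1 : 0 < g1) (hg2 : 0 < g2) (hT : 0 < T)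
    (hC0 : forall u, inH2 O u -> - C0 <= E1 O g2 u)
    (hphi : AC_solution O g1 g2 T C0 phi phit)
    (hreg : regular O T phi phit)
    (htrunc : truncation_O2 O g1 g2 T C0 phi)
    (hPsi : first_order O g2 T C0 phi Psi) :
  exists C : R, forall (N : nat) (phin : nat -> plane R -> R) (rn : nat -> R),
    (0 < N)%N ->
    let dt := T / N%:R in
    LSAV_start O g2 C0 dt Psi (phi 0) phin rn ->
    LSAV_steps O g1 g2 C0 dt N phin rn ->
    forall n : nat, (n <= N)%N ->
      let e_phi := phi (n%:R * dt) \- phin n in
      let e_r := rfun O g2 C0 (phi (n%:R * dt)) - rn n in
      (H1norm O e_phi ^+ 2 + Lpnorm O 2%:E (cst e_r) ^+ 2
       <= (C * dt ^+ 4)%:E)%E.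
Proof.
have [C hC] := error_bound hO hg1 hg2 hT hphi hreg htrunc hPsi.
exists C => N phin rn N0 dt hs hst n nN.
cbv zeta; rewrite (error_normE hO hT hphi N0 hs hst nN) lee_fin.
exact: hC.
Qed.
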